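(* An undirected graph with $n$ vertices and $m$ edges can be preprocessed to build a data structure of $O(m\log n)$ size such that for any set $U$ of $k$ edge insertions (where $k\le n$), a DFS tree of $G+U$ can be reported in $O(n\log^3 n)$ time.
   Context: $G+U$ denotes the graph obtained from $G$ by inserting the edges in $U$. A DFS tree of an undirected graph rooted at $r$ is a rooted spanning tree in which every non-tree edge joins a vertex to one of its ancestors in the tree; to handle disconnected graphs, a dummy vertex $r$ adjacent to all vertices is added and the DFS tree is rooted at $r$. *)

(* Defs.v *)
From mathcomp Require Import all_boot.

Set Implicit Arguments.
Unset Strict Implicit.
Unset Printing Implicit Defensive.

(* A word RAM, as a while-language over finitely many registers and finitely many
    random-access arrays (only finitely many can occur in a given program).
    Every register and every array cell holds a [w]-bit word, array indices are
    words, and every operation on words has unit cost. *)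

Inductive binop := Add | Sub | Mul | Div | Mod | Lt | Eq.

Inductive expr :=
  | Lit of nat                    (* constant *)
  | Reg of nat                    (* register number *)
  | Cell of nat & expr            (* array number, index *)
  | Bin of binop & expr & expr.

Inductive cmd :=
  | Skip
  | SetReg of nat & expr          (* register := value *)
  | SetCell of nat & expr & expr  (* array[index] := value *)
  | Seq of cmd & cmd
  | If of expr & cmd & cmd
  | While of expr & cmd.

Record state := State { reg : nat -> nat; arr : nat -> nat -> nat }.

Definition wrap (w v : nat) : nat := v %% 2 ^ w.

(* Subtraction is modulo [2 ^ w].
   Division by zero yields [0], and [a mod 0 = a]. *)
Definition binop_eval (w : nat) (o : binop) (a b : nat) : nat :=
  wrap w (match o with
          | Add => a + b
          | Sub => a + (2 ^ w - b)
          | Mul => a * b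
          | Div => a %/ b
          | Mod => a %% b
          | Lt => a < b
          | Eq => a == b
          end).

Fixpoint eval (w : nat) (s : state) (e : expr) : nat :=
  match e with
  | Lit v => wrap w v
  | Reg x => reg s x
  | Cell a e1 => arr s a (eval w s e1)
  | Bin o e1 e2 => binop_eval w o (eval w s e1) (eval w s e2)
  end.

Fixpoint cost (e : expr) : nat :=
  match e with
  | Lit _ | Reg _ => 1
  | Cell _ e1 => (cost e1).+1
  | Bin _ e1 e2 => (cost e1 + cost e2).+1
  end.

Definition set_reg (s : state) (x v : nat) : state :=
  State (fun y => if y == x then v else reg s y) (arr s).

Definition set_cell (s : state) (a i v : nat) : state :=
  State (reg s)
        (fun b j => if (b == a) && (j == i) then v else arr s b j).

(* [exec w c s t s']: started in [s], the command [c] halts in [s'] after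
   exactly [t] steps. *)
Inductive exec (w : nat) : cmd -> state -> nat -> state -> Prop :=
  | exec_skip s : exec w Skip s 1 s
  | exec_reg s x e :
      exec w (SetReg x e) s (cost e).+1 (set_reg s x (eval w s e))
  | exec_cell s a e1 e2 :
      exec w (SetCell a e1 e2) s (cost e1 + cost e2).+1
           (set_cell s a (eval w s e1) (eval w s e2))
  | exec_seq c1 c2 s1 s2 s3 t1 t2 :
      exec w c1 s1 t1 s2 -> exec w c2 s2 t2 s3 ->
      exec w (Seq c1 c2) s1 (t1 + t2) s3
  | exec_if_true e c1 c2 s s' t :
      eval w s e != 0 -> exec w c1 s t s' ->
      exec w (If e c1 c2) s (cost e + t).+1 s'
  | exec_if_false e c1 c2 s s' t :
      eval w s e == 0 -> exec w c2 s t s' ->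
      exec w (If e c1 c2) s (cost e + t).+1 s'
  | exec_while_true e c s1 s2 s3 t1 t2 :
      eval w s1 e != 0 -> exec w c s1 t1 s2 ->
      exec w (While e c) s2 t2 s3 ->
      exec w (While e c) s1 (cost e + t1 + t2).+1 s3
  | exec_while_false e c s :
      eval w s e == 0 -> exec w (While e c) s (cost e).+1 s.

(* The i-th input list is placed in array [i], its length in register [i];
   everything else is initially zero. *)
Definition load (w : nat) (ins : seq (seq nat)) : state :=
  State (fun x => wrap w (size (nth [::] ins x)))
        (fun a i => wrap w (nth 0 (nth [::] ins a) i)).

(* The output is the prefix of array 0 whose length is in register 0. *)
Definition output (s : state) : seq nat := mkseq (arr s 0) (reg s 0).

Definition computes (w : nat) (c : cmd) (ins : seq (seq nat)) (out : seq nat)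
    (t : nat) : Prop :=
  exists s : state, exec w c (load w ins) t s /\ output s = out.

(* A simple undirected graph on [V] is given by its set of edges, which are
   two-element subsets of [V]. *)
Definition edge_set (V : finType) (E : {set {set V}}) : Prop :=
  forall e : {set V}, e \in E -> #|e| = 2.

(* Rooted trees on [V] are given by parent maps, the root being its own parent. *)
Definition tree_edges (V : finType) (r : V) (par : V -> V) : {set {set V}} :=
  [set [set v; par v] | v in [set~ r]].

Definition rooted_spanning_tree (V : finType) (E : {set {set V}}) (r : V)
    (par : V -> V) : Prop :=
  [/\ par r = r,
      tree_edges r par \subset E
    & forall v : V, exists i : nat, iter i par v = r].

Definition ancestor (V : finType) (par : V -> V) (u v : V) : Prop :=
  exists i : nat, iter i par v = u.

Definition dfs_tree (V : finType) (E : {set {set V}}) (r : V)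
    (par : V -> V) : Prop :=
  rooted_spanning_tree E r par /\
  forall x y : V, [set x; y] \in E -> [set x; y] \notin tree_edges r par ->
    ancestor par x y \/ ancestor par y x.

(* The dummy root is [None]. *)
Definition add_root (V : finType) (E : {set {set V}}) : {set {set option V}} :=
  [set [set Some x | x in e] | e : {set V} in E] :|:
  [set [set None; Some v] | v : V].

(* [L] lists every edge of [E] exactly once, in any order and with the
   endpoints in any order. *)
Definition lists_edges (n : nat) (L : seq ('I_n * 'I_n))
    (E : {set {set 'I_n}}) : Prop :=
  perm_eq [seq [set p.1; p.2] | p <- L] (enum E).

Definition edge_words (n : nat) (L : seq ('I_n * 'I_n)) : seq nat :=
  flatten [seq [:: val p.1; val p.2] | p <- L].

(* The parents of the vertices [0, ..., n - 1], where the dummy root is coded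
   by [n]. *)
Definition parent_words (n : nat) (par : option 'I_n -> option 'I_n) : seq nat :=
  [seq (if par (Some v) is Some u then val u else n) | v <- enum 'I_n].

Definition log2 (n : nat) : nat := trunc_log 2 n.

(* Words have [Theta(log n)] bits; [c] is a constant of the machine. *)
Definition word_size (c n : nat) : nat := c * (log2 n).+1.

(* Main.v *)
(** The preprocessing stores a depth-first forest [T] of [G] in preorder, so that
    the subtree of [z] is an interval.  To answer a query, run a depth-first
    search of [G + U] that, on reaching an unvisited vertex [x], climbs [T] from
    [x] to its highest unvisited ancestor [r] and visits this whole path at once.
    As [T] is a depth-first forest, no edge of [G] joins two of the subtrees left
    hanging from the path, so it is enough to keep one edge for each of them,
    namely the one whose end on the path was visited last: a component of the
    unvisited graph that meets the path is then always entered from the deepest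
    vertex of the stack to which it is adjacent.  That end is the least neighbour
    at least [r] of the subtree, so it is found by a range successor query in a
    merge-sort tree over the adjacency lists in preorder, in [O(log^2 n)] time,
    and every vertex is the root of a hanging subtree at most once.

    The preorder itself comes from the same search, run on the trivial forest.
    Since at most [n] edges can be searched directly within the time bound, the
    structure is built only when [m > n]; this is also what keeps its size
    within [O(m log n)] when [G] has many isolated vertices. *)

From mathcomp Require Import all_boot zify.
Require Import Defs.

Set Implicit Arguments.
Unset Strict Implicit.
Unset Printing Implicit Defensive.

(** * Reasoning about programs *)

(** The query time is amortised: neither the length of a climb nor the number of searches made by
    one scan has a useful bound of its own. Commands are therefore run against a stock of credits,
    attached to the vertices not yet visited, not yet passed by a scan, not yet searched as subtree
    roots and not yet left, and to the pending list entries; a search also pays for the list entry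
    that it creates. An edge [x - y] is coded by the number [y * n + x], so that the least code that
    is at least [r * n] reveals the least end [y >= r]. The dummy root is the vertex [n]. Its edges
    are treated like inserted ones, so that a single list at [n] drives the search through all
    components. For the preprocessing only termination is at stake: it may fill an adjacency matrix
    and sort by counting smaller elements. Words of [20 * (log2 n + 1)] bits leave ample room for
    the codes, the positions in the table and the list nodes. *)

Fixpoint wregs (c : cmd) : seq nat :=
  match c with
  | Skip | SetCell _ _ _ => [::]
  | SetReg x _ => [:: x]
  | Seq c1 c2 | If _ c1 c2 => wregs c1 ++ wregs c2
  | While _ c1 => wregs c1
  end.

Fixpoint warrs (c : cmd) : seq nat :=
  match c with
  | Skip | SetReg _ _ => [::]
  | SetCell a _ _ => [:: a]
  | Seq c1 c2 | If _ c1 c2 => warrs c1 ++ warrs c2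
  | While _ c1 => warrs c1
  end.

(** The write sets are syntactic, so that for a concrete program the side conditions of a frame fact
    are settled by evaluation. *)
Definition frame (c : cmd) (s s' : state) : Prop :=
  (forall x, x \notin wregs c -> reg s' x = reg s x) /\
  (forall a, a \notin warrs c -> arr s' a = arr s a).

Lemma frame_trans c s1 s2 s3 : frame c s1 s2 -> frame c s2 s3 -> frame c s1 s3.
Proof.
move=> [r1 a1] [r2 a2]; split=> x xP; first by rewrite r2 // r1.
by rewrite a2 // a1.
Qed.

Lemma frame_sub c1 c2 s s' :
  {subset wregs c1 <= wregs c2} -> {subset warrs c1 <= warrs c2} ->
  frame c1 s s' -> frame c2 s s'.
Proof.
move=> sr sa [r a]; split=> x xN; first by apply: r; apply: contra xN => /sr.
by apply: a; apply: contra xN => /sa.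
Qed.

Lemma exec_frame w c s t s' : exec w c s t s' -> frame c s s'.
Proof.
elim=> {c s t s'} //.
- by move=> s x e; split=> //= y; rewrite inE => /negbTE->.
- by move=> s a e1 e2; split=> //= b; rewrite inE => /negbTE->.
- move=> c1 c2 s1 s2 s3 t1 t2 _ f1 _ f2.
  by apply: (@frame_trans _ _ s2);
    [apply: frame_sub f1 | apply: frame_sub f2] => x xP; rewrite mem_cat xP ?orbT.
- by move=> e c1 c2 s s' t _ _; apply: frame_sub => x xP; rewrite mem_cat xP.
- by move=> e c1 c2 s s' t _ _; apply: frame_sub => x xP; rewrite mem_cat xP orbT.
- by move=> e c s1 s2 s3 t1 t2 _ _ f1 _; apply: frame_trans.
Qed.

Lemma wrap_lt w v : wrap w v < 2 ^ w.
Proof. by rewrite ltn_mod expn_gt0. Qed.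

Definition bounded_state (w : nat) (s : state) : Prop :=
  (forall x, reg s x < 2 ^ w) /\ (forall a i, arr s a i < 2 ^ w).

Lemma eval_lt w s e : bounded_state w s -> eval w s e < 2 ^ w.
Proof. by move=> [hr ha]; case: e => //= *; apply: wrap_lt. Qed.

(** The output of the preprocessing is loaded again for each query, and [load] reduces modulo
    [2 ^ w]; boundedness makes this reduction the identity. *)
Lemma exec_bounded w c s t s' :
  exec w c s t s' -> bounded_state w s -> bounded_state w s'.
Proof.
elim=> {c s t s'} //.
- move=> s x e hs; split=> [y|a i] /=; last exact: hs.2.
  by case: ifP => _; [apply: eval_lt | apply: hs.1].
- move=> s a e1 e2 hs; split=> [y|b i] /=; first exact: hs.1.
  by case: ifP => _; [apply: eval_lt | apply: hs.2].
- by move=> c1 c2 s1 s2 s3 t1 t2 _ h1 _ h2 /h1.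
- by move=> e c s1 s2 s3 t1 t2 _ _ h1 _ h2 /h1.
Qed.

Lemma load_bounded w ins : bounded_state w (load w ins).
Proof. by split=> *; apply: wrap_lt. Qed.

(** * Time-credit logic *)

Section TimeLogic.
Variable w : nat.

(* Time-credit semantics: started with [T] credits, [c] halts without
   overspending, and [Q] holds of the remaining credits and the final state. *)
Definition wp (c : cmd) (s : state) (T : nat) (Q : nat -> state -> Prop) : Prop :=
  exists t s', [/\ exec w c s t s', t <= T & Q (T - t) s'].

Definition runs (c : cmd) (s : state) (B : nat) (Q : state -> Prop) : Prop :=
  wp c s B (fun _ => Q).

Lemma wp_conseq c s T (Q Q' : nat -> state -> Prop) :
  wp c s T Q -> (forall T' s', Q T' s' -> frame c s s' -> Q' T' s') ->
  wp c s T Q'.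
Proof.
move=> [t [s' [h1 h2 h3]]] hQ; exists t, s'; split=> //.
by apply: hQ => //; apply: exec_frame h1.
Qed.

Lemma wp_skip s T (Q : nat -> state -> Prop) :
  1 <= T -> Q (T - 1) s -> wp Skip s T Q.
Proof. by move=> hT hQ; exists 1, s; split=> //; constructor. Qed.

Lemma wp_reg v x e s T (Q : nat -> state -> Prop) :
  eval w s e = v -> cost e < T ->
  Q (T - (cost e).+1) (set_reg s x v) -> wp (SetReg x e) s T Q.
Proof.
by move=> <- hT hQ; exists (cost e).+1, (set_reg s x (eval w s e)); split=> //; constructor.
Qed.

Lemma wp_cell i v a e1 e2 s T (Q : nat -> state -> Prop) :
  eval w s e1 = i -> eval w s e2 = v -> cost e1 + cost e2 < T ->
  Q (T - (cost e1 + cost e2).+1) (set_cell s a i v) -> wp (SetCell a e1 e2) s T Q.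
Proof.
move=> <- <- hT hQ; exists (cost e1 + cost e2).+1,
  (set_cell s a (eval w s e1) (eval w s e2)); split=> //; constructor.
Qed.

Lemma wp_seq c1 c2 s T (Q : nat -> state -> Prop) :
  wp c1 s T (fun T1 s1 => wp c2 s1 T1 Q) -> wp (Seq c1 c2) s T Q.
Proof.
move=> [t1 [s1 [h1 h2 [t2 [s2 [h3 h4 h5]]]]]]; exists (t1 + t2), s2; split.
- exact: exec_seq h1 h3.
- lia.
- by rewrite subnDA.
Qed.

Lemma wp_if (b : bool) e c1 c2 s T (Q : nat -> state -> Prop) :
  eval w s e = b -> cost e < T ->
  (b -> wp c1 s (T - (cost e).+1) Q) ->
  (~~ b -> wp c2 s (T - (cost e).+1) Q) ->
  wp (If e c1 c2) s T Q.
Proof.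
move=> hb hT h1 h2; case: b hb h1 h2 => hb h1 h2.
  case: (h1 isT) => t [s' [k1 k2 k3]]; exists (cost e + t).+1, s'; split.
  - by apply: exec_if_true k1; rewrite hb.
  - lia.
  - by rewrite -addSn subnDA.
case: (h2 isT) => t [s' [k1 k2 k3]]; exists (cost e + t).+1, s'; split.
- by apply: exec_if_false k1; rewrite hb.
- lia.
- by rewrite -addSn subnDA.
Qed.

(* The credits themselves are the termination measure. *)
Lemma wp_while (I : nat -> state -> Prop) e c s0 T0 (Q : nat -> state -> Prop) :
  I T0 s0 ->
  (forall T s, I T s -> frame c s0 s -> exists b : bool,
     [/\ eval w s e = b, cost e < T,
         b -> wp c s (T - (cost e).+1) I
       & ~~ b -> Q (T - (cost e).+1) s]) ->
  wp (While e c) s0 T0 Q.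
Proof.
move=> hI0 step.
suff gen T s : I T s -> frame c s0 s -> wp (While e c) s T Q by exact: gen.
elim/ltn_ind: T s => T IH s hI hf.
have [b [hb hT h1 h2]] := step _ _ hI hf.
case: b hb h1 h2 => hb h1 h2.
  case: (h1 isT) => t [s' [k1 k2 k3]].
  have [|t' [s'' [l1 l2 l3]]] := IH _ _ s' k3 (frame_trans hf (exec_frame k1)); first lia.
  exists (cost e + t + t').+1, s''; split.
  - by apply: exec_while_true k1 l1; rewrite hb.
  - lia.
  - by have -> : T - (cost e + t + t').+1 = T - (cost e).+1 - t - t' by lia.
exists (cost e).+1, s; split=> //; last exact: h2.
by apply: exec_while_false; rewrite hb.
Qed.

(** Inserts a command with a worst-case bound into an amortised argument: at least [T - B] credits
    come back. *)
Lemma wp_runs B c s T (Q : state -> Prop) (R : nat -> state -> Prop) :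
  runs c s B Q -> B <= T ->
  (forall T' s', T <= T' + B -> Q s' -> frame c s s' -> R T' s') ->
  wp c s T R.
Proof.
move=> [t [s' [h1 h2 h3]]] hB hR; exists t, s'; split=> //; first lia.
by apply: hR => //; [lia | apply: exec_frame h1].
Qed.

Definition For (x : nat) (e : expr) (c : cmd) : cmd :=
  Seq (SetReg x (Lit 0))
      (While (Bin Lt (Reg x) e) (Seq c (SetReg x (Bin Add (Reg x) (Lit 1))))).

Lemma runs_for (I : nat -> state -> Prop) (x N B : nat) e c s0 :
  1 < w -> N < 2 ^ w ->
  I 0 (set_reg s0 x 0) ->
  (forall i s, i <= N -> I i s -> reg s x = i -> frame (For x e c) s0 s ->
     eval w s e = N) ->
  (forall i s, i < N -> I i s -> reg s x = i -> frame (For x e c) s0 s ->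
     runs c s B (fun s' => reg s' x = i /\ I i.+1 (set_reg s' x i.+1))) ->
  runs (For x e c) s0 (N * (B + cost e + 10) + cost e + 10)
    (fun s' => I N s' /\ reg s' x = N).
Proof.
move=> w1 hN I0 hE step.
have W2 : 2 ^ 2 <= 2 ^ w by rewrite leq_exp2l.
apply: wp_seq; apply: (@wp_reg 0) => /=; [by rewrite /wrap mod0n | lia | ].
set T0 := (_ - 2).
apply: (@wp_while (fun T s => exists i, [/\ i <= N, I i s, reg s x = i,
  frame (For x e c) s0 s & (N - i) * (B + cost e + 10) + cost e + 5 <= T])).
  exists 0; split=> //=; last by rewrite /T0; lia.
  - by rewrite eqxx.
  - by split=> // y /=; rewrite inE => /norP[/negbTE-> _].
move=> T s [i [iN Ii xi hf hT]] hf1.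
exists (i < N); split=> /=.
- by rewrite xi (hE i) //= /binop_eval /wrap modn_small //; lia.
- by move: (_ * _) hT => K; lia.
- move=> iltN; apply: wp_seq.
  have [t [s' [k1 k2 [k3 k4]]]] := step i s iltN Ii xi hf.
  have {}hT : (N - i.+1) * (B + cost e + 10) + (B + cost e + 10) + cost e + 5 <= T.
    by apply: leq_trans hT; rewrite -mulSnr -subSn.
  exists t, s'; split=> //; first by move: (_ * _) hT => K; lia.
  apply: (@wp_reg i.+1) => /=.
  + by rewrite k3 /binop_eval /wrap !modn_small; lia.
  + by move: (_ * _) hT => K; lia.
  exists i.+1; split=> //=.
  + by rewrite eqxx.
  + apply: frame_trans hf _; split=> y /=; rewrite ?cats1 ?cat_cons ?inE.
      rewrite mem_rcons inE => /norP[/negbTE yx yc].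
      move: yc; rewrite yx /= => yc; exact: (exec_frame k1).1.
    by rewrite cats0 => yc; apply: (exec_frame k1).2.
  + by move: (_ * _) hT => K; lia.
- move=> iN'; have -> : N = i by lia.
  by [].
Qed.

Lemma runs_conseq c s B B' (Q Q' : state -> Prop) :
  runs c s B Q -> B <= B' -> (forall s', Q s' -> frame c s s' -> Q' s') ->
  runs c s B' Q'.
Proof.
by move=> h hB hQ; apply: (wp_runs h hB) => T' s' _ /hQ.
Qed.

End TimeLogic.

(** * Traversal of a graph along a precomputed forest *)

Definition upd (f : nat -> nat) (p v : nat) : nat -> nat :=
  fun j => if j == p then v else f j.

(* A rooted forest on [0, n) in preorder: the subtree of [i] is [i, S i), and
   [P i] is the parent of [i], or [n] if [i] is a root. *)
Record forest (n : nat) (G : rel nat) (P S : nat -> nat) : Prop := Forest {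
  forest_sub : forall i, i < n -> i < S i <= n;
  forest_lam : forall i j, i < j -> j < S i -> i < n -> S j <= S i;
  forest_par : forall i, i < n -> P i < n -> [/\ P i < i, i < S (P i) & G i (P i)];
  forest_max : forall i j, j < i -> i < S j -> i < n -> P i < n /\ j <= P i;
  forest_parn : forall i, i < n -> P i <= n;
  forest_edge : forall a b, G a b -> a < b -> b < S a;
  forest_sym : symmetric G;
  forest_dom : forall a b, G a b -> a < n }.

(* A depth-first traversal in progress from the root [n]: [V] and [fin] hold the
   (nonzero) times of entry and exit, [F] the parents, [c] the current time and
   [cur] the top of the stack, which consists of the vertices [v] with
   [V v != 0] and [fin v = 0]. *)
Record dfs_state (n : nat) (H : rel nat) (V F fin : nat -> nat) (c cur : nat) : Prop := DfsState {
  ds_root : V n = 1;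
  ds_rootF : F n = n.+1;
  ds_cur : [/\ cur <= n, 0 < V cur & fin cur = 0];
  ds_le : forall v, v <= n -> V v <= c;
  ds_inj : forall u v, u <= n -> v <= n -> 0 < V v -> V u = V v -> u = v;
  ds_fin : forall u, u <= n -> 0 < fin u -> [/\ 0 < V u, V u < fin u & fin u <= c.+1];
  ds_top : forall u, u <= n -> 0 < V u -> fin u = 0 -> V u <= V cur;
  ds_par : forall v, v < n -> 0 < V v ->
    [/\ F v <= n, 0 < V (F v), V (F v) < V v, (fin (F v) = 0 \/ V v < fin (F v)) & H (F v) v];
  ds_max : forall u v, u <= n -> v < n -> 0 < V u -> V u < V v ->
    (fin u = 0 \/ V v < fin u) -> V u <= V (F v);
  ds_lam : forall u v, u <= n -> v <= n -> 0 < V u -> V u < V v ->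
    (fin u = 0 \/ V v < fin u) -> fin u = 0 \/ (0 < fin v /\ fin v <= fin u);
  ds_edge : forall a b, H a b -> 0 < V a -> V a < V b -> fin a = 0 \/ V b < fin a;
  ds_done : forall a b, H a b -> 0 < fin a -> 0 < V b }.

Section Traversal.
Variables (n : nat) (H : rel nat).
Hypothesis H_dom : forall a b, H a b -> a <= n /\ b <= n.

(** The entry time of [p] exceeds all others, so most clauses hold trivially for it. The real point
    is [ds_edge] for edges into [p]: by [ds_done], a vertex with an unvisited neighbour is not
    finished. *)
Lemma dfs_visit V F fin c cur p :
  dfs_state n H V F fin c cur -> p < n -> V p = 0 -> H cur p ->
  dfs_state n H (upd V p c.+1) (upd F p cur) fin c.+1 p.
Proof.
move=> D pn Vp Hp; have [c1 c2 c3] := ds_cur D.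
have cp : cur != p by apply: contraTneq c2 => ->; rewrite Vp.
have fp : fin p = 0.
  by apply/eqP; rewrite eqn0Ngt; apply/negP => /(ds_fin D (ltnW pn))[]; rewrite Vp.
have Vle v : v <= n -> V v <= c := @ds_le _ _ _ _ _ _ _ D v.
split; rewrite /upd.
- by rewrite gtn_eqF // (ds_root D).
- by rewrite gtn_eqF // (ds_rootF D).
- by rewrite eqxx (ltnW pn).
- by move=> v vn; case: ifP => // _; apply: leqW; apply: Vle.
- move=> u v un vn; have := Vle u un; have := Vle v vn.
  case: eqP => [->|_]; case: eqP => [->|_] //; try lia.
  by move=> *; apply: (ds_inj D).
- move=> u un fu; have [f1 f2 f3] := ds_fin D un fu.
  by case: eqP => [up|_]; [rewrite up Vp in f1 | split=> //; lia].
- move=> u un; rewrite eqxx; have := Vle u un; case: ifP => //; lia.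
- move=> v vn; case: eqP => [-> _|vp v0].
    rewrite (negbTE cp); split=> //; first by have := Vle cur c1; lia.
    by left.
  have [d1 d2 d3 d4 d5] := ds_par D vn v0; have fvp : F v != p by apply: contraTneq d2 => ->; rewrite Vp.
  by rewrite (negbTE fvp).
- move=> u v un vn; have := Vle u un; have := Vle v (ltnW vn).
  case: (u =P p) => [->|up]; case: (v =P p) => [->|vp]; try by lia.
    move=> h1 h2 h3 h4 [f0|]; last by move=> h; have [|_ _] := ds_fin D un; lia.
    by rewrite (negbTE cp); apply: (ds_top D).
  move=> h1 h2 u0 uv o; have v0 : 0 < V v by lia.
  have [d1 d2 d3 d4 d5] := ds_par D vn v0; have fvp : F v != p by apply: contraTneq d2 => ->; rewrite Vp.
  by rewrite (negbTE fvp); apply: (ds_max D).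
- move=> u v un vn; have := Vle u un; have := Vle v vn.
  case: (u =P p) => [->|up]; case: (v =P p) => [->|vp]; try by lia.
    move=> h1 h2 h3 h4 [f0|]; first by left.
    by move=> h; have [|_ _] := ds_fin D un; lia.
  by move=> h1 h2 h3 h4; apply: (ds_lam D).
- move=> a b Hab; have [an bn] := H_dom Hab.
  have := Vle a an; have := Vle b bn.
  case: (a =P p) => [->|ap]; case: (b =P p) => [bp|bp]; try by lia.
    move=> h1 h2 h3 h4; left; apply/eqP; rewrite eqn0Ngt; apply/negP => /(ds_done D Hab).
    by rewrite bp Vp.
  by move=> h1 h2 h3 h4; apply: (ds_edge D).
- by move=> a b Hab /(ds_done D Hab); case: eqP.
Qed.

(** The clock ticks at entries only, so [fin] is one more than the last entry time in the subtree.
    Entry times are thus a preorder and [[V u, fin u)] the interval of [u] in it; nested vertices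
    may share an exit time. *)
Lemma dfs_leave V F fin c cur :
  dfs_state n H V F fin c cur -> cur != n -> (forall b, H cur b -> 0 < V b) ->
  dfs_state n H V F (upd fin cur c.+1) c (F cur).
Proof.
move=> D cn Hc; have [c1 c2 c3] := ds_cur D.
have clt : cur < n by rewrite ltn_neqAle cn.
have [d1 d2 d3 d4 d5] := ds_par D clt c2.
have Vle v : v <= n -> V v <= c := @ds_le _ _ _ _ _ _ _ D v.
have fc : F cur != cur by apply: contraTneq d3 => ->; rewrite ltnn.
have above v : v <= n -> V cur < V v -> 0 < fin v.
  move=> vn h; case E: (fin v) => //; have := ds_top D vn _ E; lia.
split; rewrite /upd; try by case: D.
- split=> //; rewrite (negbTE fc).
  by case: (ds_lam D d1 c1 d2 d3 d4) => // -[]; rewrite c3.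
- move=> u un; have := Vle u un; case: eqP => [->|uc]; first by split=> //; lia.
  by move=> _; apply: (ds_fin D).
- move=> u un u0; case: eqP => // uc fu.
  have := ds_top D un u0 fu; rewrite leq_eqVlt => /orP[/eqP e|lt].
    by case: uc; apply: (ds_inj D) => //.
  by apply: (ds_max D) => //; left.
- move=> v vn v0; have [e1 e2 e3 e4 e5] := ds_par D vn v0; split=> //.
  case: eqP => [_|_]; last by [].
  by right; have := Vle v (ltnW vn); lia.
- move=> u v un vn u0 uv o; apply: (ds_max D) => //.
  by move: o; case: eqP => [->|//]; left.
- move=> u v un vn u0 uv o; have vc := Vle v vn.
  case: (u =P cur) o => [eu _|uc o].
    right; have := above v vn; rewrite -eu => /(_ uv) fv.
    have [_ _ f3] := ds_fin D vn fv.
    by case: eqP uv => [->|_ _] //; rewrite ltnn.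
  case: (v =P cur) o => [ev o|vc' o]; last by apply: (ds_lam D) o.
  have := ds_lam D un vn u0 uv o; rewrite ev c3 => -[|[]] //; by left.
- move=> a b Hab a0 ab; have [an bn] := H_dom Hab.
  case: eqP => [_|_]; last by apply: (ds_edge D).
  by right; have := Vle b bn; lia.
- move=> a b Hab; case: eqP => [ac _|_]; last by apply: (ds_done D).
  by apply: Hc; rewrite -ac.
Qed.

End Traversal.

(* [L y] lists the edges found so far at [y] that remain to be tried.  An edge
   [a - x] into an unvisited tree is dispensable when an edge into the same tree
   is pending at [a] or deeper on the stack. *)
Definition pending (n : nat) (S V fin : nat -> nat) (L : nat -> seq nat) (a x : nat) : Prop :=
  exists y x' z, [/\ y <= n, 0 < V y, fin y = 0 & V a <= V y] /\
    [/\ x' \in L y, V z = 0, z <= x < S z & z <= x' < S z].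

(** By [si_up] the visited set is closed under ancestors in the forest, so the unvisited part is a
    union of whole subtrees [[z, S z)]. Edges of [G] need one representative per such tree; edges of
    [X] are listed individually until their end is visited. *)
Record search_inv (n : nat) (G X : rel nat) (P S V F fin : nat -> nat) (c cur : nat)
    (L : nat -> seq nat) : Prop := SearchInv {
  si_dfs : dfs_state n (fun a b => G a b || X a b) V F fin c cur;
  si_tree : forall a x, G a x -> 0 < V a -> V x = 0 -> pending n S V fin L a x;
  si_extra : forall a x, X a x -> V x = 0 -> x \in L a;
  si_up : forall u v, u < v -> v < S u -> u < n -> 0 < V v -> 0 < V u;
  si_list : forall a b, a <= n -> b \in L a -> G a b || X a b }.

(* The climb from [y], having reached [r], where [V0] and [c0] belong to the
   state before it. *)
Record climb (n : nat) (S V0 : nat -> nat) (c0 y : nat) (V : nat -> nat) (r : nat) : Prop :=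
  Climb {
  cl_root : [/\ r < n, V0 r = 0 & r <= y < S r];
  cl_vis : forall v, 0 < V v <-> 0 < V0 v \/ (r <= v <= y /\ y < S v);
  cl_old : forall v, 0 < V0 v -> V v = V0 v;
  cl_new : forall v, V0 v = 0 -> 0 < V v -> c0 < V v;
  cl_desc : forall v v', V0 v = 0 -> V0 v' = 0 -> 0 < V v -> 0 < V v' -> v < v' -> V v' < V v }.

(** * One climb and the scan that follows it *)

Section Climb.
Variables (n : nat) (G X : rel nat) (P S : nat -> nat).
Hypothesis fo : forest n G P S.
Hypothesis X_dom : forall a b, X a b -> a <= n /\ b <= n.
Let H : rel nat := fun a b => G a b || X a b.

Lemma H_dom a b : H a b -> a <= n /\ b <= n.
Proof.
case/orP=> [h|/X_dom//]; split; apply: ltnW; first exact: (forest_dom fo h).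
by move: h; rewrite (forest_sym fo); apply: (forest_dom fo).
Qed.

Section OneClimb.
Variables (V0 F0 fin : nat -> nat) (c0 cur0 y : nat) (L0 : nat -> seq nat).
Hypothesis inv0 : search_inv n G X P S V0 F0 fin c0 cur0 L0.
Hypothesis y_new : y < n /\ V0 y = 0.
Hypothesis y_edge : H cur0 y.

Lemma V0_le v : v <= n -> V0 v <= c0.
Proof. exact: (ds_le (si_dfs inv0)). Qed.

Lemma climb_start :
  dfs_state n H (upd V0 y c0.+1) (upd F0 y cur0) fin c0.+1 y /\
  climb n S V0 c0 y (upd V0 y c0.+1) y.
Proof.
case: y_new => yn y0.
have /andP[yS _] := forest_sub fo yn.
split; first by apply: dfs_visit (si_dfs inv0) _ _ _ => //; [exact: H_dom].
split; rewrite /upd.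
- by rewrite leqnn yS.
- move=> v; case: eqP => [->|vy]; first by rewrite leqnn yS; split=> // _; right.
  split=> [|[//|[h _]]]; first by left.
  by case: vy; apply/eqP; rewrite eqn_leq andbC.
- by move=> v; case: eqP => // ->; rewrite y0.
- by move=> v; case: eqP => // _ ->.
- by move=> v v'; do 2 (case: eqP => [->|_]) => //; lia.
Qed.

(** By [forest_max], a vertex below [r] whose interval contains [r] is at most [P r]. Hence the path
    climbed so far is exactly the set of [v] in [[r, y]] with [y < S v], and [cl_vis] needs no
    iteration of [P]. *)
Lemma climb_step V F c r :
  dfs_state n H V F fin c r -> climb n S V0 c0 y V r -> V (P r) = 0 ->
  dfs_state n H (upd V (P r) c.+1) (upd F (P r) r) fin c.+1 (P r) /\
  climb n S V0 c0 y (upd V (P r) c.+1) (P r).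
Proof.
move=> D C VP; have [rn r0 /andP[ry yS]] := cl_root C.
(* The parent of a forest root is [n], the dummy root, which is always visited: the climb stops
   there without a separate test. *)
have Pn : P r < n.
  rewrite ltn_neqAle (forest_parn fo) // andbT; apply/eqP => E.
  by move: VP; rewrite E (ds_root D).
have [Pr rSP GP] := forest_par fo rn Pn.
have PS := forest_lam fo Pr rSP Pn.
have V0P : V0 (P r) = 0 by case E: (V0 (P r)) => //; move: VP; rewrite (cl_old C) E.
split; first by apply: dfs_visit D _ _ _ => //; [exact: H_dom | rewrite /H GP].
split; rewrite /upd.
- by split=> //; apply/andP; split; lia.
- move=> v; case: eqP => [->|vP].
    by split=> // _; right; split; lia.
  split=> [/(cl_vis C)[|[h1 h2]]|[h|[h1 h2]]]; try by [left | right; split; lia].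
    by apply/(cl_vis C); left.
  apply/(cl_vis C); right; split=> //.
  have [|vr] := leqP r v; first lia.
  by have [|_] := forest_max fo vr _ rn; lia.
- by move=> v; case: eqP => [->|_]; [rewrite V0P | apply: (cl_old C)].
- move=> v; case: eqP => [_ _ _|_]; last exact: (cl_new C).
  have [_ Vr _] := ds_cur D.
  by have := cl_new C r0 Vr; have := ds_le D (ltnW rn); lia.
- move=> v v'; case: eqP => [->|vP]; case: eqP => [->|vP'] //; try lia.
  + move=> _ a b c' d; have /(cl_vis C) [|[h1 h2]] := c'; first lia.
    by have := @ds_le _ _ _ _ _ _ _ D v'; lia.
  + move=> a _ /(cl_vis C); lia.
  + exact: (cl_desc C).
Qed.

Variables (V F : nat -> nat) (c r : nat).
Hypothesis D : dfs_state n H V F fin c r.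
Hypothesis C : climb n S V0 c0 y V r.
Hypothesis P_old : 0 < V (P r).

Lemma climb_subtree v : r <= v < S r -> V0 v = 0.
Proof.
move=> /andP[rv vS]; have [rn r0 _] := cl_root C.
case E: (V0 v) => //; move: rv; rewrite leq_eqVlt => /orP[/eqP e|rv].
  by move: r0; rewrite e E.
by have := si_up inv0 rv vS rn; rewrite E r0 => /(_ isT).
Qed.

(** For ancestors above [r] the claim passes through [P r], which was visited before the climb since
    the climb ended there. *)
Lemma climb_up u v : u < v -> v < S u -> u < n -> 0 < V v -> 0 < V u.
Proof.
move=> uv vS un /(cl_vis C)[v0|[h1 h2]].
  by apply/(cl_vis C); left; apply: (si_up inv0 uv vS un v0).
have [rn r0 /andP[ry yS]] := cl_root C.
have SS := forest_lam fo uv vS un.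
have [ru|ur] := leqP r u; first by apply/(cl_vis C); right; lia.
have [|Pn uP] := forest_max fo ur _ rn; first lia.
have [Pr rSP _] := forest_par fo rn Pn.
move: uP; rewrite leq_eqVlt => /orP[/eqP->//|uP].
have /(cl_vis C)[h|] := P_old; last lia.
by apply/(cl_vis C); left; by have := si_up inv0 uP _ un h; lia.
Qed.

(* The scan of the subtree of [r] in preorder has reached [z], having skipped
   the subtree of each unvisited vertex met so far. *)
Record scan (L : nat -> seq nat) (z : nat) : Prop := Scan {
  sc_range : r <= z <= S r;
  sc_skip : forall u, r <= u < z -> V u = 0 -> S u <= z;
  sc_tree : forall a x, G a x -> 0 < V a -> V x = 0 ->
    pending n S V fin L a x \/ z <= x < S r;
  sc_extra : forall a x, X a x -> V x = 0 -> x \in L a;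
  sc_list : forall a b, a <= n -> b \in L a -> H a b }.

(** If [a] is on the new path, [x] is its descendant, because an unvisited ancestor of [a] is
    impossible; so [x] lies in the range to be scanned. If [a] is older and the tree of its pending
    edge met the path, that tree lies inside the range. Otherwise the pending edge survives: the one
    removed entry leads to [y], and no tree that is still unvisited contains [y]. *)
Lemma scan_start (L : nat -> seq nat) :
  (forall a b, b \in L a -> b \in L0 a) ->
  (forall a b, b \in L0 a -> b \in L a \/ (a = cur0 /\ b = y)) ->
  scan L r.
Proof.
move=> Lsub Lsup; have [rn r0 /andP[ry yS]] := cl_root C.
have Vy : 0 < V y.
  apply/(cl_vis C); right; case: y_new => /(forest_sub fo) /andP[? _] _; split=> //; lia.
split.
- by rewrite leqnn; lia.
- lia.
- move=> a x Gax Va Vx; have xn : x < n by apply: (forest_dom fo (b := a)); rewrite (forest_sym fo).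
  have an : a < n := forest_dom fo Gax.
  have [a0|a0] := posnP (V0 a).
    right; have /(cl_vis C)[|[ra ya]] := Va; first by rewrite a0.
    have ne : a != x by apply: contraTneq Va => ->; rewrite Vx.
    have [ax|xa] := ltnP a x.
      have := forest_edge fo Gax ax.
      have [ar|h1 h2] := leqP a r; first by (have -> : r = a by lia); lia.
      by have := forest_lam fo h1 _ rn; lia.
    have xa' : x < a by rewrite ltn_neqAle eq_sym ne.
    have aSx : a < S x by apply: (forest_edge fo) xa'; rewrite (forest_sym fo).
    by have := climb_up xa' aSx xn Va; rewrite Vx.
  have Vx0 : V0 x = 0 by case E: (V0 x) => //; move: Vx; rewrite (cl_old C) E.
  have [y' [x' [z [[h1 h2 h3 h4] [h5 h6 h7 h8]]]]] := si_tree inv0 Gax a0 Vx0.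
  have zn : z < n by lia.
  have [Vz|Vz] := posnP (V z); last first.
    right; have /(cl_vis C)[|[rz yz]] := Vz; first by rewrite h6.
    have [|rz'] := leqP z r; first by move=> zr; (have -> : r = z by lia).
    by have := forest_lam fo rz' _ rn; lia.
  left; exists y', x', z; split; split=> //.
  + by rewrite (cl_old C).
  + by rewrite !(cl_old C).
  case: (Lsup _ _ h5) => // -[ey ex]; move: h8; rewrite ex => /andP[zy yz].
  move: zy; rewrite leq_eqVlt => /orP[/eqP e|zy]; first by move: Vz Vy; rewrite e => ->.
  by have := climb_up zy yz zn Vy; rewrite Vz.
- move=> a x Xax Vx; have Vx0 : V0 x = 0 by case E: (V0 x) => //; move: Vx; rewrite (cl_old C) E.
  case: (Lsup _ _ (si_extra inv0 Xax Vx0)) => // -[_ ex].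
  by move: Vy; rewrite -ex Vx.
- by move=> a b an /Lsub; apply: (si_list inv0) an.
Qed.

Lemma scan_visited L z : scan L z -> z < S r -> 0 < V z -> scan L z.+1.
Proof.
move=> sc zS Vz; split; try by case: sc.
- by have := sc_range sc; lia.
- move=> u; rewrite ltnS => /andP[ru]; rewrite leq_eqVlt => /orP[/eqP->|uz Vu].
    by move=> h; move: Vz; rewrite h.
  by apply: leqW; apply: (sc_skip sc); rewrite ?ru.
- move=> a x Gax Va Vx; case: (sc_tree sc Gax Va Vx) => [|h]; [by left | right].
  have : x != z by apply: contraTneq Vz => <-; rewrite Vx.
  lia.
Qed.

Lemma scan_parent L z : scan L z -> z < S r -> V z = 0 ->
  [/\ z < n, P z < n, r <= P z & r < z].
Proof.
move=> sc zS Vz; have [rn r0 /andP[ry yS]] := cl_root C.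
have /andP[rz _] := sc_range sc.
have Vr : 0 < V r.
  by apply/(cl_vis C); right; have := forest_sub fo rn; lia.
have rz' : r < z.
  by rewrite ltn_neqAle rz andbT; apply: contraTneq Vr => ->; rewrite Vz.
have /andP[_ Srn] := forest_sub fo rn.
have zn : z < n by lia.
by have [] := forest_max fo rz' zS zn.
Qed.

(* The edges leaving the subtree of [z] upwards end on the climbed path, where
   visit times decrease with the index; [y2] is the end visited last. *)
Lemma scan_unvisited L z x2 y2 (L' : nat -> seq nat) :
  scan L z -> z < S r -> V z = 0 ->
  z <= x2 < S z -> r <= y2 -> G x2 y2 ->
  (forall a x, G a x -> z <= x < S z -> r <= a -> y2 <= a) ->
  (forall a b, b \in L' a = (b \in L a) || ((a == y2) && (b == x2))) ->
  [/\ scan L' (S z), z < S z, P z < n, V0 (P z) = 0 & 0 < V (P z)].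
Proof.
move=> sc zS Vz x2z ry2 G2 min L'E; have [rn r0 /andP[ry yS]] := cl_root C.
have [zn Pn rP rz'] := scan_parent sc zS Vz.
have /andP[rz _] := sc_range sc.
have /andP[_ Srn] := forest_sub fo rn.
have [Pz zSP GP] := forest_par fo zn Pn.
have /andP[zSz _] := forest_sub fo zn.
have SzS := forest_lam fo rz' zS rn.
(* An unvisited [u] would have been skipped together with its subtree, which contains [z]. *)
have vis u : r <= u < z -> z < S u -> 0 < V u.
  by move=> h1 h2; case E: (V u) => //; have := sc_skip sc h1 E; lia.
(* The tree edge to [P z] is one of the candidates, so the least end is a proper ancestor of [z] and
   not a vertex of the subtree itself. *)
have y2P : y2 <= P z.
  apply: (min _ z); rewrite ?leqnn //; by rewrite (forest_sym fo).
have y2S : x2 < S y2.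
  by apply: (forest_edge fo); [rewrite (forest_sym fo) | lia].
have Vy2 : 0 < V y2 by apply: vis; lia.
have V0y2 : V0 y2 = 0 by apply: climb_subtree; lia.
have y2n : y2 < n by lia.
have V0P : V0 (P z) = 0 by apply: climb_subtree; lia.
have VP : 0 < V (P z) by apply: vis; lia.
have fy2 : fin y2 = 0.
  by apply/eqP; rewrite eqn0Ngt; apply/negP => /(ds_fin (si_dfs inv0) (ltnW y2n))[]; rewrite V0y2.
split=> //; split.
- lia.
- move=> u /andP[ru uz] Vu; have [|zu] := leqP z u; last by have := sc_skip sc _ Vu; lia.
  rewrite leq_eqVlt => /orP[/eqP->//|zu].
  exact: (forest_lam fo) zu uz zn.
- move=> a x Gax Va Vx.
  have xn : x < n by apply: (forest_dom fo (b := a)); rewrite (forest_sym fo).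
  have an : a < n := forest_dom fo Gax.
  case: (sc_tree sc Gax Va Vx) => [|h].
    move=> [y' [x' [z' [h1 [h5 h6 h7 h8]]]]]; left; exists y', x', z'; split=> //.
    by split=> //; rewrite L'E h5.
  have [Szx|xSz] := leqP (S z) x; [right; lia | left].
  exists y2, x2, z; split; split=> //.
  + exact: ltnW.
  (* A vertex visited before the climb is older than the whole path; on the path a larger index
     means an earlier visit. *)
  + have [a0|a0] := posnP (V0 a); last first.
      rewrite (cl_old C) //; have := V0_le (ltnW an).
      by have := cl_new C V0y2 Vy2; lia.
    have /(cl_vis C)[|[/andP[ra ya] ya']] := Va; first by rewrite a0.
    have : y2 <= a by apply: min Gax _ ra; lia.
    rewrite leq_eqVlt => /orP[/eqP->//|lt].
    by apply: ltnW; apply: (cl_desc C).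
  + by rewrite L'E !eqxx orbT.
  + lia.
- by move=> a x Xax Vx; rewrite L'E (sc_extra sc).
- move=> a b an; rewrite L'E => /orP[|/andP[/eqP-> /eqP->]]; first exact: (sc_list sc).
  by rewrite /H (forest_sym fo) G2.
Qed.

Lemma scan_end L : scan L (S r) -> search_inv n G X P S V F fin c r L.
Proof.
move=> sc; split=> //.
- move=> a x Gax Va Vx; case: (sc_tree sc Gax Va Vx) => //; lia.
- exact: (sc_extra sc).
- move=> u v uv vS un; exact: climb_up.
- exact: (sc_list sc).
Qed.

End OneClimb.

(** No unvisited subtree contains the visited vertex [y], so the discarded entry represented
    nothing. *)
Lemma search_skip V F fin c cur L L' y :
  search_inv n G X P S V F fin c cur L -> 0 < V y ->
  (forall a b, b \in L' a -> b \in L a) ->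
  (forall a b, b \in L a -> b \in L' a \/ (a = cur /\ b = y)) ->
  search_inv n G X P S V F fin c cur L'.
Proof.
move=> I Vy Lsub Lsup; split; try by case: I.
- move=> a x Gax Va Vx.
  have xn : x < n by apply: (forest_dom fo (b := a)); rewrite (forest_sym fo).
  have [y' [x' [z [h [h5 h6 h7 h8]]]]] := si_tree I Gax Va Vx.
  exists y', x', z; split=> //; split=> //.
  case: (Lsup _ _ h5) => // -[_ ex]; move: h8; rewrite ex => /andP[zy yz].
  move: zy; rewrite leq_eqVlt => /orP[/eqP e|zy]; first by move: h6 Vy; rewrite e => ->.
  have zn : z < n by lia.
  by have := si_up I zy yz zn Vy; rewrite h6.
- move=> a x Xax Vx; case: (Lsup _ _ (si_extra I Xax Vx)) => // -[_ ex].
  by move: Vy; rewrite -ex Vx.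
- by move=> a b an /Lsub; apply: (si_list I).
Qed.

(** A pending edge for an unvisited neighbour of [cur] would sit at [cur] or deeper on the stack. As
    [cur] is the top, it would be in the empty list of [cur]; hence all neighbours are visited. *)
Lemma search_leave V F fin c cur L :
  search_inv n G X P S V F fin c cur L -> L cur = [::] -> cur != n ->
  search_inv n G X P S V F (upd fin cur c.+1) c (F cur) L.
Proof.
move=> I Lc cn; have [c1 c2 c3] := ds_cur (si_dfs I).
have key y : y <= n -> 0 < V y -> fin y = 0 -> V cur <= V y -> y = cur.
  move=> yn y0 fy h; have h' := ds_top (si_dfs I) yn y0 fy.
  by apply: (ds_inj (si_dfs I)) => //; lia.
split; try by case: I.
- apply: dfs_leave (si_dfs I) cn _; first exact: H_dom.
  move=> b /orP[Gb|Xb]; case E: (V b) => //.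
    have [y' [x' [z [[h1 h2 h3 h4] [h5 _ _ _]]]]] := si_tree I Gb c2 E.
    by move: h5; rewrite (key y') // Lc.
  by have := si_extra I Xb E; rewrite Lc.
- move=> a x Gax Va Vx.
  have [y' [x' [z [[h1 h2 h3 h4] [h5 h6 h7 h8]]]]] := si_tree I Gax Va Vx.
  exists y', x', z; split; split=> //; rewrite /upd.
  by case: eqP => // e; move: h5; rewrite e Lc.
Qed.

End Climb.

(** * The completed search *)

Record dfs_done (n : nat) (H : rel nat) (V F fin : nat -> nat) : Prop := DfsDone {
  dd_root : V n = 1;
  dd_time : forall v, v <= n -> [/\ 0 < V v, V v < fin v & fin v <= n.+2];
  dd_inj : forall u v, u <= n -> v <= n -> V u = V v -> u = v;
  dd_par : forall v, v < n -> [/\ F v <= n, V (F v) < V v, V v < fin (F v) & H (F v) v];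
  dd_max : forall u v, u <= n -> v < n -> V u < V v -> V v < fin u -> V u <= V (F v);
  dd_lam : forall u v, u <= n -> v <= n -> V u < V v -> V v < fin u -> fin v <= fin u;
  dd_edge : forall a b, H a b -> V a < V b -> V b < fin a }.

Section Done.
Variables (n : nat) (G X : rel nat) (P S : nat -> nat).
Hypothesis fo : forest n G P S.
Hypothesis X_dom : forall a b, X a b -> a <= n /\ b <= n.
Hypothesis X_root : forall v, v < n -> X n v.

(** The edges at the dummy root are extra edges, so its empty list says that every vertex is
    visited; and with the root, of entry time 1, on top of the stack, all others are finished. *)
Lemma search_finish V F fin c L :
  search_inv n G X P S V F fin c n L -> L n = [::] -> c <= n.+1 ->
  dfs_done n (fun a b => G a b || X a b) V F (upd fin n c.+1).
Proof.
move=> I Ln cn; have D := si_dfs I.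
have vis v : v <= n -> 0 < V v.
  rewrite leq_eqVlt => /orP[/eqP->|vn]; first by rewrite (ds_root D).
  by case E: (V v) => //; have := si_extra I (X_root vn) E; rewrite Ln.
have fi v : v <= n -> v != n -> 0 < fin v.
  move=> vn ne; case E: (fin v) => //; have h := ds_top D vn (vis v vn) E.
  by case/eqP: ne; apply: (ds_inj D) => //; move: h (vis v vn); rewrite (ds_root D); lia.
have le v : v <= n -> V v <= c := @ds_le _ _ _ _ _ _ _ D v.
have op u v : (upd fin n c.+1) u > V v -> u <= n -> v <= n -> fin u = 0 \/ V v < fin u.
  rewrite /upd; case: eqP => [->|_]; last by right.
  by left; case: (ds_cur D).
split.
- exact: ds_root D.
- move=> v vn; rewrite /upd; case: eqP => [->|/eqP ne].
    by rewrite (ds_root D); have := le _ (leqnn n); rewrite (ds_root D); split=> //; lia.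
  by have [] := ds_fin D vn (fi v vn ne); split=> //; lia.
- by move=> u v un vn e; apply: (ds_inj D) => //; apply: vis.
- move=> v vn; have [h1 h2 h3 h4 h5] := ds_par D vn (vis v (ltnW vn)); split=> //.
  rewrite /upd; case: eqP => [_|/eqP ne]; first by have := le v (ltnW vn); lia.
  by case: h4 => // E; have := fi _ h1 ne; rewrite E.
- move=> u v un vn uv h; apply: (ds_max D) => //; first exact: vis.
  by apply: op h _ _ => //; apply: ltnW.
- move=> u v un vn uv h; have vn' : v != n.
    apply: contraTneq uv => ->; rewrite (ds_root D) ltnS leqn0 -lt0n; exact: vis.
  have fv := fi v vn vn'; rewrite /upd (negbTE vn'); case: eqP h => [_|/eqP ne] h.
    by have [] := ds_fin D vn fv.
  have := ds_lam D un vn (vis u un) uv; case; [by right; move: h; rewrite /upd (negbTE ne) | | by case].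
  by move=> E; have := fi u un ne; rewrite E.
- move=> a b Hab ab; have [an bn] : a <= n /\ b <= n.
    case/orP: Hab => [h|/X_dom//]; split; apply: ltnW; first exact: (forest_dom fo h).
    by move: h; rewrite (forest_sym fo); apply: (forest_dom fo).
  rewrite /upd; case: eqP => [_|/eqP ne]; first by have := le b bn; lia.
  case: (ds_edge D Hab (vis a an) ab) => // E; by have := fi a an ne; rewrite E.
Qed.

End Done.

(** * Range successor queries *)

(** Registers and arrays 0 and 1 belong to the inputs. [a_I] takes vertices to their numbers in the
    forest and [a_O] takes them back; [a_hd], [a_nx], [a_tg] are linked lists with [r_nc] nodes; the
    table starts at [r_tb] and its current level at [r_lb]. *)
Notation r_n := 2 (only parsing).
Notation r_nc := 3 (only parsing).
Notation r_time := 4 (only parsing).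
Notation r_cur := 5 (only parsing).
Notation r_p := 6 (only parsing).
Notation r_z := 7 (only parsing).
Notation r_best := 8 (only parsing).
Notation r_l := 9 (only parsing).
Notation r_r := 10 (only parsing).
Notation r_sz := 11 (only parsing).
Notation r_lb := 12 (only parsing).
Notation r_lo := 13 (only parsing).
Notation r_hi := 14 (only parsing).
Notation r_mid := 15 (only parsing).
Notation r_v := 16 (only parsing).
Notation r_q := 17 (only parsing).
Notation r_N := 18 (only parsing).
Notation r_tb := 19 (only parsing).
Notation r_a := 20 (only parsing).
Notation r_b := 21 (only parsing).
Notation r_i := 22 (only parsing).
Notation r_len := 23 (only parsing).
Notation a_I := 2 (only parsing).
Notation a_P := 3 (only parsing).
Notation a_S := 4 (only parsing).
Notation a_A := 5 (only parsing).
Notation a_V := 6 (only parsing).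
Notation a_F := 7 (only parsing).
Notation a_fin := 8 (only parsing).
Notation a_hd := 9 (only parsing).
Notation a_nx := 10 (only parsing).
Notation a_tg := 11 (only parsing).
Notation a_O := 12 (only parsing).

Notation "c1 ;; c2" := (Seq c1 c2) (at level 90, right associativity).
Notation "x <- e" := (SetReg x e) (at level 80, no associativity).
Notation "e1 +! e2" := (Bin Add e1 e2) (at level 50, left associativity).
Notation "e1 -! e2" := (Bin Sub e1 e2) (at level 50, left associativity).
Notation "e1 *! e2" := (Bin Mul e1 e2) (at level 40, left associativity).
Notation "e1 /! e2" := (Bin Div e1 e2) (at level 40, left associativity).
Notation "e1 %! e2" := (Bin Mod e1 e2) (at level 40, left associativity).
Notation "e1 <! e2" := (Bin Lt e1 e2) (at level 70, no associativity).
Notation "e1 =! e2" := (Bin Eq e1 e2) (at level 70, no associativity).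

Lemma wrapE w v : v < 2 ^ w -> wrap w v = v.
Proof. exact: modn_small. Qed.

Ltac ev := rewrite /= /binop_eval ?wrapE; lia.
Ltac areg v := apply: (@wp_reg _ v); [try ev | rewrite /=; lia | rewrite /=].
Ltac sreg v := apply: wp_seq; areg v.
Ltac acell i v := apply: (@wp_cell _ i v); [try ev | try ev | rewrite /=; lia | rewrite /=].
Ltac scell i v := apply: wp_seq; acell i v.
Ltac aif b := apply: (@wp_if _ b); [try ev | rewrite /=; lia | rewrite /= | rewrite /=].

(* Lowers the register [best] to the least value at least [q] in the sorted
   block of length [sz] starting at position [x]. *)
Definition block_search (x : nat) : cmd :=
  r_lo <- Reg x ;;
  r_hi <- Reg r_lo +! Reg r_sz ;;
  While (Reg r_lo <! Reg r_hi) (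
    r_mid <- (Reg r_lo +! Reg r_hi) /! Lit 2 ;;
    r_v <- Cell 0 (Reg r_lb +! Reg r_mid) ;;
    If (Reg r_v <! Reg r_q)
      (r_lo <- Reg r_mid +! Lit 1)
      (r_hi <- Reg r_mid ;;
       If (Reg r_v <! Reg r_best) (r_best <- Reg r_v) Skip)).

(** Each probe that is at least [q] lowers [best] at once. So no value has to be read after the
    loop, when [lo] may have left the block. *)
Lemma block_search_spec w s x xv sz lb q (t : nat -> nat) J :
  reg s x = xv -> reg s r_sz = sz -> reg s r_lb = lb -> reg s r_q = q ->
  lb + 2 * (xv + sz) + 2 < 2 ^ w -> sz < 2 ^ J ->
  (forall i, xv <= i < xv + sz -> arr s 0 (lb + i) = t i) ->
  (forall i j, xv <= i -> i <= j -> j < xv + sz -> t i <= t j) ->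
  runs w (block_search x) s (40 * J + 40) (fun s' =>
    [/\ reg s' r_best <= reg s r_best,
        forall i, xv <= i < xv + sz -> q <= t i -> reg s' r_best <= t i
      & reg s' r_best = reg s r_best \/
        exists i, [/\ xv <= i < xv + sz, q <= t i & reg s' r_best = t i]]).
Proof.
move=> hx hsz hlb hq ovf hJ tE mono.
sreg xv; sreg (xv + sz).
set s1 := set_reg _ _ _.
apply: (@wp_while _ (fun T s' => exists k, let lo := reg s' r_lo in
  let hi := reg s' r_hi in let best := reg s' r_best in
  [/\ hi - lo < 2 ^ k, 40 * k + 10 <= T, xv <= lo <= hi, hi <= xv + sz &
   [/\ best <= reg s r_best,
       forall i, xv <= i < lo -> t i < q,
       forall i, hi <= i < xv + sz -> q <= t i -> best <= t i
     & best = reg s r_best \/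
        exists i, [/\ xv <= i < xv + sz, q <= t i & best = t i]]])).
  exists J; rewrite /s1 /=; split=> //; try lia.
  split=> //; try lia; by left.
move=> T s2 [k]; set lo := reg s2 r_lo; set hi := reg s2 r_hi; set best := reg s2 r_best.
move=> /= [hk hT h1 h2 [h3 h4 h5 h6]] [fr fa].
have qE : reg s2 r_q = q by rewrite fr.
have lbE : reg s2 r_lb = lb by rewrite fr.
have aE : arr s2 0 = arr s 0 by rewrite fa.
exists (lo < hi); split.
- by rewrite /= /binop_eval -/lo -/hi wrapE //; lia.
- by rewrite /=; lia.
- move=> lohi.
  case: k hk hT => [|k]; first by rewrite expn0; lia.
  rewrite expnS => hk hT.
  have hm : lo <= (lo + hi) %/ 2 < hi by lia.
  have [mid midE] : exists mid, mid = (lo + hi) %/ 2 by exists ((lo + hi) %/ 2).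
  rewrite -midE in hm.
  sreg mid.
  sreg (t mid).
    rewrite /= /binop_eval /= lbE wrapE; last lia.
    by rewrite aE tE //; lia.
  aif (t mid < q).
  + move=> tm; areg mid.+1.
    exists k; split=> //; try lia.
    split=> // i hi'; have [|mi] := leqP i mid; last lia.
    move=> im; apply: leq_ltn_trans tm; apply: mono; lia.
  + rewrite -leqNgt => tm; sreg mid; aif (t mid < best).
    - move=> tb; areg (t mid); exists k; split=> //; try lia.
      split=> //; first by lia.
        move=> i hi' qt; have [hii|ihi] := leqP hi i.
          by apply: leq_trans (ltnW tb) _; apply: h5 => //; lia.
        by apply: mono; lia.
      by right; exists mid; split=> //; lia.
    - rewrite -leqNgt => tb; apply: wp_skip; first by lia.
      exists k; split=> //; rewrite /= -/lo -/hi -/best; try lia.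
      split=> //.
      move=> i hi' qt; have [hii|ihi] := leqP hi i; first by apply: h5 => //; lia.
      by apply: leq_trans tb _; apply: mono; lia.
- rewrite -leqNgt => hilo; split=> //.
  move=> i hi'; have [|il] := leqP lo i; last by have := h4 i; lia.
  by move=> loi; apply: h5; lia.
Qed.

(* Level [j] of the table is the base sequence with each aligned block of
   length [2 ^ j] sorted; a last incomplete block is never consulted. *)
Definition sorted_levels (N J : nat) (base tab : nat -> nat) : Prop :=
  forall j b, j < J -> b.+1 * 2 ^ j <= N ->
  let block i := b * 2 ^ j <= i < b.+1 * 2 ^ j in
  [/\ forall i i', block i -> block i' -> i <= i' -> tab (j * N + i) <= tab (j * N + i'),
      forall i, block i -> exists2 p, block p & tab (j * N + i) = base p
    & forall p, block p -> exists2 i, block i & tab (j * N + i) = base p].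

(** The bottom-up decomposition of [[l, r)] known from iterative segment trees: at each block length
    an odd block is split off at either end, after which both ends are aligned to twice the length.
    [q] is the least code whose end is at least [cur]; [n * n] exceeds every code and means that
    nothing was found. *)
Definition range_search : cmd :=
  r_l <- Cell a_A (Reg r_z) ;;
  r_r <- Cell a_A (Cell a_S (Reg r_z)) ;;
  r_q <- Reg r_cur *! Reg r_n ;;
  r_best <- Reg r_n *! Reg r_n ;;
  r_sz <- Lit 1 ;;
  r_lb <- Reg r_tb ;;
  While (Reg r_l <! Reg r_r) (
    If ((Reg r_l /! Reg r_sz) %! Lit 2)
      (block_search r_l ;; r_l <- Reg r_l +! Reg r_sz) Skip ;;
    If ((Reg r_r /! Reg r_sz) %! Lit 2)
      (r_r <- Reg r_r -! Reg r_sz ;; block_search r_r) Skip ;;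
    r_sz <- Reg r_sz *! Lit 2 ;;
    r_lb <- Reg r_lb +! Reg r_N).

Lemma eval_odd_div w s x l sz :
  reg s x = l -> reg s r_sz = sz -> l < 2 ^ w -> 2 < 2 ^ w ->
  eval w s ((Reg x /! Reg r_sz) %! Lit 2) = odd (l %/ sz).
Proof.
move=> /= -> -> lw w2; have lw' := leq_ltn_trans (leq_div l sz) lw.
by rewrite /binop_eval (wrapE w2) (wrapE lw') modn2 wrapE //; case: odd; lia.
Qed.

Definition aligned (j x : nat) : Prop := 2 ^ j %| x.

Lemma aligned_next j l r :
  aligned j l -> aligned j r -> l < r -> l + 2 ^ j <= r /\ aligned j (l + 2 ^ j).
Proof.
move=> ld rd lr; split; last by rewrite /aligned dvdn_add.
have /dvdn_leq : 2 ^ j %| r - l by rewrite dvdn_sub.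
by rewrite subn_gt0 => /(_ lr); move: (2 ^ j) => k; lia.
Qed.

Lemma aligned_even j y : aligned j y -> ~~ odd (y %/ 2 ^ j) -> aligned j.+1 y.
Proof.
move=> /dvdnP[q ->]; rewrite mulnK ?expn_gt0 // -dvdn2 => /dvdnP[q' ->].
by rewrite /aligned -mulnA -expnS dvdn_mull.
Qed.

Lemma aligned_oddD j y : aligned j y -> odd (y %/ 2 ^ j) -> aligned j.+1 (y + 2 ^ j).
Proof.
move=> /dvdnP[q ->]; rewrite mulnK ?expn_gt0 // => oq.
by rewrite /aligned -mulSnr expnS dvdn_mul // dvdn2 /= oq.
Qed.

Lemma aligned_oddB j y : aligned j y -> odd (y %/ 2 ^ j) -> aligned j.+1 (y - 2 ^ j).
Proof.
move=> /dvdnP[q ->]; rewrite mulnK ?expn_gt0 //; case: q => [//|q] oq.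
by rewrite /aligned mulSn addKn expnS dvdn_mul // dvdn2.
Qed.

Lemma alignedW j y : aligned j.+1 y -> aligned j y.
Proof. by apply: dvdn_trans; rewrite dvdn_exp2l. Qed.

(** If [l] and [r] met, then [r] would be aligned to [2 ^ j.+1] and its quotient even; so the right
    block never overlaps what the left step has consumed. *)
Lemma aligned_prev j l r :
  aligned j.+1 l -> aligned j r -> odd (r %/ 2 ^ j) -> l <= r ->
  [/\ 2 ^ j <= r, l <= r - 2 ^ j & aligned j (r - 2 ^ j)].
Proof.
move=> ld rd ro lr.
have lr' : l < r.
  rewrite ltn_neqAle lr andbT; apply: contraTneq ld => ->; apply/negP => d.
  have := aligned_oddD rd ro; rewrite /aligned (dvdn_addr _ d) => /dvdn_leq.
  by rewrite leq_exp2l // ltnn expn_gt0 => /(_ isT).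
have [h _] := aligned_next (alignedW ld) rd lr'.
have h' : 2 ^ j <= r by apply: leq_trans h; rewrite leq_addl.
by split=> //; [move: (2 ^ j) h h' => k; lia | apply: dvdn_sub].
Qed.

(** At most [J] levels with two binary searches each, a search costing [40 * J + 40]. *)
Definition search_cost (J : nat) : nat := J * (80 * J + 200) + 80.

Definition range_min (base : nat -> nat) (l r q best none : nat) : Prop :=
  (forall p, l <= p < r -> q <= base p -> best <= base p) /\
  (best = none \/ exists p, [/\ l <= p < r, q <= base p & best = base p]).

(* One half of a round of the loop: searching the block of length [2 ^ j] at [x]
   extends the examined positions from [ex] to [ex']. *)
Lemma block_step N J base tab j x best best' q (ex ex' : nat -> Prop) none :
  sorted_levels N J base tab -> j < J -> aligned j x -> x + 2 ^ j <= N ->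
  (forall p, ex' p -> ex p \/ x <= p < x + 2 ^ j) ->
  (forall p, ex p -> ex' p) -> (forall p, x <= p < x + 2 ^ j -> ex' p) ->
  let t i := tab (j * N + i) in
  [/\ best' <= best,
      forall i, x <= i < x + 2 ^ j -> q <= t i -> best' <= t i
    & best' = best \/ exists i, [/\ x <= i < x + 2 ^ j, q <= t i & best' = t i]] ->
  (forall p, ex p -> q <= base p -> best <= base p) /\
  (best = none \/ exists p, [/\ ex p, q <= base p & best = base p]) ->
  (forall p, ex' p -> q <= base p -> best' <= base p) /\
  (best' = none \/ exists p, [/\ ex' p, q <= base p & best' = base p]).
Proof.
move=> tab_ok jJ /dvdnP[b xE] xN ex'E exS blS t [h1 h2 h3] [h4 h5].
have E : x + 2 ^ j = b.+1 * 2 ^ j by rewrite mulSn xE addnC.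
have [|_ sub sup] := tab_ok j b jJ; first by rewrite -E.
rewrite -E -xE in sub sup.
split=> [p|].
  case/ex'E => [/h4 h /h|/sup[i ib <-]]; last exact: h2.
  exact: leq_trans.
case: h3 => [->|[i [ib qt ->]]].
  by case: h5 => [->|[p [p1 p2 ->]]]; [left | right; exists p; split=> //; apply: exS].
have [p pb bE] := sub _ ib; right; exists p; split=> //; first exact: blS.
by rewrite -bE.
Qed.

Lemma range_search_spec w s n N J tb z cur l0 r0 (base : nat -> nat) :
  reg s r_n = n -> reg s r_N = N -> reg s r_tb = tb -> reg s r_z = z ->
  reg s r_cur = cur -> arr s a_A z = l0 -> arr s a_A (arr s a_S z) = r0 ->
  l0 <= r0 <= N -> N < 2 ^ J -> 0 < J -> cur <= n ->
  tb + J * N + 4 * N + 10 < 2 ^ w -> n * n < 2 ^ w ->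
  sorted_levels N J base (fun i => arr s 0 (tb + i)) ->
  runs w range_search s (search_cost J) (fun s' =>
    range_min base l0 r0 (cur * n) (reg s' r_best) (n * n)).
Proof.
move=> nE NE tbE zE curE l0E r0E /andP[lr0 r0N] NJ J0 curn ovf ovf2 tab.
rewrite /runs; set T0 := search_cost J; have hT0 : J * (80 * J + 200) + 80 = T0 by [].
have cn : cur * n < 2 ^ w by apply: leq_ltn_trans ovf2; rewrite leq_mul2r curn orbT.
sreg l0; first by rewrite /= zE.
sreg r0; first by rewrite /= zE.
sreg (cur * n).
sreg (n * n).
sreg 1; sreg tb.
set s1 := set_reg _ _ _.
pose K := 80 * J + 200.
apply: (@wp_while _ (fun T s' => exists j, let l := reg s' r_l in
  let r := reg s' r_r in let best := reg s' r_best in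
  [/\ j <= J, (J - j) * K + 10 <= T, reg s' r_sz = 2 ^ j, reg s' r_lb = tb + j * N &
   [/\ aligned j l, aligned j r, l0 <= l <= r, r <= r0 &
       (forall p, (l0 <= p < l \/ r <= p < r0) -> cur * n <= base p -> best <= base p) /\
       (best = n * n \/ exists p, [/\ (l0 <= p < l \/ r <= p < r0),
            cur * n <= base p & best = base p])]])).
  exists 0; rewrite /s1 /=; split=> //; try lia.
  split; rewrite /aligned ?expn0 ?dvd1n //; first by rewrite leqnn.
  by split; [lia | left].
move=> T s2 [j]; set l := reg s2 r_l; set r := reg s2 r_r; set best := reg s2 r_best.
move=> /= [jJ hT szE lbE [ld rd lr rr0 B]] [fr fa].
have [nE' NE' qE a0E] : [/\ reg s2 r_n = n, reg s2 r_N = N, reg s2 r_q = cur * n &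
    arr s2 0 = arr s 0] by split; rewrite ?fr ?fa.
exists (l < r); split.
- by rewrite /= /binop_eval -/l -/r wrapE; lia.
- by rewrite /=; lia.
- move=> ltlr.
  (* As [r] is a positive multiple of [2 ^ j] and at most [N < 2 ^ J], a further round is possible
     only for [j < J]. *)
  have szr : 2 ^ j <= r by apply: dvdn_leq => //; lia.
  have jJ' : j < J by rewrite -(ltn_exp2l _ _ (isT : 1 < 2)); lia.
  have hTK : (J - j.+1) * K + K + 10 <= T by apply: leq_trans hT; rewrite -mulSnr -subSn.
  have jN : j * N + N <= J * N by rewrite -mulSnr leq_mul2r jJ' orbT.
  have {}hTK : exists2 T1, (J - j.+1) * K + 10 <= T1 & T1 + K <= T.
    by exists ((J - j.+1) * K + 10) => //; rewrite addnAC.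
  case: hTK => T1 hT1 hTK; rewrite /K in hTK.
  have expJ : 2 ^ j < 2 ^ J by rewrite ltn_exp2l.
  apply: wp_seq.
  apply: (@wp_conseq _ _ _ _ (fun T' s' => [/\ T <= T' + (40 * J + 60),
    aligned j.+1 (reg s' r_l), l <= reg s' r_l <= r &
    let best := reg s' r_best in let l := reg s' r_l in
    (forall p, (l0 <= p < l \/ r <= p < r0) -> cur * n <= base p -> best <= base p) /\
       (best = n * n \/ exists p, [/\ (l0 <= p < l \/ r <= p < r0),
            cur * n <= base p & best = base p])])).
    apply: (@wp_if _ (odd (l %/ 2 ^ j))); rewrite /=.
    + by apply: eval_odd_div => //; lia.
    + lia.
    + move=> lo; have hl3 := aligned_oddD ld lo; move: lo => _.
      have [hl1 hl2] := aligned_next ld rd ltlr.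
      apply: wp_seq.
      apply: (@wp_runs _ (40 * J + 40)).
      * apply: (@block_search_spec _ _ _ l (2 ^ j) (tb + j * N) (cur * n)
           (fun i => arr s 0 (tb + (j * N + i)))) => //; try lia.
          by move=> i _; rewrite a0E addnA.
        have [b lE] := dvdnP ld; have E : l + 2 ^ j = b.+1 * 2 ^ j by rewrite mulSn lE addnC.
        have [|mono _ _] := tab j b jJ'; first by rewrite -E; lia.
        by move=> i i' h1 h2 h3; apply: mono; rewrite -?E -?lE; lia.
      * lia.
      move=> T' s3 hT' spec [fr3 fa3].
      areg (l + 2 ^ j); first by rewrite /= !fr3 //= -/l szE /binop_eval wrapE; lia.
      split; try lia; first exact: hl3.
      apply: (block_step tab jJ' ld _ _ _ _ spec B); try lia.
    + move=> /(aligned_even ld) lo; apply: wp_skip; first lia.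
      by split=> //; lia.
  move=> T2 s3 [hT2 ld3 lr3 B3] [fr3 fa3].
  set l3 := reg s3 r_l in ld3 lr3 B3.
  have /andP[_ lr3b] := lr3.
  have [rE3 szE3 lbE3 qE3 NE3] : [/\ reg s3 r_r = r, reg s3 r_sz = 2 ^ j,
    reg s3 r_lb = tb + j * N, reg s3 r_q = cur * n & reg s3 r_N = N] by split; rewrite fr3.
  have a0E3 : arr s3 0 = arr s 0 by rewrite fa3.
  apply: wp_seq.
  apply: (@wp_conseq _ _ _ _ (fun T' s' => [/\ T2 <= T' + (40 * J + 60),
    aligned j.+1 (reg s' r_r), l3 <= reg s' r_r <= r &
    let best := reg s' r_best in let r := reg s' r_r in
    (forall p, (l0 <= p < l3 \/ r <= p < r0) -> cur * n <= base p -> best <= base p) /\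
       (best = n * n \/ exists p, [/\ (l0 <= p < l3 \/ r <= p < r0),
            cur * n <= base p & best = base p])])).
    apply: (@wp_if _ (odd (r %/ 2 ^ j))); rewrite /=.
    + by apply: eval_odd_div => //; lia.
    + lia.
    + move=> ro.
      have [hr1 hr2 rd'] := aligned_prev ld3 rd ro lr3b.
      have hr3 := aligned_oddB rd ro; move: ro => _.
      sreg (r - 2 ^ j).
        rewrite /= /binop_eval /wrap rE3 szE3 addnBA; last lia.
        by rewrite addnC -addnBA // modnDl modn_small; lia.
      apply: (@wp_runs _ (40 * J + 40)).
      * apply: (@block_search_spec _ _ _ (r - 2 ^ j) (2 ^ j) (tb + j * N) (cur * n)
           (fun i => arr s 0 (tb + (j * N + i)))) => //=; try lia.
          by move=> i _; rewrite a0E3 addnA.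
        have [b lE] := dvdnP rd'; have E : r - 2 ^ j + 2 ^ j = b.+1 * 2 ^ j by rewrite mulSn lE addnC.
        have [|mono _ _] := tab j b jJ'; first by rewrite -E; lia.
        by move=> i i' h1 h2 h3; apply: mono; rewrite -?E -?lE; lia.
      * lia.
      move=> T' s4 /= hT' spec [fr4 fa4].
      rewrite (fr4 10) //=.
      split; try lia; first exact: hr3.
      apply: (block_step tab jJ' rd' _ _ _ _ spec B3); try lia.
    + move=> /(aligned_even rd) ro; apply: wp_skip; first lia.
      by rewrite rE3; split=> //; lia.
  move=> T3 s4 [hT3 rd4 rr4 B4] [fr4 fa4].
  set r4 := reg s4 r_r in rd4 rr4 B4.
  sreg (2 ^ j.+1).
    by rewrite /= /binop_eval fr4 // szE3 expnSr ?wrapE; lia.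
  areg (tb + j.+1 * N).
    by rewrite /= /binop_eval !fr4 // lbE3 NE3 mulSn ?wrapE; lia.
  exists j.+1; rewrite fr4 //; split=> //; try lia.
  by split=> //; lia.
- rewrite -leqNgt => rl; case: B => B1 B2; split=> [p hp|].
    by apply: B1; lia.
  case: B2 => [|[p [h1 h2 h3]]]; first by left.
  by right; exists p; split=> //; lia.
Qed.

(** * The traversal program *)

(* A linked list of immutable nodes, numbered from [1]; [0] is the empty list. *)
Fixpoint chain (nx tg : nat -> nat) (c h : nat) (l : seq nat) : Prop :=
  if l is b :: l' then [/\ 0 < h, h <= c, tg h = b & chain nx tg c (nx h) l']
  else h = 0.

Lemma chain_fresh nx tg c h l v b :
  chain nx tg c h l -> chain (upd nx c.+1 v) (upd tg c.+1 b) c.+1 h l.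
Proof.
elim: l h => //= a l IH h [h0 hc th hl]; split=> //; first by lia.
  by rewrite /upd ltn_eqF.
have -> : upd nx c.+1 v h = nx h by rewrite /upd ltn_eqF.
exact: IH.
Qed.

Definition total (n : nat) (f : nat -> nat) : nat := \sum_(v < n.+1) f v.

(** With [d] and [e] on opposite sides one statement covers gains and losses without truncated
    subtraction. *)
Lemma total_upd n (f f' : nat -> nat) p d e :
  p <= n -> (forall v, v <= n -> v != p -> f' v = f v) ->
  f' p + d <= f p + e -> total n f' + d <= total n f + e.
Proof.
move=> pn E hp; rewrite /total.
have pn' : p < n.+1 by [].
rewrite (bigD1 (Ordinal pn')) //= [X in _ <= X + _](bigD1 (Ordinal pn')) //=.
rewrite [X in _ + X + _ <= _](eq_bigr (fun i : 'I_n.+1 => f i)); last first.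
  by move=> i /eqP ip; apply: E; [rewrite -ltnS | apply/eqP => ?; apply: ip; apply: val_inj].
move: hp; set B := \sum_(_ < _ | _) _; lia.
Qed.

Lemma total_le n (f : nat -> nat) k : (forall v, v <= n -> f v <= k) -> total n f <= n.+1 * k.
Proof.
move=> h; rewrite /total -[X in _ <= X * _](card_ord n.+1) -sum_nat_const.
by apply: leq_sum => i _; apply: h; rewrite -ltnS.
Qed.

Definition push : cmd :=
  r_nc <- Reg r_nc +! Lit 1 ;;
  SetCell a_tg (Reg r_nc) (Reg r_b) ;;
  SetCell a_nx (Reg r_nc) (Cell a_hd (Reg r_a)) ;;
  SetCell a_hd (Reg r_a) (Reg r_nc).

Definition lists_ok (n : nat) (s : state) (L : nat -> seq nat) : Prop :=
  forall v, v <= n -> chain (arr s a_nx) (arr s a_tg) (reg s r_nc) (arr s a_hd v) (L v).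

Definition add_list (L : nat -> seq nat) (a b : nat) : nat -> seq nat :=
  fun v => if v == a then b :: L v else L v.

Lemma mem_add_list L y x a b :
  (b \in add_list L y x a) = (b \in L a) || ((a == y) && (b == x)).
Proof. by rewrite /add_list; case: eqP => _; rewrite ?inE ?orbF // orbC. Qed.

Lemma push_spec w s n L :
  reg s r_a <= n -> lists_ok n s L -> (reg s r_nc).+1 < 2 ^ w -> 1 < 2 ^ w ->
  runs w push s 20 (fun s' => lists_ok n s' (add_list L (reg s r_a) (reg s r_b)) /\
    reg s' r_nc = (reg s r_nc).+1).
Proof.
move=> an ok ovf w1.
sreg (reg s r_nc).+1.
scell (reg s r_nc).+1 (reg s r_b).
scell (reg s r_nc).+1 (arr s a_hd (reg s r_a)).
acell (reg s r_a) (reg s r_nc).+1.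
split=> // v vn; rewrite /add_list /=; case: eqP => [->|_]; last first.
  exact: chain_fresh (ok v vn).
rewrite /= eqxx; split=> //; exact: chain_fresh (ok _ an).
Qed.

Definition visit : cmd :=
  r_time <- Reg r_time +! Lit 1 ;;
  SetCell a_V (Reg r_p) (Reg r_time) ;;
  SetCell a_F (Reg r_p) (Reg r_cur) ;;
  r_cur <- Reg r_p ;;
  r_p <- Cell a_P (Reg r_cur).

Lemma visit_spec w s :
  (reg s r_time).+1 < 2 ^ w -> 1 < 2 ^ w ->
  runs w visit s 20 (fun s' =>
    [/\ arr s' a_V = upd (arr s a_V) (reg s r_p) (reg s r_time).+1,
        arr s' a_F = upd (arr s a_F) (reg s r_p) (reg s r_cur),
        reg s' r_time = (reg s r_time).+1, reg s' r_cur = reg s r_p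
      & reg s' r_p = arr s a_P (reg s r_p)]).
Proof.
move=> ovf w1.
sreg (reg s r_time).+1.
scell (reg s r_p) (reg s r_time).+1.
scell (reg s r_p) (reg s r_cur).
sreg (reg s r_p).
by areg (arr s a_P (reg s r_p)).
Qed.

Definition climb_cmd : cmd := visit ;; While (Cell a_V (Reg r_p) =! Lit 0) visit.

Definition scan_cmd : cmd :=
  r_z <- Reg r_cur ;;
  While (Reg r_z <! Cell a_S (Reg r_cur)) (
    If (Lit 0 <! Cell a_V (Reg r_z))
      (r_z <- Reg r_z +! Lit 1)
      (range_search ;;
       r_a <- Reg r_best /! Reg r_n ;;
       r_b <- Reg r_best %! Reg r_n ;;
       push ;;
       r_z <- Cell a_S (Reg r_z))).

(** The parent of the dummy root is set to [n + 1], which serves as the sentinel that ends the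
    loop. *)
Definition traverse : cmd :=
  While (Reg r_cur <! Reg r_n +! Lit 1) (
    If (Cell a_hd (Reg r_cur) =! Lit 0)
      (SetCell a_fin (Reg r_cur) (Reg r_time +! Lit 1) ;;
       r_cur <- Cell a_F (Reg r_cur))
      (r_p <- Cell a_tg (Cell a_hd (Reg r_cur)) ;;
       SetCell a_hd (Reg r_cur) (Cell a_nx (Cell a_hd (Reg r_cur))) ;;
       If (Cell a_V (Reg r_p) =! Lit 0) (climb_cmd ;; scan_cmd) Skip)).

(* The positions [A z, A (S z)) of the base sequence hold the codes
   [y * n + x] of the edges [x - y] with [x] in the subtree of [z]. *)
Record adjacency_codes (n N : nat) (G : rel nat) (S A base : nat -> nat) : Prop :=
  AdjacencyCodes {
  ac_range : forall z, z < n -> A z <= A (S z) <= N;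
  ac_sup : forall z x y, z < n -> z <= x < S z -> G x y ->
    exists2 p, A z <= p < A (S z) & base p = y * n + x;
  ac_sub : forall z p, z < n -> A z <= p < A (S z) ->
    exists x y, [/\ G x y, z <= x < S z & base p = y * n + x] }.

Section Traverse.
Variables (w n N J tb NC : nat) (G X : rel nat) (P S A base : nat -> nat) (tab : nat -> nat).
Hypothesis fo : forest n G P S.
Hypothesis X_dom : forall a b, X a b -> a <= n /\ b <= n.
Hypothesis X_root : forall v, v < n -> X n v.
Hypothesis codes : adjacency_codes n N G S A base.
Hypothesis levels : sorted_levels N J base (fun i => tab (tb + i)).
Hypothesis N_lt : N < 2 ^ J.
Hypothesis J_gt0 : 0 < J.
Hypothesis tb_lt : tb + J * N + 4 * N + 10 < 2 ^ w.
Hypothesis nn_lt : n * n < 2 ^ w.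
Hypothesis n_lt : n + 10 < 2 ^ w.
Hypothesis NC_lt : NC + 10 < 2 ^ w.
Let H : rel nat := fun a b => G a b || X a b.

(** Bounds the clock by [n + 1], which excludes overflow and gives the bound on the final exit
    times. *)
Definition visited_ok (s : state) : Prop :=
  reg s r_time <= total n (fun v => 0 < arr s a_V v).

Lemma visited_le s : visited_ok s -> reg s r_time <= n.+1.
Proof.
move=> h; apply: leq_trans h _; rewrite -[X in _ <= X]muln1.
by apply: total_le => v _; case: (0 < _).
Qed.

(** Every vertex of the path stops being unvisited and releases 200 credits, which pay for its own
    visit; [K] is left for the scan and the rest of the search. *)
Lemma climb_run s L0 T K :
  search_inv n G X P S (arr s a_V) (arr s a_F) (arr s a_fin) (reg s r_time) (reg s r_cur) L0 ->
  reg s r_p < n -> arr s a_V (reg s r_p) = 0 -> H (reg s r_cur) (reg s r_p) ->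
  visited_ok s -> (forall v, v < n -> arr s a_P v = P v) ->
  200 * total n (fun v => arr s a_V v == 0) + K <= T ->
  wp w climb_cmd s T (fun T' s' =>
    [/\ dfs_state n H (arr s' a_V) (arr s' a_F) (arr s' a_fin) (reg s' r_time) (reg s' r_cur),
        climb n S (arr s a_V) (reg s r_time) (reg s r_p) (arr s' a_V) (reg s' r_cur),
        0 < arr s' a_V (P (reg s' r_cur)), visited_ok s'
      & 200 * total n (fun v => arr s' a_V v == 0) + K + 100 <= T']).
Proof.
move=> I pn Vp Hp vok PE hT.
have vok1 (s1 s2 : state) p : p < n -> arr s1 a_V p = 0 ->
    arr s2 a_V = upd (arr s1 a_V) p (reg s1 r_time).+1 ->
    reg s2 r_time = (reg s1 r_time).+1 -> visited_ok s1 ->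
    visited_ok s2 /\ total n (fun v => arr s2 a_V v == 0) + 1 <= total n (fun v => arr s1 a_V v == 0).
  move=> pn' V1 E Et; rewrite /visited_ok Et E => ok1; split.
    suff: total n (fun v => 0 < arr s1 a_V v) + 1 <=
      total n (fun v => 0 < upd (arr s1 a_V) p (reg s1 4).+1 v) + 0 by lia.
    apply: (@total_upd _ _ _ p); first exact: ltnW.
      by move=> v _ /negbTE vp; rewrite /upd vp.
    by rewrite /upd eqxx V1.
  rewrite -[X in _ <= X]addn0; apply: (@total_upd _ _ _ p); first exact: ltnW.
    by move=> v _ /negbTE vp; rewrite /upd vp.
  by rewrite /upd eqxx V1.
apply: wp_seq; apply: (wp_runs (visit_spec _ _)); try by have := visited_le vok; lia.
  have : 1 <= total n (fun v => arr s a_V v == 0); last by lia.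
  apply: (@leq_trans (total n (fun v => v == reg s r_p))).
    rewrite /total (bigD1 (Ordinal (ltnW pn : reg s r_p < n.+1))) //= eqxx; lia.
  by apply: leq_sum => i _; case: eqP => // ->; rewrite Vp.
move=> T1 s1 hT1 [VE FE tE cE pE] [fr fa].
have [vok_1 hV1] := vok1 s s1 _ pn Vp VE tE vok; rewrite VE in hV1.
have [D1 C1] := climb_start fo X_dom I (conj pn Vp) Hp.
apply: (@wp_while _ (fun T' s' =>
    [/\ dfs_state n H (arr s' a_V) (arr s' a_F) (arr s' a_fin) (reg s' r_time) (reg s' r_cur),
        climb n S (arr s a_V) (reg s r_time) (reg s r_p) (arr s' a_V) (reg s' r_cur),
        reg s' r_p = P (reg s' r_cur), visited_ok s'
      & 200 * total n (fun v => arr s' a_V v == 0) + K + 150 <= T'])).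
  rewrite VE FE tE cE pE PE // (fa a_fin) //; split=> //; try lia.
move=> T2 s2 [D C pE2 vok2 hT2] [fr2 fa2].
have [rn _ _] := cl_root C.
exists (arr s2 a_V (reg s2 r_p) == 0); split; try (by rewrite /=; lia).
- ev.
- move=> /eqP V0.
  apply: (wp_runs (visit_spec _ _)); rewrite /=; try by have := visited_le vok2; lia.
  move=> T3 s3 hT3 [VE3 FE3 tE3 cE3 pE3] [fr3 fa3].
  have pn2 : P (reg s2 r_cur) < n.
    rewrite ltn_neqAle (forest_parn fo) // andbT; apply/eqP => E.
    by move: V0; rewrite pE2 E (ds_root D).
  have [vok_3 hV3] := vok1 s2 s3 _ pn2 (eq_trans (congr1 _ (esym pE2)) V0)
    (etrans VE3 (congr1 (fun p => upd _ p _) pE2)) tE3 vok2.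
  rewrite VE3 FE3 tE3 cE3 pE3 (fa3 a_fin) // pE2.
  have [|D3 C3] := climb_step fo X_dom (conj pn Vp) Hp D C; first by rewrite -pE2.
  split=> //.
  + by rewrite fa2 // fa // PE.
  + by move: hV3; rewrite VE3 pE2; lia.
- rewrite -lt0n pE2 => VP; split=> //; rewrite /=; lia.
Qed.

Let sc := search_cost J.

(* [g] marks the visited vertices already passed by a scan, [q] the subtree
   roots already searched. *)
Definition scan_credit (g q : nat -> bool) (L : nat -> seq nat) : nat :=
  200 * total n (fun v => ~~ g v) + (sc + 400) * total n (fun v => ~~ q v) +
  200 * total n (fun v => size (L v)).

Lemma scan_run s V0 F0 c0 cur0 y L0 L (g q : nat -> bool) T K :
  search_inv n G X P S V0 F0 (arr s a_fin) c0 cur0 L0 -> y < n -> V0 y = 0 -> H cur0 y ->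
  dfs_state n H (arr s a_V) (arr s a_F) (arr s a_fin) (reg s r_time) (reg s r_cur) ->
  climb n S V0 c0 y (arr s a_V) (reg s r_cur) -> 0 < arr s a_V (P (reg s r_cur)) ->
  scan n G X S (arr s a_fin) (arr s a_V) (reg s r_cur) L (reg s r_cur) ->
  lists_ok n s L -> reg s r_nc + total n (fun v => ~~ q v) <= NC ->
  (forall v, v < n -> g v -> 0 < V0 v) ->
  (forall z, z < n -> q z -> P z < n /\ 0 < V0 (P z)) ->
  (forall v, v < n -> arr s a_S v = S v) -> (forall v, v <= n -> arr s a_A v = A v) ->
  arr s 0 = tab -> reg s r_tb = tb -> reg s r_N = N -> reg s r_n = n ->
  scan_credit g q L + K + 60 <= T ->
  wp w scan_cmd s T (fun T' s' => exists (g q : nat -> bool) L,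
    [/\ search_inv n G X P S (arr s' a_V) (arr s' a_F) (arr s' a_fin) (reg s' r_time) (reg s' r_cur) L,
        lists_ok n s' L, reg s' r_nc + total n (fun v => ~~ q v) <= NC,
        scan_credit g q L + K <= T' &
        (forall v, v < n -> g v -> 0 < arr s' a_V v) /\
        (forall z, z < n -> q z -> P z < n /\ 0 < arr s' a_V (P z))]).
Proof.
move=> I yn V0y Hy D C VP sc0 ok nc g0 q0 SE AE tabE tbE NE nE hT.
have ynew : y < n /\ V0 y = 0 by [].
have [rn r0 ryS] := cl_root C.
sreg (reg s r_cur).
set s1 := set_reg _ _ _.
apply: (@wp_while _ (fun T' s' => exists (g q : nat -> bool) L, let z := reg s' r_z in
  [/\ scan n G X S (arr s a_fin) (arr s a_V) (reg s r_cur) L z,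
      lists_ok n s' L, reg s' r_nc + total n (fun v => ~~ q v) <= NC,
      scan_credit g q L + K + 40 <= T' &
      (forall v, v < n -> g v -> 0 < arr s a_V v /\ (0 < V0 v \/ v < z)) /\
      (forall z', z' < n -> q z' -> [/\ P z' < n, 0 < arr s a_V (P z')
         & 0 < V0 (P z') \/ z' < z])])).
  exists g, q, L; rewrite /s1 /=; split=> //; first by lia.
  split=> [v vn gv|z zn qz].
    by split; [apply/(cl_vis C); left; apply: g0 | left; apply: g0].
  by have [h1 h2] := q0 z zn qz; split=> //; [apply/(cl_vis C); left | left].
move=> T2 s2 [g2 [q2 [L2]]]; set z := reg s2 r_z.
move=> /= [scz ok2 nc2 hT2 [hg hq]] [fr fa].
have ez : reg s2 r_z = z by [].
have [curE nE2 NE2 tbE2] : [/\ reg s2 r_cur = reg s r_cur, reg s2 r_n = n,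
    reg s2 r_N = N & reg s2 r_tb = tb] by split; rewrite fr.
have [VE AE2 SE2 tabE2] : [/\ arr s2 a_V = arr s a_V, arr s2 a_A = arr s a_A,
    arr s2 a_S = arr s a_S & arr s2 0 = tab] by split; rewrite fa.
have [SrE [zS zr]] : arr s2 a_S (reg s2 r_cur) = S (reg s r_cur) /\ z <= S (reg s r_cur) /\ reg s r_cur <= z.
  by rewrite curE SE2 SE //; have := sc_range scz; lia.
have Srn : S (reg s r_cur) <= n by have := forest_sub fo rn; lia.
exists (z < S (reg s r_cur)); split; try (by rewrite /=; lia).
- by rewrite /= SrE /binop_eval -/z wrapE; lia.
- move=> ltz; have zn : z < n by lia.
  have unmark (f : nat -> bool) : f z = false ->
      total n (fun v => ~~ (if v == z then true else f v)) + 1 <= total n (fun v => ~~ f v).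
    move=> fz; rewrite -[X in _ <= X]addn0; apply: (@total_upd _ _ _ z); first exact: ltnW.
      by move=> v _ /negbTE->.
    by rewrite eqxx fz.
  apply: (@wp_if _ (0 < arr s a_V z)); rewrite /=.
  + by rewrite -/z VE /binop_eval !wrapE; lia.
  + by lia.
  + move=> Vz; areg z.+1.
    have gz : g2 z = false.
      apply/negP => /(hg z zn)[_ [V0z|]]; last lia.
      by have := climb_subtree I C (v := z); rewrite zr ltz => /(_ isT); lia.
    exists (fun v => if v == z then true else g2 v), q2, L2; split=> //.
    * exact: (scan_visited ynew Hy VP scz ltz Vz).
    * by move: hT2; rewrite /scan_credit; have := unmark g2 gz; lia.
    split=> [v vn|z' z'n qz'].
      by case: eqP => [-> _|_ /(hg v vn)[h1 h2]]; split=> //; [right | case: h2; [left | right; lia]].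
    by have [h1 h2 h3] := hq z' z'n qz'; split=> //; case: h3; [left | right; lia].
  + rewrite -eqn0Ngt => /eqP Vz.
    have [_ Pn rP rz] := scan_parent fo ynew Hy C VP scz ltz Vz.
    have [Pz zSP GP] := forest_par fo zn Pn.
    have /andP[zSz Szn] := forest_sub fo zn.
    have V0P : V0 (P z) = 0 by apply: (climb_subtree I C); lia.
    have qz : q2 z = false.
      by apply/negP => /(hq z zn)[_ _ [|]]; rewrite ?V0P //; lia.
    have /andP[A1 A2] := ac_range codes zn.
    have credit := unmark q2 qz.
    have hT3 : sc + 400 + (200 * total n (fun v => ~~ g2 v) +
        (sc + 400) * total n (fun v => ~~ (if v == z then true else q2 v)) +
        200 * total n (fun v => size (L2 v))) + K + 40 <= T2.
      have : (sc + 400) * total n (fun v => ~~ (if v == z then true else q2 v)) + (sc + 400)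
          <= (sc + 400) * total n (fun v => ~~ q2 v).
        by move: credit; rewrite addn1 -mulnSr leq_mul2l => ->; rewrite orbT.
      move: hT2; rewrite /scan_credit.
      move: (_ * total n (fun v => ~~ (if _ then _ else _))) => A3.
      by move: (_ * total n (fun v => ~~ q2 v)) => A4; lia.
    apply: wp_seq; apply: (wp_runs (B := sc)).
    * apply: (@range_search_spec w s2 n N J tb z (reg s r_cur) (A z) (A (S z)) base) => //.
      - by rewrite AE2 AE //; lia.
      - by rewrite AE2 SE2 SE // AE.
      - by rewrite A1 A2.
      - exact: ltnW.
      - by rewrite tabE2.
    * lia.
    move=> T3 s3 hT3' [bmin bex] [fr3 fa3].
    (* The tree edge from [z] to [P z] is a candidate, since [P z] is not below the root of the
       climb; so the search succeeds with a code less than [n * n]. *)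
    have [|p0 p0r p0E] := ac_sup codes zn (x := z) (y := P z) _ GP; first by rewrite leqnn.
    have n0 : 0 < n by lia.
    have best_lt : reg s3 r_best < n * n.
      have : P z * n + z < n * n.
        apply: (@leq_trans ((P z).+1 * n)); first by rewrite mulSnr ltn_add2l.
        by rewrite leq_mul2r Pn orbT.
      apply: leq_ltn_trans; rewrite -p0E; apply: bmin => //.
      by rewrite p0E; apply: leq_trans (leq_addr _ _); rewrite leq_mul2r rP orbT.
    case: bex => [E|[p [pr qp bE]]]; first by move: best_lt; rewrite E ltnn.
    have [x2 [y2 [G2 x2r pE]]] := ac_sub codes zn pr.
    have x2n : x2 < n by lia.
    have dE u v : v < n -> (u * n + v) %/ n = u by move=> vn; rewrite divnMDl // divn_small // addn0.
    have y2n : y2 < n by rewrite -(dE y2 x2 x2n) -pE -bE ltn_divLR.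
    have ry2 : reg s r_cur <= y2.
      rewrite -(dE y2 x2 x2n) -[X in X <= _](dE _ 0) // addn0; apply: leq_div2r.
      by rewrite -pE.
    (* The end is the quotient of the code by [n], and quotients are monotone: a least code has a
       least end. *)
    have y2min a x : G a x -> z <= x < S z -> reg s r_cur <= a -> y2 <= a.
      move=> Gax xr ra; have xn : x < n by lia.
      have [|p' p'r p'E] := ac_sup codes zn (x := x) (y := a) xr; first by rewrite (forest_sym fo).
      rewrite -(dE y2 x2 x2n) -(dE a x xn); apply: leq_div2r.
      rewrite -pE -bE -p'E; apply: bmin => //.
      by rewrite p'E; apply: leq_trans (leq_addr _ _); rewrite leq_mul2r ra orbT.
    have [scz' _ _ V0P' VP'] := scan_unvisited fo I ynew Hy C VP scz ltz Vz x2r ry2 G2 y2min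
      (mem_add_list L2 y2 x2).
    apply: wp_seq; apply: (@wp_reg _ y2).
      by rewrite /= (fr3 r_n) // nE2 bE pE /binop_eval dE // wrapE //; lia.
      by rewrite /=; lia.
    apply: wp_seq; apply: (@wp_reg _ x2).
      by rewrite /= (fr3 r_n) // nE2 bE pE /binop_eval modnMDl modn_small // wrapE //; lia.
      by rewrite /=; lia.
    have nc3 : reg s3 r_nc = reg s2 r_nc by rewrite fr3.
    have q_pos : 0 < total n (fun v => ~~ q2 v) by lia.
    apply: wp_seq; apply: (wp_runs (@push_spec w _ n L2 _ _ _ _)) => /=.
    * exact: ltnW.
    * by move=> v vn; rewrite /= !fa3 // fr3 //; apply: ok2.
    * by rewrite nc3; lia.
    * lia.
    * lia.
    move=> T4 s4 hT4 [ok4 nc4] [fr4 fa4].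
    areg (S z).
      by rewrite /= fr4 //= fr3 // -/z (fa4 a_S) //= (fa3 a_S) // SE2 SE.
    exists g2, (fun v => if v == z then true else q2 v), (add_list L2 y2 x2); split=> //.
    * by rewrite /= nc4 /= nc3; lia.
    * have : 200 * total n (fun v => size (add_list L2 y2 x2 v)) <=
        200 * total n (fun v => size (L2 v)) + 200.
        rewrite -[X in _ <= _ + X]muln1 -mulnDr leq_mul2l /= -[X in X <= _]addn0.
        apply: (@total_upd _ _ _ y2); first exact: ltnW.
          by move=> v _ /negbTE vy; rewrite /add_list vy.
        by rewrite /add_list eqxx /= addn0 addn1.
      by rewrite /scan_credit; lia.
    split=> [v vn gv|z' z'n].
      by have [h1 h2] := hg v vn gv; split=> //; case: h2; [left | right; lia].
    case: eqP => [-> _|_ qz']; first by split=> //; right.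
    by have [h1 h2 h3] := hq z' z'n qz'; split=> //; case: h3; [left | right; lia].
- rewrite -leqNgt => zge; have zE : z = S (reg s r_cur) by lia.
  exists g2, q2, L2; split=> //; last first.
  + split=> [v vn gv|z' z'n qz']; first by rewrite VE; have [] := hg v vn gv.
    by rewrite VE; have [] := hq z' z'n qz'.
  + by rewrite /=; lia.
  have [FE finE] : arr s2 a_F = arr s a_F /\ arr s2 a_fin = arr s a_fin by rewrite !fa.
  have tE : reg s2 r_time = reg s r_time by rewrite fr.
  rewrite VE FE finE tE curE.
  by apply: (scan_end fo I ynew Hy D C VP); rewrite -zE.
Qed.

(** Per vertex, 200 credits pay for its visit, 200 for being passed by a scan, [sc + 400] for its
    search as a subtree root and 200 for leaving it, which makes [sc + 1000]; each list entry
    carries another 200. *)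
Lemma traverse_run s L T :
  search_inv n G X P S (arr s a_V) (arr s a_F) (arr s a_fin) (reg s r_time) (reg s r_cur) L ->
  lists_ok n s L -> reg s r_nc + n.+1 <= NC -> visited_ok s ->
  (forall v, v < n -> arr s a_P v = P v) ->
  (forall v, v < n -> arr s a_S v = S v) -> (forall v, v <= n -> arr s a_A v = A v) ->
  arr s 0 = tab -> reg s r_tb = tb -> reg s r_N = N -> reg s r_n = n ->
  n.+1 * (sc + 1000) + 200 * total n (fun v => size (L v)) + 100 <= T ->
  runs w traverse s T (fun s' => dfs_done n H (arr s' a_V) (arr s' a_F) (arr s' a_fin)).
Proof.
move=> I0 ok0 nc0 vok0 PE SE AE tabE tbE NE nE hT.
have all1 (f : nat -> bool) : total n f <= n.+1.
  by rewrite -[X in _ <= X]muln1; apply: total_le => v _; case: (f v).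
(* Leaving the dummy root sets [r_cur] to [n + 1], where the search invariant has no meaning; hence
   the disjunction. *)
apply: (@wp_while _ (fun T' s' =>
  [/\ reg s' r_cur = n.+1, 20 <= T' & dfs_done n H (arr s' a_V) (arr s' a_F) (arr s' a_fin)] \/
  exists (g q : nat -> bool) L,
    [/\ search_inv n G X P S (arr s' a_V) (arr s' a_F) (arr s' a_fin) (reg s' r_time) (reg s' r_cur) L,
        lists_ok n s' L, reg s' r_nc + total n (fun v => ~~ q v) <= NC,
        visited_ok s' &
     [/\ (forall v, v < n -> g v -> 0 < arr s' a_V v),
         (forall z, z < n -> q z -> P z < n /\ 0 < arr s' a_V (P z)) &
         200 * total n (fun v => arr s' a_V v == 0) + (scan_credit g q L +
         (200 * total n (fun v => arr s' a_fin v == 0) + 50)) <= T']])).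
  right; exists (fun _ => false), (fun _ => false), L; split=> //.
    by apply: leq_trans nc0; rewrite leq_add2l; apply: (all1 (fun=> true)).
  split=> //; apply: leq_trans hT.
  have h1 := all1 (fun v => arr s a_V v == 0); have h2 := all1 (fun v => arr s a_fin v == 0).
  have h3 : total n (fun=> 1) <= n.+1 := all1 (fun=> true).
  have -> : scan_credit (fun=> false) (fun=> false) L = 200 * total n (fun=> 1) +
     (sc + 400) * total n (fun=> 1) + 200 * total n (fun v => size (L v)) by [].
  have : (sc + 400) * total n (fun=> 1) <= (sc + 400) * n.+1 by rewrite leq_mul2l h3 orbT.
  move: (total n (fun=> 1)) h3 => t1 h3.
  by move: (total n (fun v => arr s a_V v == 0)) h1 => t2; move: (total n (fun v => arr s a_fin v == 0)) h2 => t3; lia.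
move=> T2 s2 [[curE hT2 dd] [fr fa]|[g [q [L2 [I ok nc vok [hg hq hT2]]]]] [fr fa]].
  exists false; split=> //; last by rewrite /=; lia.
  by rewrite /= curE fr // nE /binop_eval !wrapE; lia.
have [c1 c2 c3] := ds_cur (si_dfs I).
set cur := reg s2 r_cur in c1 c2 c3.
have ecur : reg s2 r_cur = cur by [].
have nE2 : reg s2 r_n = n by rewrite fr.
have tle := visited_le vok.
exists true; split=> //; try (by rewrite /=; lia).
  by rewrite /= nE2 /binop_eval ecur !wrapE; lia.
move=> _; aif (arr s2 a_hd cur == 0); first by rewrite /= /binop_eval ecur !wrapE; lia.
- move=> /eqP hd0.
  have L0 : L2 cur = [::] by move: (ok cur c1); rewrite hd0; case: (L2 cur) => //= ? ? [].
  have credit : total n (fun v => upd (arr s2 a_fin) cur (reg s2 r_time).+1 v == 0) + 1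
      <= total n (fun v => arr s2 a_fin v == 0).
    rewrite -[X in _ <= X]addn0; apply: (@total_upd _ _ _ cur) => //.
      by move=> v _ /negbTE vy; rewrite /upd vy.
    by rewrite /upd eqxx c3.
  scell cur (reg s2 r_time).+1.
  areg (arr s2 a_F cur); first by rewrite /= ecur.
  have [ec|ec] := eqVneq cur n.
    left; split; first by rewrite ec (ds_rootF (si_dfs I)).
      by lia.
    move: I L0; rewrite ecur ec => I L0.
    exact: (search_finish fo X_dom X_root I L0).
  right; exists g, q, L2; split=> //.
    exact: search_leave.
  split=> //; first by move: credit; rewrite /upd; lia.
- move=> hd0; have := ok cur c1; case E: (L2 cur) => [|y l] /=; first by move=> h; rewrite h in hd0.
  move=> [h1 h2 h3 h4].
  pose L1 a := if a == cur then l else L2 a.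
  have Hy : H cur y by apply: (si_list I c1); rewrite E inE eqxx.
  have yn : y <= n by have [] := H_dom fo X_dom Hy.
  have sizeL : total n (fun v => size (L1 v)) + 1 <= total n (fun v => size (L2 v)).
    rewrite -[X in _ <= X]addn0; apply: (@total_upd _ _ _ cur) => //.
      by move=> v _ /negbTE vy; rewrite /L1 vy.
    by rewrite /L1 eqxx E /= addn0 addn1.
  have L1sub a b : b \in L1 a -> b \in L2 a.
    by rewrite /L1; case: eqP => // ->; rewrite E inE => ->; rewrite orbT.
  have L1sup a b : b \in L2 a -> b \in L1 a \/ (a = cur /\ b = y).
    rewrite /L1; case: eqP => [->|_]; last by left.
    by rewrite E inE => /orP[/eqP->|]; [right | left].
  have hT3 : 200 * total n (fun v => arr s2 a_V v == 0) + (scan_credit g q L1 +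
         (200 * total n (fun v => arr s2 a_fin v == 0) + 50)) + 200 <= T2.
    by apply: leq_trans hT2; rewrite /scan_credit; lia.
  sreg y; first by rewrite /= ecur.
  scell cur (arr s2 a_nx (arr s2 a_hd cur)); first by rewrite /= ecur.
  set s3 := set_cell _ _ _ _.
  have ok3 : lists_ok n s3 L1.
    by move=> v vn; rewrite /L1 /s3 /=; case: (v =P cur) => _; [exact: h4 | exact: ok].
  aif (arr s2 a_V y == 0).
  + move=> /eqP Vy0.
    have yltn : y < n.
      by rewrite ltn_neqAle yn andbT; apply: contra_eq_neq Vy0 => ->; rewrite (ds_root (si_dfs I)).
    apply: wp_seq.
    pose K := scan_credit g q L1 + (200 * total n (fun v => arr s2 a_fin v == 0) + 50).
    have := @climb_run s3 L2 _ K; rewrite /s3 /=; move=> climbP.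
    apply: (wp_conseq (climbP _ _ _ _ _ _ _ _)) => //.
    * by move=> v vn; rewrite fa // PE.
    * by rewrite /K; lia.
    move=> T4 s4 [D4 C4 VP4 vok4 hT4] [fr4 fa4].
    rewrite /= in fr4 fa4.
    have fin4 : arr s4 a_fin = arr s2 a_fin by rewrite fa4.
    have := @scan_run s4 (arr s2 a_V) (arr s2 a_F) (reg s2 r_time) cur y L2 L1 g q T4
      (200 * total n (fun v => arr s4 a_V v == 0) + (200 * total n (fun v => arr s2 a_fin v == 0) + 50)).
    move=> scanP; apply: (wp_conseq (scanP _ _ _ _ _ _ _ _ _ _ _ _ _ _ _ _ _ _ _)) => //.
    * by rewrite fin4.
    * by rewrite fin4; apply: (scan_start fo I (conj yltn Vy0) Hy C4 VP4).
    * by move=> v vn; rewrite !fa4 // fr4 //; apply: ok3.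
    * by rewrite fr4 //= fr.
    * by move=> v vn; rewrite fa4 //= fa // SE.
    * by move=> v vn; rewrite fa4 //= fa // AE.
    * by rewrite fa4 //= fa.
    * by rewrite fr4 //= fr.
    * by rewrite fr4 //= fr.
    * by rewrite fr4 //= fr.
    * by move: hT4; rewrite /K; lia.
    move=> T5 s5 [g5 [q5 [L5 [I5 ok5 nc5 hT5 [hg5 hq5]]]]] [fr5 fa5].
    right; exists g5, q5, L5; split=> //.
      by rewrite /visited_ok fa5 // fr5.
    split=> //; rewrite (fa5 a_fin) // (fa5 a_V) // fin4; by lia.
  + rewrite -lt0n => Vy; apply: wp_skip; first by lia.
    right; exists g, q, L1; split=> //.
    * exact: (search_skip fo I Vy).
    split=> //; by rewrite /s3 /=; lia.
Qed.

End Traverse.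

(** * Setting up the search from edge lists *)

Definition adj (E : seq (nat * nat)) : rel nat :=
  fun a b => ((a, b) \in E) || ((b, a) \in E).

Definition relabel (I : nat -> nat) (E : seq (nat * nat)) : seq (nat * nat) :=
  [seq (I p.1, I p.2) | p <- E].

Definition extra (n : nat) (E : seq (nat * nat)) : rel nat :=
  fun a b => [|| (a == n) && (b < n), (b == n) && (a < n) | adj E a b].

Definition below (n : nat) (E : seq (nat * nat)) : Prop :=
  forall p, p \in E -> p.1 < n /\ p.2 < n.

Lemma adj_sym E : symmetric (adj E).
Proof. by move=> a b; rewrite /adj orbC. Qed.

Lemma adj_below n E a b : below n E -> adj E a b -> a < n /\ b < n.
Proof. by move=> h /orP[] /h[]. Qed.

Lemma below_relabel n I E :
  (forall v, v < n -> I v < n) -> below n E -> below n (relabel I E).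
Proof. by move=> hI hE p /mapP[q /hE[h1 h2] ->]; split; apply: hI. Qed.

Lemma extra_dom n E : below n E -> forall a b, extra n E a b -> a <= n /\ b <= n.
Proof.
move=> h a b /or3P[/andP[/eqP-> ?]|/andP[/eqP-> ?]|/(adj_below h)[? ?]];
  by split=> //; apply: ltnW.
Qed.

Lemma extra_sym n E : symmetric (extra n E).
Proof. by move=> a b; rewrite /extra adj_sym orbCA. Qed.

Lemma search_start n G P S E (V F fin : nat -> nat) L :
  forest n G P S -> below n E ->
  (forall v, V v = (v == n)) -> F n = n.+1 -> (forall v, fin v = 0) ->
  (forall y x, (x \in L y) = ((y == n) && (x < n) || adj E y x)) ->
  search_inv n G (extra n E) P S V F fin 1 n L.
Proof.
move=> fo hE VE FE finE LE.
have V0 v : 0 < V v -> v = n by rewrite VE; case: eqP.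
split.
- split=> //; try by move=> *; rewrite ?finE; left.
  + by rewrite VE eqxx.
  + by rewrite leqnn VE eqxx finE.
  + by move=> v _; rewrite VE; case: eqP.
  + move=> u v _ _ /V0-> E'; apply: V0; by rewrite E' VE eqxx.
  + by move=> u _; rewrite finE.
  + by move=> u _ /V0->.
  + by move=> v vn /V0 E'; move: vn; rewrite E' ltnn.
  + move=> u v _ vn /V0-> ; rewrite !VE eqxx; lia.
  + by move=> a b _; rewrite finE.
- by move=> a x Gax /V0 E'; have := forest_dom fo Gax; rewrite E' ltnn.
- move=> a x Xax; rewrite VE LE; case: eqP => // xn _.
  by case/or3P: Xax => [->//|/andP[/eqP //]|->]; rewrite orbT.
- by move=> u v uv vS un /V0 E'; have := forest_sub fo un; rewrite -E'; lia.
- by move=> a b _; rewrite LE /extra => /orP[->|->]; rewrite !orbT.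
Qed.

(** One pass fills the list of the dummy root with all vertices and inverts the numbering; [a_O]
    fixes [n], so that the root keeps its code. *)
Definition init_lists : cmd :=
  For r_i (Reg r_n) (
    r_a <- Reg r_n ;; r_b <- Reg r_i ;; push ;;
    SetCell a_O (Cell a_I (Reg r_i)) (Reg r_i)) ;;
  SetCell a_O (Reg r_n) (Reg r_n).

(** The register [len] counts words, two for each edge, and [off] skips the two header cells of the
    stored data. *)
Definition add_edges (arr off len : nat) : cmd :=
  For r_i (Reg len /! Lit 2) (
    r_a <- Cell a_I (Cell arr (Reg r_i *! Lit 2 +! Lit off)) ;;
    r_b <- Cell a_I (Cell arr (Reg r_i *! Lit 2 +! Lit off.+1)) ;;
    push ;;
    r_v <- Reg r_a ;; r_a <- Reg r_b ;; r_b <- Reg r_v ;;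
    push).

(** Shared by three uses: the preprocessing and the queries to a sparse graph run it on the trivial
    forest, with the edges of the graph as extra ones; the queries to a dense graph run it on the
    stored forest, with only [U] extra. With no edges stored in array 0, [r_len] keeps its initial
    value 0. *)
Definition search_all : cmd :=
  init_lists ;;
  add_edges 0 2 r_len ;;
  add_edges 1 0 1 ;;
  SetCell a_V (Reg r_n) (Lit 1) ;;
  SetCell a_F (Reg r_n) (Reg r_n +! Lit 1) ;;
  r_time <- Lit 1 ;;
  r_cur <- Reg r_n ;;
  traverse.

Definition lists_of (n : nat) (s : state) (Q : seq (nat * nat)) : Prop :=
  exists L, [/\ lists_ok n s L, forall y x, (x \in L y) = ((y, x) \in Q),
    total n (fun v => size (L v)) <= size Q & reg s r_nc = size Q].

Lemma push_pair w s n Q :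
  reg s r_a <= n -> lists_of n s Q -> (size Q).+1 < 2 ^ w -> 1 < 2 ^ w ->
  runs w push s 20 (fun s' => lists_of n s' ((reg s r_a, reg s r_b) :: Q)).
Proof.
move=> an [L [ok LE sz nc]] ovf w1.
apply: (runs_conseq (@push_spec w s n L an ok _ w1)) => //; first by rewrite nc.
move=> s' [ok' nc'] _; exists (add_list L (reg s r_a) (reg s r_b)); split=> //.
- by move=> y x; rewrite mem_add_list LE inE xpair_eqE orbC.
- rewrite -[X in X <= _]addn0; apply: (@leq_trans (total n (fun v => size (L v)) + 1)).
    apply: (@total_upd _ _ _ (reg s r_a)) => //; first by move=> v _ /negbTE vy; rewrite /add_list vy.
    by rewrite /add_list eqxx /= addn0 addn1.
  by rewrite addn1.
- by rewrite nc' nc.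
Qed.

Definition stores (s : state) (a off : nat) (E : seq (nat * nat)) : Prop :=
  forall e, e < size E -> arr s a (e * 2 + off) = (nth (0, 0) E e).1 /\
    arr s a (e * 2 + off.+1) = (nth (0, 0) E e).2.

Section SearchAll.
Variables (w n : nat).
Hypothesis n_lt : n + 10 < 2 ^ w.
Hypothesis w_gt1 : 1 < w.

Lemma init_lists_spec s (I : nat -> nat) :
  reg s r_n = n -> reg s r_nc = 0 -> (forall v, arr s a_hd v = 0) ->
  (forall v, v < n -> arr s a_I v = I v /\ I v < n) ->
  {in gtn n &, injective I} ->
  runs w init_lists s (n * 60 + 30) (fun s' =>
    (exists Q, [/\ lists_of n s' Q, size Q = n &
      forall p, (p \in Q) = ((p.1 == n) && (p.2 < n))]) /\
    (forall v, v < n -> arr s' a_O (I v) = v) /\ arr s' a_O n = n).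
Proof.
move=> nE nc hd IE Iinj.
apply: wp_seq; apply: (wp_runs (@runs_for w (fun i s' =>
  (exists Q, [/\ lists_of n s' Q, size Q = i &
      forall p, (p \in Q) = ((p.1 == n) && (p.2 < i))]) /\
  (forall v, v < i -> arr s' a_O (I v) = v)) r_i n 30 _ _ _ w_gt1 _ _ _ _)) => //.
- lia.
- split=> //; exists [::]; split=> //; last by move=> p; rewrite andbF.
  exists (fun _ => [::]); split=> //.
  + by move=> v vn; rewrite /= hd.
  + by rewrite /total big1.
- by move=> i s1 _ _ _ [fr _]; rewrite /= fr.
- move=> i s1 iltn [[Q [hQ sQ mQ]] hO] xi [fr fa].
  have nE1 : reg s1 r_n = n by rewrite fr.
  have [IiE Iin] := IE i iltn.
  have IE1 : arr s1 a_I i = I i by rewrite fa.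
  sreg n; sreg i.
  apply: wp_seq; apply: (wp_runs (@push_pair w _ n Q _ _ _ _)) => //=; try lia.
  move=> T2 s2 hT2 hQ2 [fr2 fa2].
  acell (I i) i.
  + by rewrite /= fr2 // fa2 //= xi IE1.
  + by rewrite /= fr2.
  split; first by rewrite /= fr2.
  split.
    exists ((n, i) :: Q); split=> //; first by rewrite /= sQ.
    move=> [p1 p2] /=; rewrite inE mQ xpair_eqE /= [in RHS]ltnS [in RHS]leq_eqVlt.
    by rewrite -andb_orr.
  move=> v; rewrite ltnS leq_eqVlt => /orP[/eqP->|vi] /=; first by rewrite eqxx.
  have [e|_] := eqVneq (I v) (I i).
    by have := Iinj v i; rewrite !inE (ltn_trans vi iltn) iltn e => /(_ isT isT erefl).
  by rewrite fa2 //=; apply: hO.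
- by rewrite /=; lia.
move=> T1 s1 /= hT1 [[[Q [hQ sQ mQ]] hO] _] [fr fa].
acell n n.
- by rewrite /= fr.
- by rewrite /= fr.
split; first by exists Q.
split=> [v vn|] /=; last by rewrite eqxx.
by rewrite ltn_eqF; [apply: hO | have [] := IE v vn].
Qed.

Lemma add_edges_spec s a off len (E : seq (nat * nat)) Q (I : nat -> nat) :
  len \notin [:: r_a; r_b; r_v; r_nc; r_i] -> a \notin [:: a_tg; a_nx; a_hd] ->
  reg s len = 2 * size E -> stores s a off E -> below n E ->
  (forall v, v < n -> arr s a_I v = I v /\ I v < n) ->
  lists_of n s Q -> size Q + 4 * size E + off + 10 < 2 ^ w ->
  runs w (add_edges a off len) s (size E * 100 + 20) (fun s' =>
    exists Q', [/\ lists_of n s' Q', size Q' = size Q + 2 * size E &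
      forall p, (p \in Q') = (p \in Q) || adj (relabel I E) p.1 p.2]).
Proof.
rewrite !inE !negb_or => /and5P[l1 l2 l3 l4 l5] /and3P[a1 a2 a3].
move=> lenE hE bE IE hQ ovf.
apply: (runs_conseq (@runs_for w (fun i s' =>
  exists Q', [/\ lists_of n s' Q', size Q' = size Q + 2 * i &
      forall p, (p \in Q') = (p \in Q) || adj (relabel I (take i E)) p.1 p.2])
  r_i (size E) 80 _ _ _ w_gt1 _ _ _ _)) => //.
- lia.
- exists Q; split=> //; first by rewrite addn0.
  by move=> p; rewrite take0 /adj /= orbF.
- move=> i s1 _ _ _ [fr _]; rewrite /= fr //.
    by rewrite lenE /binop_eval !wrapE; lia.
  by rewrite /= !inE !negb_or l1 l2 l3 l4 l5.
- move=> i s1 iltE [Q1 [hQ1 sQ1 mQ1]] xi [fr fa].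
  have [e1 e2] := hE i iltE.
  have aE : arr s1 a = arr s a by rewrite fa //= !inE !negb_or a1 a2 a3.
  have pE : nth (0, 0) E i \in E by apply: mem_nth.
  case p_E : (nth (0, 0) E i) pE e1 e2 => [u v] uvE /= e1 e2.
  have [un vn] := bE _ uvE; rewrite /= in un vn.
  have [Iu Iun] := IE u un; have [Iv Ivn] := IE v vn.
  have IE1 : arr s1 a_I = arr s a_I by rewrite fa.
  apply: wp_seq; apply: (@wp_reg _ (I u)); [|by rewrite /=; lia|].
    by rewrite /= /binop_eval xi !wrapE ?aE ?e1 ?IE1 //; lia.
  apply: wp_seq; apply: (@wp_reg _ (I v)); [|by rewrite /=; lia|].
    by rewrite /= /binop_eval xi !wrapE ?aE ?e2 ?IE1 //; lia.
  apply: wp_seq; apply: (wp_runs (@push_pair w _ n Q1 _ _ _ _)) => //=; try lia.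
  move=> T2 s2 hT2 hQ2 [fr2 fa2].
  sreg (I u); first by rewrite /= fr2.
  sreg (I v); first by rewrite /= fr2.
  sreg (I u).
  apply: (wp_runs (@push_pair w _ n ((I u, I v) :: Q1) _ _ _ _)) => //=; try lia.
  move=> T3 s3 hT3 hQ3 [fr3 fa3].
  split; first by rewrite fr3 //= fr2.
  exists [:: (I v, I u), (I u, I v) & Q1]; split=> //; first by rewrite /= sQ1; lia.
  move=> [p1 p2] /=; rewrite !inE mQ1 /= (take_nth (0, 0) iltE) /relabel map_rcons p_E /=.
  rewrite /adj !mem_rcons !inE !xpair_eqE /=.
  move: ((p1, p2) \in Q) => b1.
  move: ((p1, p2) \in _) ((p2, p1) \in _) => b2 b3.
  rewrite [(p2 == I u) && _]andbC.
  by case: (_ && _); case: (_ && _); case: b1; case: b2; case: b3.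
- by rewrite /=; lia.
- by move=> s' [h _] _; rewrite take_size in h.
Qed.

Lemma search_all_spec s (N J : nat) (G : rel nat) (P S A base I : nat -> nat) (E0 E1 : seq (nat * nat)) :
  forest n G P S -> adjacency_codes n N G S A base ->
  sorted_levels N J base (fun i => arr s 0 (reg s r_tb + i)) ->
  N < 2 ^ J -> 0 < J -> reg s r_tb + J * N + 4 * N + 10 < 2 ^ w -> n * n < 2 ^ w ->
  2 * n + 10 * (size E0 + size E1) + 30 < 2 ^ w ->
  (forall v, v < n -> arr s a_I v = I v /\ I v < n) -> {in gtn n &, injective I} ->
  (forall v, v < n -> arr s a_P v = P v) -> (forall v, v < n -> arr s a_S v = S v) ->
  (forall v, v <= n -> arr s a_A v = A v) ->
  reg s r_n = n -> reg s r_N = N -> reg s r_nc = 0 ->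
  (forall v, arr s a_hd v = 0) -> (forall v, arr s a_V v = 0) -> (forall v, arr s a_fin v = 0) ->
  reg s r_len = 2 * size E0 -> stores s 0 2 E0 -> below n E0 ->
  reg s 1 = 2 * size E1 -> stores s 1 0 E1 -> below n E1 ->
  runs w search_all s (n.+1 * (search_cost J + 2000) + 1000 * (size E0 + size E1) + 1000)
    (fun s' => [/\ dfs_done n (fun a b => G a b || extra n (relabel I (E0 ++ E1)) a b)
                     (arr s' a_V) (arr s' a_F) (arr s' a_fin),
                   forall v, v < n -> arr s' a_O (I v) = v & arr s' a_O n = n]).
Proof.
move=> fo codes levels NJ J0 tb_lt nn_lt ovf IE Iinj PE SE AE nE NE nc hd VE finE.
move=> len0 st0 b0 len1 st1 b1.
set E := relabel I (E0 ++ E1).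
have bE : below n E.
  apply: below_relabel; first by move=> v /IE[].
  by move=> p; rewrite mem_cat => /orP[/b0|/b1].
apply: wp_seq; apply: (wp_runs (init_lists_spec nE nc hd IE Iinj)); first lia.
move=> T1 s1 hT1 [[Q1 [hQ1 sQ1 mQ1]] [hO1 hOn1]] [fr1 fa1].
apply: wp_seq; apply: (wp_runs (@add_edges_spec s1 0 2 r_len E0 Q1 I _ _ _ _ _ _ _ _)) => //.
- by rewrite fr1.
- by move=> e he; rewrite fa1 //; apply: st0.
- by move=> v vn; rewrite fa1 //; apply: IE.
- lia.
- lia.
move=> T2 s2 hT2 [Q2 [hQ2 sQ2 mQ2]] [fr2 fa2].
apply: wp_seq; apply: (wp_runs (@add_edges_spec s2 1 0 1 E1 Q2 I _ _ _ _ _ _ _ _)) => //.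
- by rewrite fr2 // fr1.
- by move=> e he; rewrite fa2 // fa1 //; apply: st1.
- by move=> v vn; rewrite fa2 // fa1 //; apply: IE.
- lia.
- lia.
move=> T3 s3 hT3 [Q3 [hQ3 sQ3 mQ3]] [fr3 fa3].
have n3 : reg s3 r_n = n by rewrite fr3 // fr2 // fr1.
scell n 1; scell n n.+1; sreg 1; sreg n.
have [L [okL LE sL ncL]] := hQ3.
set s4 := set_reg _ _ _.
have A0 : arr s4 0 = arr s 0 by rewrite /s4 /= fa3 // fa2 // fa1.
have V4 v : arr s4 a_V v = (v == n).
  by rewrite /s4 /=; case: eqP => // _; rewrite fa3 // fa2 // fa1.
apply: (wp_conseq (Q := fun _ s' => dfs_done n (fun a b => G a b || extra n E a b)
     (arr s' a_V) (arr s' a_F) (arr s' a_fin))).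
  (* The bound on list nodes allows for [n] at the root, two for each edge, and one for each
     possible subtree search. *)
  apply: (@traverse_run w n N J (reg s r_tb) (2 * n + 10 * (size E0 + size E1) + 10) G (extra n E)
    P S A base (arr s 0) fo (extra_dom bE) _ codes levels NJ J0 tb_lt nn_lt n_lt _ s4 L).
  - by move=> v vn; rewrite /extra eqxx vn.
  - lia.
  - change (search_inv n G (extra n E) P S (arr s4 a_V) (arr s4 a_F) (arr s4 a_fin) 1 n L).
    apply: search_start => //.
    + by rewrite /s4 /= eqxx.
    + by move=> v; rewrite /s4 /= fa3 // fa2 // fa1.
    + move=> y x; rewrite LE mQ3 mQ2 mQ1 /= -orbA; congr (_ || _).
      by rewrite /adj /E /relabel map_cat !mem_cat; case: (_ \in _); case: (_ \in _); rewrite ?orbT.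
  - exact: okL.
  - by rewrite /s4 /= ncL; lia.
  - rewrite /visited_ok /s4 /= /total (bigD1 (Ordinal (ltnSn n))) //= eqxx; lia.
  - by move=> v vn; rewrite /s4 /= fa3 // fa2 // fa1 // PE.
  - by move=> v vn; rewrite /s4 /= fa3 // fa2 // fa1 // SE.
  - by move=> v vn; rewrite /s4 /= fa3 // fa2 // fa1 // AE.
  - exact: A0.
  - by rewrite /s4 /= fr3 // fr2 // fr1.
  - by rewrite /s4 /= fr3 // fr2 // fr1.
  - by [].
  - rewrite sQ3 sQ2 sQ1 in sL.
    have EC : n.+1 * (search_cost J + 2000) = n.+1 * (search_cost J + 1000) + n.+1 * 1000.
      by rewrite -mulnDr -addnA.
    by rewrite EC in hT1; move: (_ * (search_cost J + 1000)) hT1 => A1 hT1; lia.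
move=> T5 s5 dd [fr5 fa5]; split=> //.
- by move=> v vn; rewrite fa5 // /s4 /= fa3 // fa2 //; apply: hO1.
- by rewrite fa5 // /s4 /= fa3 // fa2.
Qed.

Definition init_trivial : cmd :=
  For r_i (Reg r_n) (
    SetCell a_I (Reg r_i) (Reg r_i) ;;
    SetCell a_P (Reg r_i) (Reg r_n) ;;
    SetCell a_S (Reg r_i) (Reg r_i +! Lit 1)).

Lemma init_trivial_spec s :
  reg s r_n = n ->
  runs w init_trivial s (n * 60 + 30) (fun s' => forall v, v < n ->
    [/\ arr s' a_I v = v, arr s' a_P v = n & arr s' a_S v = v.+1]).
Proof.
move=> nE.
apply: (runs_conseq (@runs_for w (fun i s' => forall v, v < i ->
    [/\ arr s' a_I v = v, arr s' a_P v = n & arr s' a_S v = v.+1]) r_i n 30 _ _ _ w_gt1 _ _ _ _)) => //.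
- lia.
- by move=> i s1 _ _ _ [fr _]; rewrite /= fr.
- move=> i s1 iltn hi xi [fr fa].
  have nE1 : reg s1 r_n = n by rewrite fr.
  scell i i; scell i n; acell i i.+1.
  split=> // v; rewrite ltnS leq_eqVlt => /orP[/eqP->|vi] /=; first by rewrite eqxx.
  by rewrite ltn_eqF //; apply: hi.
- by rewrite /=; lia.
- by move=> s' [].
Qed.

End SearchAll.

(** With the empty graph and one-vertex trees, every climb has length one and no scan makes a
    search: what remains is ordinary depth-first search along the lists. *)
Definition no_edge : rel nat := fun _ _ => false.

Lemma forest_trivial n : forest n no_edge (fun=> n) succn.
Proof. by split=> // *; lia. Qed.

Lemma codes_trivial n base : adjacency_codes n 0 no_edge succn (fun=> 0) base.
Proof. by split=> // z p _; lia. Qed.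

Lemma levels_trivial J base tab : sorted_levels 0 J base tab.
Proof. by move=> j b _; rewrite leqn0 muln_eq0 expn_eq0. Qed.

(** * Answering a query *)

(** Enough levels for [n * n] positions, which bounds the number of adjacency entries. *)
Definition levels_nb (n : nat) : nat := 2 * (log2 n).+1.

(* Contents of the data structure for the graph with edge list [E]: a sparse
   graph is stored as its list of edges, which costs [O(n)] to search from
   scratch; otherwise there are the preorder [I] of a depth-first forest, the
   arrays [P], [S] describing the forest, and the sorted levels. *)
Definition sparse_data (n : nat) (E : seq (nat * nat)) (s : state) : Prop :=
  [/\ arr s 0 0 = n, arr s 0 1 = 2 * size E, size E <= n & stores s 0 2 E].

(** Cell 1 tells the two formats apart: it exceeds [2 * n] only here. After the two header cells
    come three arrays of length [n] and one of length [n + 1], which puts the levels at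
    [4 * n + 3]. *)
Record dense_layout (n : nat) (E : seq (nat * nat)) (D : nat -> nat)
    (N : nat) (I P S A base : nat -> nat) : Prop := DenseLayout {
  dl_n : D 0 = n;
  dl_m : 2 * n < D 1;
  dl_perm : forall v, v < n -> D (2 + v) = I v /\ I v < n;
  dl_inj : {in gtn n &, injective I};
  dl_par : forall v, v < n -> D (2 + n + v) = P v;
  dl_sub : forall v, v < n -> D (2 + 2 * n + v) = S v;
  dl_first : forall v, v <= n -> D (2 + 3 * n + v) = A v;
  dl_total : A n = N /\ N <= n * n;
  dl_forest : forest n (adj (relabel I E)) P S;
  dl_codes : adjacency_codes n N (adj (relabel I E)) S A base;
  dl_levels : sorted_levels N (levels_nb n) base (fun i => D (4 * n + 3 + i)) }.

Definition data_ok (n : nat) (E : seq (nat * nat)) (s : state) : Prop :=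
  sparse_data n E s \/ exists N I P S A base, dense_layout n E (arr s 0) N I P S A base.

Definition load_dense : cmd :=
  For r_i (Reg r_n) (
    SetCell a_I (Reg r_i) (Cell 0 (Lit 2 +! Reg r_i)) ;;
    SetCell a_P (Reg r_i) (Cell 0 (Lit 2 +! Reg r_n +! Reg r_i)) ;;
    SetCell a_S (Reg r_i) (Cell 0 (Lit 2 +! Lit 2 *! Reg r_n +! Reg r_i)) ;;
    SetCell a_A (Reg r_i) (Cell 0 (Lit 2 +! Lit 3 *! Reg r_n +! Reg r_i))) ;;
  SetCell a_A (Reg r_n) (Cell 0 (Lit 2 +! Lit 3 *! Reg r_n +! Reg r_n)) ;;
  r_N <- Cell a_A (Reg r_n) ;;
  r_tb <- Lit 4 *! Reg r_n +! Lit 3.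

(** Parents are found in the numbering of the forest and translated back by [a_O]. The stored data
    has been read by then, so the answer may overwrite array 0. *)
Definition query : cmd :=
  r_n <- Cell 0 (Lit 0) ;;
  If (Lit 2 *! Reg r_n <! Cell 0 (Lit 1))
    load_dense
    (init_trivial ;; r_len <- Cell 0 (Lit 1)) ;;
  search_all ;;
  For r_i (Reg r_n)
    (SetCell 0 (Reg r_i) (Cell a_O (Cell a_F (Cell a_I (Reg r_i))))) ;;
  0 <- Reg r_n.

Definition fresh (s : state) : Prop :=
  (forall x, 2 <= x -> reg s x = 0) /\ (forall a i, 2 <= a -> arr s a i = 0).

(** The cost of [search_all] contributes 2000; the other 2900 cover the at most [2 * n] edges read
    directly, at 1000 each, and the linear loops around the search. *)
Definition query_cost (n : nat) : nat := n.+1 * (search_cost (levels_nb n) + 4900).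

Lemma eq_dfs_done n (H H' : rel nat) V F fin :
  (forall a b, H a b = H' a b) -> dfs_done n H V F fin -> dfs_done n H' V F fin.
Proof.
move=> E D; split; try by case: D.
- by move=> v vn; have [? ? ?] := dd_par D vn; rewrite E.
- by move=> a b; rewrite -E; apply: (dd_edge D).
Qed.

Lemma expn_levels n : n * n < 2 ^ levels_nb n.
Proof.
have h : n < 2 ^ (log2 n).+1 by apply: trunc_log_ltn.
by rewrite /levels_nb mul2n -addnn expnD ltn_mul.
Qed.

Section Query.
Variables (w n : nat) (E M : seq (nat * nat)).
Hypothesis bE : below n E.
Hypothesis bM : below n M.
Hypothesis M_le : size M <= n.
Hypothesis w_gt1 : 1 < w.
Hypothesis w_big : levels_nb n * (n * n) + 4 * (n * n) + 100 * n + 100 < 2 ^ w.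

Lemma load_dense_spec s N I P S A base :
  reg s r_n = n -> dense_layout n E (arr s 0) N I P S A base ->
  runs w load_dense s (n * 100 + 100) (fun s' =>
    [/\ forall v, v < n -> [/\ arr s' a_I v = I v, arr s' a_P v = P v & arr s' a_S v = S v],
        forall v, v <= n -> arr s' a_A v = A v, reg s' r_N = N & reg s' r_tb = 4 * n + 3]).
Proof.
move=> nE D.
have dl0 := dl_first D.
apply: wp_seq; apply: (wp_runs (@runs_for w (fun i s' => forall v, v < i ->
  [/\ arr s' a_I v = I v, arr s' a_P v = P v, arr s' a_S v = S v & arr s' a_A v = A v])
  r_i n 80 _ _ _ w_gt1 _ _ _ _)) => //.
- lia.
- by move=> i s1 _ _ _ [fr _]; rewrite /= fr.
- move=> i s1 iltn hi xi [fr fa].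
  have nE1 : reg s1 r_n = n by rewrite fr.
  have aE : arr s1 0 = arr s 0 by rewrite fa.
  have [Ii _] := dl_perm D iltn.
  have Pi := dl_par D iltn; have Si := dl_sub D iltn; have Ai := dl0 i (ltnW iltn).
  scell i (I i); first by rewrite /= /binop_eval xi !wrapE ?aE //; lia.
  scell i (P i); first by rewrite /= /binop_eval xi nE1 !wrapE ?aE //; lia.
  scell i (S i); first by rewrite /= /binop_eval xi nE1 !wrapE ?aE //; lia.
  acell i (A i); first by rewrite /= /binop_eval xi nE1 !wrapE ?aE //; lia.
  split=> // v; rewrite ltnS leq_eqVlt => /orP[/eqP->|vi] /=; first by rewrite eqxx.
  by rewrite ltn_eqF //; apply: hi.
- by rewrite /=; lia.
move=> T1 s1 /= hT1 [hs1 _] [fr fa].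
have nE1 : reg s1 r_n = n by rewrite fr.
have aE : arr s1 0 = arr s 0 by rewrite fa.
scell n (A n).
  by rewrite /= /binop_eval nE1 !wrapE ?aE ?dl0 //; lia.
sreg N; first by rewrite /= nE1 eqxx; have [-> _] := dl_total D.
areg (4 * n + 3).
split=> //.
  by move=> v vn; have [] := hs1 v vn.
move=> v; rewrite leq_eqVlt => /orP[/eqP->|vn] /=; first by rewrite eqxx.
by rewrite ltn_eqF //; have [] := hs1 v vn.
Qed.

Definition query_result (s' : state) : Prop :=
  exists (I : nat -> nat) V F fin,
    [/\ forall v, v < n -> I v < n, {in gtn n &, injective I},
        dfs_done n (extra n (relabel I (E ++ M))) V F fin, reg s' 0 = n
      & forall v, v < n -> (F (I v) = n -> arr s' 0 v = n) /\
          forall u, u < n -> F (I v) = I u -> arr s' 0 v = u].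

Lemma query_output s I V F fin (H : rel nat) T :
  reg s r_n = n -> (forall v, v < n -> arr s a_I v = I v /\ I v < n) ->
  {in gtn n &, injective I} ->
  arr s a_F = F -> (forall v, v < n -> arr s a_O (I v) = v) -> arr s a_O n = n ->
  (forall a b, H a b = extra n (relabel I (E ++ M)) a b) ->
  dfs_done n H V F fin -> n * 60 + 60 <= T ->
  runs w (For r_i (Reg r_n)
    (SetCell 0 (Reg r_i) (Cell a_O (Cell a_F (Cell a_I (Reg r_i))))) ;;
    0 <- Reg r_n) s T query_result.
Proof.
move=> nE IE Iinj FE OE On HE D hT.
apply: wp_seq; apply: (wp_runs (@runs_for w (fun i s' => forall v, v < i ->
  arr s' 0 v = arr s a_O (F (I v))) r_i n 30 _ _ _ w_gt1 _ _ _ _)) => //.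
- lia.
- by move=> i s1 _ _ _ [fr _]; rewrite /= fr.
- move=> i s1 iltn hi xi [fr fa].
  have [Ii _] := IE i iltn.
  acell i (arr s a_O (F (I i))); first by rewrite /= xi !fa // Ii FE.
  split=> // v; rewrite ltnS leq_eqVlt => /orP[/eqP->|vi] /=; first by rewrite eqxx.
  by rewrite ltn_eqF //; apply: hi.
- by rewrite /=; lia.
move=> T1 s1 /= hT1 [hs1 _] [fr fa].
areg n; first by rewrite /= fr.
exists I, V, F, fin; split=> //.
- by move=> v /IE[].
- exact: eq_dfs_done D.
move=> v vn; rewrite hs1 //; split=> [->//|u un ->].
exact: OE.
Qed.

Lemma query_spec s :
  data_ok n E s -> fresh s -> reg s 1 = 2 * size M -> stores s 1 0 M ->
  runs w query s (query_cost n) query_result.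
Proof.
move=> data [r0 a0] lenM stM.
rewrite /runs; set T0 := query_cost n.
have hT0 : n.+1 * (search_cost (levels_nb n) + 2000) + 2900 * n.+1 <= T0.
  by rewrite /T0 /query_cost [2900 * _]mulnC -mulnDr leq_mul2l -addnA leqnn orbT.
have ovf4 : 4 * n < 2 ^ w by lia.
have nnw : n * n < 2 ^ w by lia.
have D0 : arr s 0 0 = n by case: data => [[]|[N [I [P [S [A [base D]]]]]]] //; apply: dl_n D.
apply: wp_seq; apply: (@wp_reg _ n) => /=; [by rewrite wrapE //; lia | by lia | ].
set s1 := set_reg _ _ _.
have w2 : 4 <= 2 ^ w by lia.
case: data => [[_ D1 sE stE]|[N [I [P [S [A [base D]]]]]]].
- apply: wp_seq; apply: (@wp_if _ false); rewrite /=; [|by lia|by []|].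
    by rewrite /binop_eval /= !wrapE ?D1; lia.
  move=> _; apply: wp_seq; apply: (wp_runs (@init_trivial_spec w n _ w_gt1 s1 _)) => //; try lia.
  move=> T2 s2 hT2 triv [fr2 fa2].
  areg (2 * size E); first by rewrite /= wrapE ?fa2 //; lia.
  set s3 := set_reg _ _ _.
  have frs x : x \notin [:: r_n; r_i; r_len] -> reg s3 x = reg s x.
    by rewrite !inE !negb_or => /and3P[/negbTE h1 h2 /negbTE h3]; rewrite /s3 /= h3 fr2 /= ?h1 // !inE !negb_or h2.
  have fas a : a \notin [:: a_I; a_P; a_S] -> arr s3 a = arr s a.
    by move=> h; rewrite /s3 /= fa2.
  apply: wp_seq.
  apply: (wp_runs (@search_all_spec w n _ w_gt1 s3 0 (levels_nb n) no_edge (fun=> n) succn (fun=> 0) (fun=> 0) id E M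
     (forest_trivial n) (codes_trivial n _) (levels_trivial (J := levels_nb n) _ _)
     _ _ _ _ _ _ _ _ _ _ _ _ _ _ _ _ _ _ _ _ _ _)) => //; try by [rewrite frs // r0 | lia].
  + by rewrite frs // r0 //; lia.
  + by move=> v vn; have [-> _ _] := triv v vn.
  + by move=> v vn; have [_ -> _] := triv v vn.
  + by move=> v vn; have [_ _ ->] := triv v vn.
  + by move=> v _; rewrite fas // a0.
  + by rewrite /s3 /= fr2.
  + by move=> v; rewrite fas // a0.
  + by move=> v; rewrite fas // a0.
  + by move=> v; rewrite fas // a0.
  + by move=> e he; rewrite fas //; apply: stE.
  + by move=> e he; rewrite fas //; apply: stM.
  move=> T4 s4 hT4 [dd OE On] [fr4 fa4].
  apply: (wp_conseq (Q := fun _ => query_result)) => //.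
  apply: (@query_output s4 id _ _ _ _ _ _ _ _ _ OE On _ dd) => //.
  + by rewrite fr4 // /s3 /= fr2.
  + by move=> v vn; rewrite fa4 //; have [-> _ _] := triv v vn.
  + by move: hT0 hT4; move: (_ * (_ + 2000)) => K; lia.
- have [AN Nn] := dl_total D; have m_gt := dl_m D.
  apply: wp_seq; apply: (@wp_if _ true); rewrite /=; [|by lia| |by []].
    by rewrite /binop_eval /= !wrapE ?m_gt //; lia.
  move=> _; apply: (wp_runs (@load_dense_spec s1 N I P S A base erefl D)); first by lia.
  move=> T3 s3 hT3 [h1 h2 NE tbE] [fr3 fa3].
  have frs x : x \notin [:: r_n; r_i; r_N; r_tb] -> reg s3 x = reg s x.
    by rewrite !inE !negb_or => /and4P[/negbTE g1 g2 g3 g4]; rewrite fr3 /= ?g1 // !inE !negb_or g2 g3 g4.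
  have fas a : a \notin [:: a_I; a_P; a_S; a_A] -> arr s3 a = arr s a.
    rewrite !inE !negb_or => /and4P[g1 g2 g3 g4].
    by rewrite fa3 //= !inE !negb_or g1 g2 g3 g4.
  have JN : levels_nb n * N <= levels_nb n * (n * n) by rewrite leq_mul2l Nn orbT.
  apply: wp_seq.
  apply: (wp_runs (@search_all_spec w n _ w_gt1 s3 N (levels_nb n) (adj (relabel I E)) P S A base I [::] M
     (dl_forest D) (dl_codes D) _
     _ _ _ _ _ _ _ _ _ _ _ _ _ _ _ _ _ _ _ _ _ _)) => //; try by [rewrite frs // r0 | lia].
  + by rewrite tbE fas //; apply: dl_levels D.
  + exact: leq_ltn_trans Nn (expn_levels n).
  + by rewrite /=; lia.
  + by move=> v vn; have [-> _ _] := h1 v vn; have [] := dl_perm D vn.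
  + exact: dl_inj D.
  + by move=> v vn; have [_ -> _] := h1 v vn.
  + by move=> v vn; have [_ _ ->] := h1 v vn.
  + by rewrite fr3.
  + by move=> v; rewrite fas // a0.
  + by move=> v; rewrite fas // a0.
  + by move=> v; rewrite fas // a0.
  + by move=> e he; rewrite fas //; apply: stM.
  + by move: hT0; rewrite [size [::]]/=; move: (_ * (_ + 2000)) => K; lia.
  move=> T4 s4 hT4 [dd OE On] [fr4 fa4].
  apply: (wp_conseq (Q := fun _ => query_result)) => //.
  apply: (@query_output s4 I _ _ _ _ _ _ _ _ _ OE On _ dd) => //.
  + by rewrite fr4 // fr3.
  + by move=> v vn; rewrite fa4 //; have [-> _ _] := h1 v vn; have [] := dl_perm D vn.
  + exact: dl_inj D.
  + move=> a b; rewrite /extra /adj /relabel /= map_cat !mem_cat.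
    by do 4 case: (_ \in _); do 2 case: (_ && _).
  + by rewrite [size [::]]/= in hT4; move: hT0 hT4; move: (_ * (_ + 2000)) => K; lia.
Qed.
End Query.

(** * From the numbered search to a DFS tree *)

Definition nat_pairs (n : nat) (L : seq ('I_n * 'I_n)) : seq (nat * nat) :=
  [seq (val p.1, val p.2) | p <- L].

Lemma below_nat_pairs n (L : seq ('I_n * 'I_n)) : below n (nat_pairs L).
Proof. by move=> p /mapP[q _ ->] /=. Qed.

(** The case [x = y] absorbs degenerate pairs; it is harmless because every vertex is its own
    ancestor. *)
Lemma set2_eq (T : finType) (x y a b : T) :
  [set x; y] = [set a; b] -> [\/ x = y, x = a /\ y = b | x = b /\ y = a].
Proof.
move=> E; have xi : x \in [set a; b] by rewrite -E set21.
have yi : y \in [set a; b] by rewrite -E set22.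
case/set2P: xi => xE; case/set2P: yi => yE; subst; by [constructor 1 | constructor 2 | constructor 3].
Qed.

Section DfsTree.
Variables (n : nat) (EL ML : seq ('I_n * 'I_n)) (E U : {set {set 'I_n}}).
Hypothesis EE : lists_edges EL E.
Hypothesis UU : lists_edges ML U.

Lemma mem_lists_edges (e : {set 'I_n}) :
  (e \in E :|: U) = (e \in [seq [set p.1; p.2] | p <- EL ++ ML]).
Proof. by rewrite inE map_cat mem_cat (perm_mem EE) (perm_mem UU) !mem_enum. Qed.

Variables (I V F fin : nat -> nat).
Hypothesis I_lt : forall v, v < n -> I v < n.
Hypothesis I_inj : {in gtn n &, injective I}.
Hypothesis D : dfs_done n (extra n (relabel I (nat_pairs EL ++ nat_pairs ML))) V F fin.

Definition code (x : option 'I_n) : nat := if x is Some v then I (val v) else n.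

(** If [F (I v)] is [n], no [u] matches, and [pick] returns [None], which is the dummy root. *)
Definition tree_parent (x : option 'I_n) : option 'I_n :=
  if x is Some v then [pick u : 'I_n | I u == F (I v)] else None.

Lemma code_le x : code x <= n.
Proof. by case: x => [v|] //=; apply: ltnW; apply: I_lt. Qed.

Lemma code_inj : injective code.
Proof.
move=> [u|] [v|] //= h.
- by congr Some; apply: val_inj; apply: I_inj h; rewrite !inE.
- by have := I_lt (ltn_ord u); rewrite h ltnn.
- by have := I_lt (ltn_ord v); rewrite -h ltnn.
Qed.

Lemma code_onto i : i <= n -> exists x, code x = i.
Proof.
rewrite leq_eqVlt => /orP[/eqP->|iltn]; first by exists None.
pose f (v : 'I_n) := Ordinal (I_lt (ltn_ord v)).
have f_inj : injective f.
  by move=> u v [h]; apply: val_inj; apply: I_inj h; rewrite !inE.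
have /codomP[v vE] := injF_onto f_inj (Ordinal iltn).
by exists (Some v); rewrite /=; have := congr1 val vE.
Qed.

Lemma code_parent (v : 'I_n) : code (tree_parent (Some v)) = F (I v).
Proof.
have [Fn _ _ _] := dd_par D (I_lt (ltn_ord v)).
rewrite /=; case: pickP => [u /eqP //|none] /=.
have [[u|] //= uE] := code_onto Fn.
by have := none u; rewrite uE eqxx.
Qed.

Lemma adj_edge u v :
  adj (relabel I (nat_pairs EL ++ nat_pairs ML)) u v ->
  exists x y : 'I_n, [/\ u = I x, v = I y & [set x; y] \in E :|: U].
Proof.
rewrite /nat_pairs -map_cat /relabel -map_comp.
case/orP=> /mapP[[x y] xyL [-> ->]] /=; [exists x, y | exists y, x]; split=> //;
  rewrite mem_lists_edges; apply/mapP; exists (x, y) => //.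
by rewrite setUC.
Qed.

Lemma add_root_edge (x y : option 'I_n) :
  [set x; y] \in add_root (E :|: U) ->
  x = y \/ extra n (relabel I (nat_pairs EL ++ nat_pairs ML)) (code x) (code y).
Proof.
rewrite inE => /orP[/imsetP[e eE]|/imsetP[v _]].
  rewrite mem_lists_edges in eE; have /mapP[[a b] abL ->] := eE.
  rewrite imsetU !imset_set1 /= => /set2_eq.
  have h : (I a, I b) \in relabel I (nat_pairs EL ++ nat_pairs ML).
    rewrite /nat_pairs -map_cat /relabel -map_comp; apply/mapP; by exists (a, b).
  case=> [->|[-> ->]|[-> ->]]; [by left | right | right]; rewrite /extra /adj /= h ?orbT //.
case/set2_eq => [->|[-> ->]|[-> ->]]; [by left | right | right];
  by rewrite /extra eqxx /= I_lt ?ltn_ord ?orbT.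
Qed.

(** By [dd_max] the parent of a vertex strictly inside the interval of [u] is still in that
    interval, with a smaller entry time; iterating reaches [u]. *)
Lemma iter_parent u v :
  V (code u) <= V (code v) -> V (code v) < fin (code u) -> ancestor tree_parent u v.
Proof.
have [k] := ubnP (V (code v)); elim: k v => // k IH v.
rewrite ltnS => vk; rewrite leq_eqVlt => /orP[/eqP E'|uv] vf.
  exists 0; apply: code_inj; symmetry; exact: (dd_inj D (code_le u) (code_le v)).
case: v vk uv vf => [v|] vk uv vf; last first.
  move: uv; rewrite /= (dd_root D); have [h _ _] := dd_time D (code_le u); lia.
have vn := I_lt (ltn_ord v).
have [p1 p2 p3 p4] := dd_par D vn.
have pE := code_parent v.
have [|||i iE] := IH (tree_parent (Some v)) _ _ _; rewrite ?pE.
- exact: leq_trans p2 vk.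
- exact: (dd_max D (code_le u) vn uv vf).
- exact: ltn_trans p2 vf.
- by exists i.+1; rewrite iterSr.
Qed.

Lemma dfs_tree_parent : dfs_tree (add_root (E :|: U)) None tree_parent.
Proof.
split; first split=> //.
- apply/subsetP => e /imsetP[[v|]]; last by rewrite !inE.
  move=> _ ->; have vn := I_lt (ltn_ord v).
  have [_ _ _] := dd_par D vn.
  rewrite -code_parent; case: (tree_parent (Some v)) => [u|] /=; last first.
    by move=> _; rewrite inE setUC; apply/orP; right; apply/imsetP; exists v.
  case/or3P => [/andP[/eqP E' _]|/andP[/eqP E' _]|/adj_edge[x [y [uE vE xy]]]].
  + by have := I_lt (ltn_ord u); rewrite E' ltnn.
  + by rewrite E' ltnn in vn.
  rewrite inE; apply/orP; left; apply/imsetP; exists [set x; y] => //.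
  have -> : u = x by apply: val_inj; apply: I_inj uE; rewrite inE.
  have -> : v = y by apply: val_inj; apply: I_inj vE; rewrite inE.
  by rewrite imsetU !imset_set1 setUC.
- move=> v; apply: (iter_parent (u := None)); rewrite /= ?(dd_root D).
    by have [] := dd_time D (code_le v).
  have [->|ne] := eqVneq v None; first by rewrite /=; have [] := dd_time D (leqnn n).
  case: v ne => // v _; have vn := I_lt (ltn_ord v).
  (* The root is adjacent to every vertex, so [dd_edge] puts all entry times into its interval. *)
  apply: (dd_edge D (a := n)); first by rewrite /extra eqxx /= vn.
  rewrite (dd_root D); have [h _ _] := dd_time D (ltnW vn).
  rewrite ltn_neqAle h andbT; apply/eqP => h1.
  have := dd_inj D (ltnW vn) (leqnn n); rewrite (dd_root D) -h1 => /(_ erefl) h2.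
  by rewrite h2 ltnn in vn.
- move=> x y /add_root_edge[-> _|Hxy _]; first by left; exists 0.
  case: (ltngtP (V (code x)) (V (code y))) => h.
  + by left; apply: iter_parent; [apply: ltnW | apply: (dd_edge D Hxy)].
  + right; apply: iter_parent; first exact: ltnW.
    by apply: (dd_edge D) => //; rewrite extra_sym.
  + by left; exists 0; apply: code_inj; apply: (dd_inj D) => //; apply: code_le.
Qed.

Lemma parent_words_tree (out : nat -> nat) :
  (forall v, v < n -> (F (I v) = n -> out v = n) /\
     forall u, u < n -> F (I v) = I u -> out v = u) ->
  mkseq out n = parent_words tree_parent.
Proof.
move=> hout; rewrite /mkseq /parent_words -val_enum_ord -map_comp.
apply: eq_map => v; rewrite -[(_ \o _) v]/(out (val v)).
have [h1 h2] := hout v (ltn_ord v); have := code_parent v.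
case: (tree_parent (Some v)) => [u|] /= h; last exact: h1.
by apply: h2; rewrite // ?ltn_ord.
Qed.

End DfsTree.

(** * Preprocessing *)

Lemma nat_inj_onto n (f : nat -> nat) :
  (forall i, i < n -> f i < n) -> {in gtn n &, injective f} ->
  forall i, i < n -> exists2 j, j < n & f j = i.
Proof.
move=> f_lt f_inj i iltn.
pose g (v : 'I_n) := Ordinal (f_lt v (ltn_ord v)).
have g_inj : injective g.
  by move=> u v [h]; apply: val_inj; apply: f_inj h; rewrite !inE.
have /codomP[v vE] := injF_onto g_inj (Ordinal iltn).
by exists (val v); rewrite ?ltn_ord // -[i]/(val (Ordinal iltn)) vE.
Qed.

(** Time 1 belongs to the root alone, so the other entry times start at 2 and the subtraction never
    truncates. *)
Lemma dfs_times n H V F fin (I : nat -> nat) :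
  dfs_done n H V F fin -> (forall v, v < n -> I v = V v - 2) ->
  (forall v, v < n -> V v = I v + 2 /\ I v < n) /\ {in gtn n &, injective I}.
Proof.
move=> D IE.
have VE v : v < n -> V v = I v + 2 /\ I v < n.
  move=> vn; have [h1 h2 h3] := dd_time D (ltnW vn).
  have h4 : V v != 1.
    apply/eqP => h4; have := dd_inj D (ltnW vn) (leqnn n).
    by rewrite (dd_root D) h4 => /(_ erefl) e; rewrite e ltnn in vn.
  by rewrite IE //; split; lia.
split=> // u v; rewrite !inE => un vn e; apply: (dd_inj D (ltnW un) (ltnW vn)).
by have [-> _] := VE u un; have [-> _] := VE v vn; rewrite e.
Qed.

(** Shifted by two, entry times are preorder numbers and exit times the ends of the subtree
    intervals. Dropping the dummy root turns its children into the roots of the forest. *)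
Lemma dfs_forest n E V F fin (I P S : nat -> nat) :
  dfs_done n (extra n E) V F fin -> below n E ->
  (forall v, v < n -> I v = V v - 2) ->
  (forall v, v < n -> P (I v) = if F v == n then n else I (F v)) ->
  (forall v, v < n -> S (I v) = fin v - 2) ->
  forest n (adj (relabel I E)) P S.
Proof.
move=> D bE IE PE SE; have [VE I_inj] := dfs_times D IE.
have V2 v : v < n -> [/\ V v = I v + 2, fin v = S (I v) + 2 & I v < S (I v) <= n].
  move=> vn; have [h1 h2 h3] := dd_time D (ltnW vn); have [h4 h5] := VE v vn.
  by rewrite SE //; split; lia.
have I_lt v : v < n -> I v < n by case/VE.
have onto := nat_inj_onto I_lt I_inj.
have adjE a b : adj (relabel I E) a b -> exists u v, [/\ u < n, v < n, a = I u, b = I v & adj E u v].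
  case/orP=> /mapP[[u v] uvE [-> ->]]; have [un vn] := bE _ uvE.
    by exists u, v; rewrite /adj uvE.
  by exists v, u; rewrite /adj uvE orbT.
have adjI u v : adj E u v -> adj (relabel I E) (I u) (I v).
  by case/orP=> h; apply/orP; [left|right]; apply/mapP; [exists (u, v)|exists (v, u)].
have par v : v < n -> F v != n -> [/\ F v < n, I (F v) < I v, I v < S (I (F v)) & adj E (F v) v].
  move=> vn Fn; have [p1 p2 p3 p4] := dd_par D vn.
  have Fltn : F v < n by rewrite ltn_neqAle Fn.
  have [h1 h2 h3] := V2 v vn; have [k1 k2 k3] := V2 _ Fltn.
  split=> //; try lia.
  case/or3P: p4 => // /andP[/eqP e]; last by rewrite e ltnn in vn.
  by rewrite e eqxx in Fn.
split.
- by move=> i /onto[v vn <-]; have [] := V2 v vn.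
- move=> i j ij jS iltn; have [v vn vE] := onto i iltn; have [h1 h2 h3] := V2 v vn.
  have jn : j < n by rewrite vE in h3; lia.
  have [u un uE] := onto j jn; have [k1 k2 k3] := V2 u un.
  move: ij jS; rewrite -vE -uE => ij jS.
  by have := dd_lam D (ltnW vn) (ltnW un); lia.
- move=> i /onto[v vn <-]; rewrite PE //; case: eqP => [_|/eqP Fn _]; first by rewrite ltnn.
  have [h1 h2 h3 h4] := par v vn Fn; split=> //.
  by apply: adjI; rewrite adj_sym.
- move=> i j ji iS /onto[v vn vE]; rewrite -vE PE // in ji iS *.
  have jn : j < n by have := I_lt v vn; lia.
  have [u un uE] := onto j jn; rewrite -uE in ji iS *.
  have [h1 h2 h3] := V2 v vn; have [k1 k2 k3] := V2 u un.
  have m : V u <= V (F v) by apply: (dd_max D (ltnW un) vn); lia.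
  have Fn : F v != n by apply: contraTneq m => ->; rewrite (dd_root D); lia.
  have [Fltn _ _ _] := par v vn Fn; have [l1 _ _] := V2 _ Fltn.
  rewrite (negbTE Fn); split; first exact: I_lt.
  by lia.
- move=> i /onto[v vn <-]; rewrite PE //; case: eqP => // /eqP Fn.
  by have [h1 _ _ _] := par v vn Fn; apply: ltnW; apply: I_lt.
- move=> a b /adjE[u [v [un vn -> -> uv]]] lt.
  have [h1 h2 h3] := V2 v vn; have [k1 k2 k3] := V2 u un.
  have := dd_edge D (a := u) (b := v); rewrite /extra uv !orbT => /(_ isT); lia.
- exact: adj_sym.
- by move=> a b /adjE[u [v [un vn -> _ _]]]; apply: I_lt.
Qed.

(** * Adjacency lists read off the adjacency matrix *)

Section Codes.
Variables (n : nat) (G : rel nat).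

Definition edge_code (c : nat) : bool := G (c %/ n) (c %% n).

(** Reading the matrix row by row, the rank of an entry is its position in the concatenated
    adjacency lists; the rows of a subtree therefore fill one contiguous range. *)
Definition edge_rank (i : nat) : nat := count edge_code (iota 0 i).

Lemma edge_rankS i : edge_rank i.+1 = edge_rank i + edge_code i.
Proof. by rewrite /edge_rank -addn1 iotaD count_cat /= add0n addn0. Qed.

Lemma edge_rank_mono i j : i <= j -> edge_rank i <= edge_rank j.
Proof.
move=> ij; rewrite -(subnKC ij); elim: (j - i) => [|k IH]; first by rewrite addn0.
by rewrite addnS edge_rankS; lia.
Qed.

(** A discrete intermediate value argument: the rank grows by at most one per step. *)
Lemma edge_rank_onto l r p : edge_rank l <= p -> p < edge_rank r ->
  exists c, [/\ l <= c < r, edge_code c & edge_rank c = p].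
Proof.
elim: r => [|r IH] lp pr; first by have := edge_rank_mono (leq0n l); lia.
have [pr'|rp] := ltnP p (edge_rank r).
  by have [c [h1 h2 h3]] := IH lp pr'; exists c; split=> //; lia.
rewrite edge_rankS in pr; exists r; split.
- rewrite ltnSn andbT; have [//|rl] := leqP l r.
  by have := edge_rank_mono rl; rewrite edge_rankS; lia.
- by case: (edge_code r) pr => //; lia.
- by case: (edge_code r) pr => //; lia.
Qed.

Variables (S A base : nat -> nat).
Hypothesis base_code : forall c, c < n * n -> edge_code c -> base (edge_rank c) = c %% n * n + c %/ n.

Lemma edge_codes :
  (forall z, z < n -> z < S z <= n) ->
  (forall x y, G x y -> x < n /\ y < n) ->
  (forall a, a <= n -> A a = edge_rank (a * n)) ->
  adjacency_codes n (edge_rank (n * n)) G S A base.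
Proof.
move=> hS G_dom AE; split.
- move=> z zn; have /andP[h1 h2] := hS z zn; rewrite !AE //; last exact: ltnW.
  by rewrite !edge_rank_mono // leq_mul2r ?h2 ?(ltnW h1) orbT.
- move=> z x y zn /andP[zx xS] Gxy; have [xn yn] := G_dom _ _ Gxy.
  have n0 : 0 < n by apply: leq_trans yn.
  have /andP[h1 h2] := hS z zn.
  have dE : (x * n + y) %/ n = x by rewrite divnMDl // divn_small // addn0.
  have mE : (x * n + y) %% n = y by rewrite modnMDl modn_small.
  have cP : edge_code (x * n + y) by rewrite /edge_code dE mE.
  have lt : x * n + y < S z * n.
    apply: (@leq_trans (x.+1 * n)); first by rewrite mulSnr ltn_add2l.
    by rewrite leq_mul2r xS orbT.
  have lt2 : S z * n <= n * n by rewrite leq_mul2r h2 orbT.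
  exists (edge_rank (x * n + y)); last first.
    by rewrite base_code // ?dE ?mE //; apply: leq_trans lt lt2.
  rewrite !AE //; last exact: ltnW.
  apply/andP; split; first by apply: edge_rank_mono; apply: leq_trans (leq_addr _ _); rewrite leq_mul2r zx orbT.
  by have := edge_rank_mono lt; rewrite edge_rankS cP addn1.
- move=> z p zn; have /andP[h1 h2] := hS z zn; rewrite !AE //; last exact: ltnW.
  case/andP=> p1 p2; have [c [/andP[c1 c2] cP cE]] := edge_rank_onto p1 p2.
  have n0 : 0 < n by lia.
  have cn : c < n * n by apply: leq_trans c2 _; rewrite leq_mul2r h2 orbT.
  exists (c %/ n), (c %% n); split=> //.
    by rewrite leq_divRL // c1 ltn_divLR.
  by rewrite -cE base_code.
Qed.

(** Codes are transposed matrix positions, hence distinct. This is what allows sorting by counting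
    smaller elements without breaking ties. *)
Lemma base_inj p q : p < edge_rank (n * n) -> q < edge_rank (n * n) -> base p = base q -> p = q.
Proof.
move=> pN qN; have [|c [/andP[_ c2] cP <-]] := @edge_rank_onto 0 (n * n) p _ pN; first by rewrite /edge_rank.
have [|d [/andP[_ d2] dP <-]] := @edge_rank_onto 0 (n * n) q _ qN; first by rewrite /edge_rank.
rewrite !base_code // => e.
have n0 : 0 < n by case: (n) c2.
have cq : c %/ n < n by rewrite ltn_divLR.
have dq : d %/ n < n by rewrite ltn_divLR.
have e1 : c %% n = d %% n.
  have := congr1 (fun x => x %/ n) e; rewrite !divnMDl // [c %/ n %/ n]divn_small // [d %/ n %/ n]divn_small //.
  by rewrite !addn0.
have e2 : c %/ n = d %/ n by move: e; rewrite e1 => /addnI.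
by rewrite (divn_eq c n) (divn_eq d n) e1 e2.
Qed.

End Codes.

Lemma edge_rank_le n E : below n E -> edge_rank n (adj E) (n * n) <= 2 * size E.
Proof.
move=> bE; rewrite /edge_rank -size_filter.
pose K := [seq p.1 * n + p.2 | p <- E] ++ [seq p.2 * n + p.1 | p <- E].
have -> : 2 * size E = size K by rewrite size_cat !size_map mul2n addnn.
apply: uniq_leq_size; first by rewrite filter_uniq // iota_uniq.
move=> c; rewrite mem_filter mem_iota add0n leq0n /= => /andP[cP cn].
rewrite mem_cat; case/orP: cP => h; apply/orP; [left | right]; apply/mapP.
  by exists (c %/ n, c %% n) => //=; rewrite -divn_eq.
by exists (c %% n, c %/ n) => //=; rewrite -divn_eq.
Qed.

(** * Sorting aligned blocks by counting *)

Section BlockSort.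
Variables (N sz : nat) (base : nat -> nat).
Hypothesis sz_gt0 : 0 < sz.
Hypothesis base_inj : forall p q, p < N -> q < N -> base p = base q -> p = q.

Definition block_start (p : nat) : nat := p %/ sz * sz.

Definition block_rank (p : nat) : nat :=
  \sum_(o < sz) (base (block_start p + o) < base p).

Definition sorted_pos (p : nat) : nat := block_start p + block_rank p.

Lemma block_start_le p : block_start p <= p < block_start p + sz.
Proof. by rewrite /block_start leq_divM /= addnC -mulSn ltn_ceil. Qed.

Lemma block_start_off b o : o < sz -> block_start (b * sz + o) = b * sz.
Proof. by move=> osz; rewrite /block_start divnMDl // divn_small // addn0. Qed.

Lemma sum_succ (f g : nat -> bool) (o0 : nat) : o0 < sz -> ~~ f o0 -> g o0 ->
  (forall o, o < sz -> f o -> g o) -> \sum_(o < sz) f o < \sum_(o < sz) g o.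
Proof.
move=> o0sz fo go fg.
rewrite (bigD1 (Ordinal o0sz)) //= [X in _ < X](bigD1 (Ordinal o0sz)) //= (negbTE fo) go add0n.
rewrite ltnS; apply: leq_sum => i _.
by have := fg i (ltn_ord i); case: (f i) => // ->.
Qed.

Lemma block_rank_lt p : block_rank p < sz.
Proof.
have /andP[h1 h2] := block_start_le p.
have o0 : p - block_start p < sz by lia.
have := @sum_succ (fun o => base (block_start p + o) < base p) (fun=> true) _ o0.
rewrite sum1_card card_ord; apply=> //.
by rewrite subnKC // ltnn.
Qed.

Lemma block_rank_mono p q : block_start p = block_start q -> base p < base q ->
  block_rank p < block_rank q.
Proof.
move=> E pq; have /andP[h1 h2] := block_start_le p.
have o0 : p - block_start p < sz by lia.
rewrite /block_rank -E.
apply: (@sum_succ (fun o => base (block_start p + o) < base p)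
  (fun o => base (block_start p + o) < base q) _ o0).
- by rewrite subnKC // ltnn.
- by rewrite subnKC.
- by move=> o _ h; apply: ltn_trans h pq.
Qed.

Lemma sorted_pos_block p : block_start (sorted_pos p) = block_start p.
Proof. by rewrite /sorted_pos {1}/block_start -/(block_start _) block_start_off // block_rank_lt. Qed.

Lemma sorted_pos_inj p q : block_start p + sz <= N -> block_start q + sz <= N ->
  sorted_pos p = sorted_pos q -> p = q.
Proof.
move=> pN qN e; have E : block_start p = block_start q by rewrite -sorted_pos_block e sorted_pos_block.
have /andP[_ h1] := block_start_le p; have /andP[_ h2] := block_start_le q.
move: e; rewrite /sorted_pos E => /addnI e.
case: (ltngtP (base p) (base q)) => h.
- by have := block_rank_mono E h; rewrite e ltnn.
- by have := block_rank_mono (esym E) h; rewrite e ltnn.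
- by apply: base_inj h; lia.
Qed.

(** Here [q] may come from the incomplete last block, whose counts also read beyond [N]: equal
    positions would mean equal blocks, and the block of [p] is complete. So writing [q] never
    destroys a complete block. *)
Lemma sorted_pos_neq p q : q < N -> block_start p + sz <= N -> p != q ->
  sorted_pos p != sorted_pos q.
Proof.
move=> qN pN; apply: contra_neq => e.
apply: (sorted_pos_inj pN _ e).
by rewrite -sorted_pos_block -e sorted_pos_block.
Qed.

(** In a complete block the ranks are distinct and less than [sz], so by the pigeonhole principle
    they permute the offsets. *)
Lemma sorted_block (t : nat -> nat) b :
  (forall p, p < N -> block_start p + sz <= N -> t (sorted_pos p) = base p) ->
  b.+1 * sz <= N -> let block i := b * sz <= i < b.+1 * sz in
  [/\ forall i i', block i -> block i' -> i <= i' -> t i <= t i',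
      forall i, block i -> exists2 p, block p & t i = base p
    & forall p, block p -> exists2 i, block i & t i = base p].
Proof.
move=> tE bN block.
have bE p : block p -> block_start p = b * sz.
  rewrite /block mulSn => /andP[h1 h2].
  by rewrite -(subnKC h1) block_start_off //; lia.
have E : b.+1 * sz = b * sz + sz by rewrite mulSn addnC.
have blk p : block p -> block (sorted_pos p).
  move=> h; rewrite /block /sorted_pos (bE p h) E leq_addr ltn_add2l; exact: block_rank_lt.
have tE' p : block p -> t (sorted_pos p) = base p.
  move=> h; apply: tE; rewrite ?(bE p h) -?E //.
  by case/andP: h => _ h; apply: leq_trans h bN.
have onto i : block i -> exists2 p, block p & sorted_pos p = i.
  rewrite /block E => /andP[h1 h2].
  have [|||o osz oE] := @nat_inj_onto sz (fun o => block_rank (b * sz + o)) _ _ (i - b * sz).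
  - by move=> o _; apply: block_rank_lt.
  - move=> o o'; rewrite !inE => h h' e; apply: (@addnI (b * sz)); apply: sorted_pos_inj.
    + by rewrite block_start_off // -E.
    + by rewrite block_start_off // -E.
    + by rewrite /sorted_pos !block_start_off // e.
  - lia.
  exists (b * sz + o); first by lia.
  by rewrite /sorted_pos block_start_off // oE; lia.
split.
- move=> i i' /onto[p pb <-] /onto[q qb <-] le; rewrite !tE' //.
  rewrite leqNgt; apply/negP => lt.
  have := block_rank_mono _ lt; rewrite (bE p pb) (bE q qb) => /(_ erefl).
  by move: le; rewrite /sorted_pos (bE p pb) (bE q qb); lia.
- by move=> i /onto[p pb <-]; exists p; rewrite ?tE'.
- by move=> p pb; exists (sorted_pos p); [apply: blk | apply: tE'].
Qed.

End BlockSort.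

(** * Termination without a time bound *)

Section Halting.
Variable w : nat.

Definition halts (c : cmd) (s : state) (Q : state -> Prop) : Prop :=
  exists t s', exec w c s t s' /\ Q s'.

Lemma halts_runs c s B (Q : state -> Prop) : runs w c s B Q -> halts c s Q.
Proof. by move=> [t [s' [h1 _ h2]]]; exists t, s'. Qed.

Lemma halts_conseq c s (Q Q' : state -> Prop) :
  halts c s Q -> (forall s', Q s' -> frame c s s' -> Q' s') -> halts c s Q'.
Proof.
by move=> [t [s' [h1 h2]]] h; exists t, s'; split=> //; apply: h => //; apply: exec_frame h1.
Qed.

Lemma halts_skip s (Q : state -> Prop) : Q s -> halts Skip s Q.
Proof. by move=> h; exists 1, s; split=> //; constructor. Qed.

Lemma halts_reg v x e s (Q : state -> Prop) :
  eval w s e = v -> Q (set_reg s x v) -> halts (SetReg x e) s Q.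
Proof.
by move=> <- hQ; exists (cost e).+1, (set_reg s x (eval w s e)); split=> //; constructor.
Qed.

Lemma halts_cell i v a e1 e2 s (Q : state -> Prop) :
  eval w s e1 = i -> eval w s e2 = v -> Q (set_cell s a i v) -> halts (SetCell a e1 e2) s Q.
Proof.
move=> <- <- hQ; exists (cost e1 + cost e2).+1, (set_cell s a (eval w s e1) (eval w s e2)).
by split=> //; constructor.
Qed.

Lemma halts_seq c1 c2 s (Q : state -> Prop) :
  halts c1 s (fun s1 => halts c2 s1 Q) -> halts (Seq c1 c2) s Q.
Proof.
move=> [t1 [s1 [h1 [t2 [s2 [h2 h3]]]]]]; exists (t1 + t2), s2; split=> //.
exact: exec_seq h1 h2.
Qed.

Lemma halts_if (b : bool) e c1 c2 s (Q : state -> Prop) :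
  eval w s e = b -> (b -> halts c1 s Q) -> (~~ b -> halts c2 s Q) ->
  halts (If e c1 c2) s Q.
Proof.
case: b => hb h1 h2.
  case: (h1 isT) => t [s' [k1 k2]]; exists (cost e + t).+1, s'; split=> //.
  by apply: exec_if_true k1; rewrite hb.
case: (h2 isT) => t [s' [k1 k2]]; exists (cost e + t).+1, s'; split=> //.
by apply: exec_if_false k1; rewrite hb.
Qed.

Lemma halts_while (I : nat -> state -> Prop) k0 e c s0 (Q : state -> Prop) :
  I k0 s0 ->
  (forall k s, I k s -> frame c s0 s -> exists b : bool,
     [/\ eval w s e = b, b -> halts c s (fun s' => exists2 k', k' < k & I k' s')
       & ~~ b -> Q s]) ->
  halts (While e c) s0 Q.
Proof.
move=> hI0 step.
suff gen k s : I k s -> frame c s0 s -> halts (While e c) s Q by exact: gen hI0 _.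
elim/ltn_ind: k s => k IH s hI hf.
have [b [hb h1 h2]] := step _ _ hI hf.
case: b hb h1 h2 => hb h1 h2; last first.
  exists (cost e).+1, s; split; last exact: h2.
  by apply: exec_while_false; rewrite hb.
case: (h1 isT) => t [s' [k1 [k' kk hI']]].
have [t' [s'' [l1 l2]]] := IH _ kk s' hI' (frame_trans hf (exec_frame k1)).
exists (cost e + t + t').+1, s''; split=> //.
by apply: exec_while_true k1 l1; rewrite hb.
Qed.

Lemma halts_for (I : nat -> state -> Prop) (x N : nat) e c s0 :
  1 < w -> N < 2 ^ w ->
  I 0 (set_reg s0 x 0) ->
  (forall i s, i <= N -> I i s -> reg s x = i -> frame (For x e c) s0 s ->
     eval w s e = N) ->
  (forall i s, i < N -> I i s -> reg s x = i -> frame (For x e c) s0 s ->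
     halts c s (fun s' => reg s' x = i /\ I i.+1 (set_reg s' x i.+1))) ->
  halts (For x e c) s0 (fun s' => I N s' /\ reg s' x = N).
Proof.
move=> w1 hN I0 hE step.
have W2 : 2 ^ 2 <= 2 ^ w by rewrite leq_exp2l.
apply: halts_seq; apply: (@halts_reg 0) => /=; first by rewrite /wrap mod0n.
apply: (@halts_while (fun k s => exists i, [/\ i <= N, I i s, reg s x = i,
  frame (For x e c) s0 s & k = N - i]) (N - 0)).
  exists 0; split=> //=; first by rewrite eqxx.
  by split=> // y /=; rewrite inE => /norP[/negbTE-> _].
move=> k s [i [iN Ii xi hf ->]] _; exists (i < N); split=> /=.
- by rewrite xi (hE i) //= /binop_eval /wrap modn_small //; lia.
- move=> iltN; apply: halts_seq.
  have [t [s' [k1 [k3 k4]]]] := step i s iltN Ii xi hf.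
  exists t, s'; split=> //.
  apply: (@halts_reg i.+1) => /=.
    by rewrite k3 /binop_eval /wrap !modn_small; lia.
  exists (N - i.+1); first lia.
  exists i.+1; split=> //=; first by rewrite eqxx.
  apply: frame_trans hf _; split=> y /=; rewrite ?cats1 ?cat_cons ?inE.
    rewrite mem_rcons inE => /norP[/negbTE yx yc].
    move: yc; rewrite yx /= => yc; exact: (exec_frame k1).1.
  by rewrite cats0 => yc; apply: (exec_frame k1).2.
- by move=> iN'; have -> : N = i by lia.
Qed.

End Halting.

Ltac hreg v := apply: (@halts_reg _ v); [try ev | rewrite /=].
Ltac hsreg v := apply: halts_seq; hreg v.
Ltac hcell i v := apply: (@halts_cell _ i v); [try ev | try ev | rewrite /=].
Ltac hscell i v := apply: halts_seq; hcell i v.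

Lemma wrap_sub w a b : b <= a -> a < 2 ^ w -> wrap w (a + (2 ^ w - b)) = a - b.
Proof.
move=> ba aw; have -> : a + (2 ^ w - b) = 2 ^ w + (a - b) by lia.
by rewrite /wrap modnDl modn_small //; lia.
Qed.

(** * The preprocessing program *)

Notation a_adj := 13 (only parsing).
Notation a_base := 14 (only parsing).

(* [V n] is set to [n + 2] so that the code of the root is [n], like those of
   the other vertices [v] being [V v - 2]. *)
Definition write_forest : cmd :=
  SetCell a_V (Reg r_n) (Reg r_n +! Lit 2) ;;
  SetCell 0 (Lit 1) (Reg 1) ;;
  For r_i (Reg r_n) (
    r_a <- Cell a_V (Reg r_i) -! Lit 2 ;;
    SetCell 0 (Lit 2 +! Reg r_i) (Reg r_a) ;;
    SetCell 0 (Lit 2 +! Reg r_n +! Reg r_a) (Cell a_V (Cell a_F (Reg r_i)) -! Lit 2) ;;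
    SetCell 0 (Lit 2 +! Lit 2 *! Reg r_n +! Reg r_a) (Cell a_fin (Reg r_i) -! Lit 2)).

Definition write_matrix : cmd :=
  For r_i (Reg 1 /! Lit 2) (
    r_a <- Cell a_V (Cell 1 (Reg r_i *! Lit 2)) -! Lit 2 ;;
    r_b <- Cell a_V (Cell 1 (Reg r_i *! Lit 2 +! Lit 1)) -! Lit 2 ;;
    SetCell a_adj (Reg r_a *! Reg r_n +! Reg r_b) (Lit 1) ;;
    SetCell a_adj (Reg r_b *! Reg r_n +! Reg r_a) (Lit 1)).

(** [r_p] is the rank of the current matrix entry; its value at the start of row [a] is the offset
    of the adjacency list of [a]. *)
Definition write_codes : cmd :=
  r_p <- Lit 0 ;;
  For r_i (Reg r_n *! Reg r_n) (
    r_a <- Reg r_i /! Reg r_n ;;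
    r_b <- Reg r_i %! Reg r_n ;;
    If (Reg r_b =! Lit 0)
      (SetCell 0 (Lit 2 +! Lit 3 *! Reg r_n +! Reg r_a) (Reg r_p)) Skip ;;
    If (Lit 0 <! Cell a_adj (Reg r_i))
      (SetCell a_base (Reg r_p) (Reg r_b *! Reg r_n +! Reg r_a) ;;
       r_p <- Reg r_p +! Lit 1) Skip) ;;
  SetCell 0 (Lit 2 +! Lit 3 *! Reg r_n +! Reg r_n) (Reg r_p) ;;
  r_N <- Reg r_p.

(* [r_lo] is the start of the block of position [r_z], and [r_v] the rank of its
   value in the block. *)
Definition write_level : cmd :=
  For r_z (Reg r_N) (
    r_lo <- (Reg r_z /! Reg r_sz) *! Reg r_sz ;;
    r_v <- Lit 0 ;;
    For r_q (Reg r_sz)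
      (r_v <- Reg r_v +! (Cell a_base (Reg r_lo +! Reg r_q) <! Cell a_base (Reg r_z))) ;;
    SetCell 0 (Reg r_lb +! (Reg r_lo +! Reg r_v)) (Cell a_base (Reg r_z))).

(** Blocks longer than [N] are never complete, so writing stops at the first length above [N]. The
    end of the last level written is the output length. *)
Definition write_levels : cmd :=
  r_sz <- Lit 1 ;;
  r_lb <- Lit 4 *! Reg r_n +! Lit 3 ;;
  While (Reg r_sz <! Reg r_N +! Lit 1) (
    write_level ;;
    r_sz <- Reg r_sz *! Lit 2 ;;
    r_lb <- Reg r_lb +! Reg r_N) ;;
  0 <- Reg r_lb.

Definition build_dense : cmd :=
  init_trivial ;; search_all ;;
  write_forest ;; write_matrix ;; write_codes ;; write_levels.

Definition build_sparse : cmd :=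
  For r_i (Reg 1) (SetCell 0 (Reg r_i +! Lit 2) (Cell 1 (Reg r_i))) ;;
  SetCell 0 (Lit 1) (Reg 1) ;;
  0 <- Reg 1 +! Lit 2.

Definition build : cmd :=
  r_n <- Cell 0 (Lit 0) ;;
  If (Lit 2 *! Reg r_n <! Reg 1) build_dense build_sparse.

Section Build.
Variables (w n : nat) (E : seq (nat * nat)).
Hypothesis bE : below n E.
Hypothesis E_le : 2 * size E <= n * n.
Hypothesis w_gt1 : 1 < w.
Hypothesis w_big : levels_nb n * (n * n) + 4 * (n * n) + 100 * n + 100 < 2 ^ w.

Lemma write_forest_spec s (I : nat -> nat) :
  reg s r_n = n ->
  (forall v, v < n -> arr s a_V v = I v + 2 /\ I v < n) -> {in gtn n &, injective I} ->
  (forall v, v < n -> [/\ arr s a_F v <= n, 2 <= arr s a_fin v & arr s a_fin v <= n.+2]) ->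
  halts w write_forest s (fun s' =>
    [/\ arr s' 0 0 = arr s 0 0, arr s' 0 1 = reg s 1,
       forall v, v < n -> arr s' a_V v = I v + 2 &
      forall v, v < n -> [/\ arr s' 0 (2 + v) = I v,
        arr s' 0 (2 + n + I v) = (if arr s a_F v == n then n else I (arr s a_F v)) &
        arr s' 0 (2 + 2 * n + I v) = arr s a_fin v - 2]]).
Proof.
move=> nE VE Iinj Ffin.
hscell n (n + 2); hscell 1 (reg s 1).
set s1 := set_cell _ _ _ _.
have VE1 v : v <= n -> arr s1 a_V v = (if v == n then n else I v) + 2.
  move=> vn; rewrite /s1 /=; case: eqP => // /eqP ne.
  by have [] := VE v; rewrite // ltn_neqAle ne.
apply: (halts_conseq (halts_for (I := fun i s' =>
    [/\ arr s' 0 0 = arr s 0 0, arr s' 0 1 = reg s 1 &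
     forall v, v < i -> [/\ arr s' 0 (2 + v) = I v,
        arr s' 0 (2 + n + I v) = (if arr s a_F v == n then n else I (arr s a_F v)) &
        arr s' 0 (2 + 2 * n + I v) = arr s a_fin v - 2]]) (N := n) w_gt1 _ _ _ _)) => //.
- lia.
- by move=> i s2 _ _ _ [fr _]; rewrite /= fr.
- move=> i s2 iltn [D0 D1 hD] xi [fr fa].
  have n2 : reg s2 r_n = n by rewrite fr.
  have V2 v : v <= n -> arr s2 a_V v = (if v == n then n else I v) + 2 by rewrite fa //; apply: VE1.
  have [F2 f2] : arr s2 a_F = arr s a_F /\ arr s2 a_fin = arr s a_fin by rewrite !fa.
  have [Fn fin1 fin2] := Ffin i iltn; have [_ Iin] := VE i iltn.
  have Vi : arr s2 a_V i = I i + 2 by rewrite V2 ?(ltnW iltn) // ltn_eqF.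
  have VF : (if arr s a_F i == n then n else I (arr s a_F i)) <= n.
    case: eqP => // /eqP ne; apply: ltnW.
    by have [|_] := VE (arr s a_F i); rewrite ?ltn_neqAle ?ne.
  apply: halts_seq; apply: (@halts_reg _ (I i)).
    by rewrite /= /binop_eval xi Vi (wrapE (v := 2)) ?wrap_sub ?addnK //; lia.
  hscell (2 + i) (I i).
  apply: halts_seq; apply: (@halts_cell _ (2 + n + I i) (if arr s a_F i == n then n else I (arr s a_F i))).
  + by rewrite /= /binop_eval n2 !wrapE; lia.
  + by rewrite /= /binop_eval xi F2 V2 // (wrapE (v := 2)) ?wrap_sub ?addnK //; lia.
  apply: (@halts_cell _ (2 + 2 * n + I i) (arr s a_fin i - 2)).
  + by rewrite /= /binop_eval n2 !wrapE; lia.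
  + by rewrite /= /binop_eval xi f2 (wrapE (v := 2)) ?wrap_sub //; lia.
  rewrite /=; split=> //; split=> //.
  move=> v; rewrite ltnS leq_eqVlt => /orP[/eqP->|vi].
    by split; do ?[case: eqP => //]; lia.
  have [h1 h2 h3] := hD v vi.
  have vn : v < n by lia.
  have [_ Ivn] := VE v vn.
  have ne : I v != I i.
    by apply: contraTneq vi => e; rewrite (Iinj v i) ?inE // ltnn.
  by split; do ?[case: eqP => [?|_] //]; lia.
move=> s2 [[D0 D1 hD] _] [fr fa]; split=> //.
by move=> v vn; rewrite fa // VE1 ?ltn_eqF // ltnW.
Qed.

Lemma write_matrix_spec s (I : nat -> nat) :
  reg s r_n = n -> reg s 1 = 2 * size E -> stores s 1 0 E ->
  (forall v, v < n -> arr s a_V v = I v + 2 /\ I v < n) ->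
  (forall c, arr s a_adj c = 0) ->
  halts w write_matrix s (fun s' => forall c, c < n * n ->
    arr s' a_adj c = edge_code n (adj (relabel I E)) c).
Proof.
move=> nE lenE stE VE adj0.
apply: (halts_conseq (halts_for (I := fun i s' => forall c, c < n * n ->
    arr s' a_adj c = edge_code n (adj (relabel I (take i E))) c) (N := size E) w_gt1 _ _ _ _)) => //.
- lia.
- by move=> c _; rewrite take0 /= adj0.
- by move=> i s1 _ _ _ [fr _]; rewrite /= fr // lenE /binop_eval !wrapE; lia.
- move=> i s1 iltE hc xi [fr fa].
  have [e1 e2] := stE i iltE; rewrite addn0 in e1.
  have pE : nth (0, 0) E i \in E by apply: mem_nth.
  case p_E : (nth (0, 0) E i) pE e1 e2 => [u v] uvE /= e1 e2.
  have [un vn] := bE uvE; rewrite /= in un vn.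
  have [Vu Iu] := VE u un; have [Vv Iv] := VE v vn.
  have [a1 V1] : arr s1 1 = arr s 1 /\ arr s1 a_V = arr s a_V by rewrite !fa.
  have n1 : reg s1 r_n = n by rewrite fr.
  have ab x y : x < n -> y < n -> x * n + y < n * n.
    move=> xn yn; apply: (@leq_trans (x.+1 * n)); first by rewrite mulSnr ltn_add2l.
    by rewrite leq_mul2r xn orbT.
  have uvn := ab _ _ Iu Iv; have vun := ab _ _ Iv Iu.
  apply: halts_seq; apply: (@halts_reg _ (I u)).
    by rewrite /= /binop_eval xi (wrapE (v := 2)) ?(wrapE (v := i * 2)) ?a1 ?e1 ?V1 ?Vu ?wrap_sub ?addnK //; lia.
  apply: halts_seq; apply: (@halts_reg _ (I v)).
    by rewrite /= /binop_eval xi (wrapE (v := 2)) ?(wrapE (v := i * 2)) ?(wrapE (v := 1)) ?(wrapE (v := i * 2 + 1)) ?a1 ?e2 ?V1 ?Vv ?wrap_sub ?addnK //; lia.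
  apply: halts_seq; apply: (@halts_cell _ (I u * n + I v) 1).
  + by rewrite /= /binop_eval n1 !wrapE; lia.
  + by rewrite /= wrapE; lia.
  apply: (@halts_cell _ (I v * n + I u) 1).
  + by rewrite /= /binop_eval n1 !wrapE; lia.
  + by rewrite /= wrapE; lia.
  split=> // c cn; rewrite /= hc //.
  have n0 : 0 < n by case: (n) cn.
  rewrite /edge_code (take_nth (0, 0) iltE) /relabel map_rcons p_E /=.
  rewrite /adj !mem_rcons !inE !xpair_eqE.
  have cE x y : x < n -> y < n -> (c == x * n + y) = (c %/ n == x) && (c %% n == y).
    move=> xn yn; apply/eqP/andP => [->|[/eqP <- /eqP <-]]; last exact: divn_eq.
    by rewrite divnMDl // divn_small // addn0 modnMDl modn_small.
  rewrite !cE //.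
  rewrite [(c %% n == I u) && _]andbC.
  move: ((_, _) \in _) ((_, _) \in _) => b1 b2.
  by case: (_ && _); case: (_ && _); case: b1; case: b2.
- by move=> s1 [h _] _; rewrite take_size in h.
Qed.

Lemma edge_rank_sq G : edge_rank n G (n * n) <= n * n.
Proof. by rewrite /edge_rank; apply: leq_trans (count_size _ _) _; rewrite size_iota. Qed.

Lemma write_codes_spec s (G : rel nat) :
  reg s r_n = n -> (forall c, c < n * n -> arr s a_adj c = edge_code n G c) ->
  halts w write_codes s (fun s' =>
    [/\ reg s' r_N = edge_rank n G (n * n),
       forall c, c < n * n -> edge_code n G c ->
         arr s' a_base (edge_rank n G c) = c %% n * n + c %/ n,
       forall a, a <= n -> arr s' 0 (2 + 3 * n + a) = edge_rank n G (a * n) &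
       forall i, i < 2 + 3 * n -> arr s' 0 i = arr s 0 i]).
Proof.
move=> nE adjE; have Nle := edge_rank_sq G.
hsreg 0.
apply: halts_seq; apply: (halts_conseq (halts_for (I := fun i s' =>
    [/\ reg s' r_p = edge_rank n G i,
       forall c, c < i -> edge_code n G c ->
         arr s' a_base (edge_rank n G c) = c %% n * n + c %/ n,
       forall a, a * n < i -> arr s' 0 (2 + 3 * n + a) = edge_rank n G (a * n) &
       forall i, i < 2 + 3 * n -> arr s' 0 i = arr s 0 i]) (N := n * n) w_gt1 _ _ _ _)).
- lia.
- by split.
- by move=> i s1 _ _ _ [fr _]; rewrite /= fr //= nE /binop_eval wrapE; lia.
- move=> i s1 iltn [pE hb hA hD] xi [fr fa].
  have n1 : reg s1 r_n = n by rewrite fr.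
  have n0 : 0 < n by case: (n) iltn.
  have qn : i %/ n < n by rewrite ltn_divLR.
  have rn : i %% n < n by rewrite ltn_mod.
  have pos_le := edge_rank_mono n G (ltnW iltn).
  have code_lt : i %% n * n + i %/ n < n * n.
    apply: (@leq_trans ((i %% n).+1 * n)); first by rewrite mulSnr ltn_add2l.
    by rewrite leq_mul2r rn orbT.
  hsreg (i %/ n); first by rewrite /= /binop_eval xi n1 wrapE //; lia.
  hsreg (i %% n); first by rewrite /= /binop_eval xi n1 wrapE //; lia.
  apply: halts_seq; apply: (@halts_conseq _ _ _ (fun s' =>
     (forall a, a * n < i.+1 -> arr s' 0 (2 + 3 * n + a) = edge_rank n G (a * n)) /\
     (forall i, i < 2 + 3 * n -> arr s' 0 i = arr s 0 i))).
    apply: (@halts_if _ (i %% n == 0)).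
    + by rewrite /= /binop_eval (wrapE (v := 0)) ?wrapE //; lia.
    + move=> /eqP r0; apply: (@halts_cell _ (2 + 3 * n + i %/ n) (edge_rank n G i)).
      - by rewrite /= /binop_eval n1 !wrapE; lia.
      - by rewrite /= pE.
      split=> [a|j jn] /=; last by rewrite (ltn_eqF (leq_trans jn (leq_addr _ _))) hD.
      have iE : i = i %/ n * n by rewrite {1}(divn_eq i n) r0 addn0.
      rewrite eqn_add2l; case: eqP => [->|ne] ai; first by rewrite -iE.
      apply: hA; move: ai; rewrite ltnS leq_eqVlt => /orP[/eqP e|//].
      by case: ne; rewrite -e mulnK.
    + move=> r0; apply: halts_skip; split=> // a; rewrite ltnS leq_eqVlt => /orP[/eqP e|//].
        by move: r0; rewrite -e modnMl.
      exact: hA.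
  move=> s2 [hA2 hD2] [fr2 fa2].
  have n2 : reg s2 r_n = n by rewrite fr2.
  have p2 : reg s2 r_p = edge_rank n G i by rewrite fr2.
  have [ra rb] : reg s2 r_a = i %/ n /\ reg s2 r_b = i %% n by rewrite !fr2.
  have i2 : reg s2 r_i = i by rewrite fr2.
  have b2 : arr s2 a_base = arr s1 a_base by rewrite fa2.
  apply: (@halts_if _ (edge_code n G i)).
  + rewrite /= i2 fa2 //= fa //= adjE // /binop_eval.
    by case: (edge_code n G i); rewrite !wrapE; lia.
  + move=> ci; apply: halts_seq.
    apply: (@halts_cell _ (edge_rank n G i) (i %% n * n + i %/ n)).
    - by rewrite /= p2.
    - by rewrite /= /binop_eval n2 ra rb !wrapE; lia.
    hreg (edge_rank n G i.+1).
      by rewrite /= p2 edge_rankS ci /binop_eval !wrapE; lia.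
    split=> //; split=> //= c.
    rewrite ltnS leq_eqVlt => /orP[/eqP->|cli] cc; first by rewrite eqxx.
    have := edge_rank_mono n G cli; rewrite edge_rankS cc addn1 => lt.
    by rewrite ltn_eqF // b2; apply: hb.
  + move=> ci; apply: halts_skip; split=> //; split=> //=.
      by rewrite p2 edge_rankS (negbTE ci) addn0.
    move=> c; rewrite ltnS leq_eqVlt => /orP[/eqP->|cli] cc; first by rewrite cc in ci.
    by rewrite b2; apply: hb.
move=> s1 [[pE hb hA hD] _] [fr fa].
have n1 : reg s1 r_n = n by rewrite fr.
hscell (2 + 3 * n + n) (edge_rank n G (n * n)).
hreg (edge_rank n G (n * n)).
split=> //= [a an|i ii]; last by rewrite (ltn_eqF (leq_trans ii (leq_addr _ _))) hD.
rewrite eqn_add2l; case: eqP => [->//|ne]; apply: hA.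
have n0 : 0 < n by lia.
by rewrite ltn_mul2r n0 ltn_neqAle an andbT; apply/eqP.
Qed.

Lemma write_level_spec s N sz lb (base : nat -> nat) :
  reg s r_N = N -> reg s r_sz = sz -> reg s r_lb = lb -> 0 < sz -> sz <= N ->
  (forall p q, p < N -> q < N -> base p = base q -> p = q) ->
  arr s a_base = base -> lb + 4 * N + 10 < 2 ^ w ->
  halts w write_level s (fun s' =>
    (forall p, p < N -> block_start sz p + sz <= N ->
       arr s' 0 (lb + sorted_pos sz base p) = base p) /\
    (forall i, i < lb -> arr s' 0 i = arr s 0 i)).
Proof.
move=> NE szE lbE sz0 szN base_inj baseE ovf.
apply: (halts_conseq (halts_for (I := fun i s' =>
    (forall p, p < i -> block_start sz p + sz <= N ->
       arr s' 0 (lb + sorted_pos sz base p) = base p) /\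
    (forall i, i < lb -> arr s' 0 i = arr s 0 i)) (N := N) w_gt1 _ _ _ _)) => //.
- lia.
- by move=> i s1 _ _ _ [fr _]; rewrite /= fr.
- move=> i s1 iltN [hs hD] xi [fr fa].
  have sz1 : reg s1 r_sz = sz by rewrite fr.
  have lb1 : reg s1 r_lb = lb by rewrite fr.
  have b1 : arr s1 a_base = base by rewrite fa.
  have /andP[bs1 _] := block_start_le sz0 i.
  have rk := block_rank_lt base sz0 i.
  have dv : i %/ sz <= i by apply: leq_div.
  apply: halts_seq; apply: (@halts_reg _ (block_start sz i)).
    by rewrite /= /binop_eval xi sz1 !wrapE; rewrite -/(block_start sz i); lia.
  hsreg 0.
  apply: halts_seq; apply: (halts_conseq (halts_for (I := fun o s' =>
    reg s' r_v = \sum_(o' < o) (base (block_start sz i + o') < base i)) (N := sz) w_gt1 _ _ _ _)).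
  + lia.
  + by rewrite /= big_ord0.
  + by move=> o s2 _ _ _ [fr2 _]; rewrite /= fr2.
  + move=> o s2 osz vE xo [fr2 fa2].
    have lo2 : reg s2 r_lo = block_start sz i by rewrite fr2.
    have z2 : reg s2 r_z = i by rewrite fr2.
    have bb : arr s2 a_base = base by rewrite fa2.
    have vle : \sum_(o' < o) (base (block_start sz i + o') < base i) <= o.
      rewrite -[X in _ <= X](card_ord o) -sum1_card; apply: leq_sum => k _.
      by case: (_ < _).
    apply: (@halts_reg _ (\sum_(o' < o.+1) (base (block_start sz i + o') < base i))).
      rewrite big_ord_recr /= vE lo2 z2 xo bb /binop_eval (@wrapE _ (block_start sz i + o)); last by lia.
      by rewrite (@wrapE _ (nat_of_bool _)) ?wrapE //; case: (_ < base i); lia.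
    by [].
  move=> s2 [vE _] [fr2 fa2].
  rewrite -/(block_rank sz base i) in vE.
  have lb2 : reg s2 r_lb = lb by rewrite fr2.
  have lo2 : reg s2 r_lo = block_start sz i by rewrite fr2.
  have z2 : reg s2 r_z = i by rewrite fr2.
  have bb : arr s2 a_base = base by rewrite fa2.
  have a02 : arr s2 0 = arr s1 0 by rewrite fa2.
  apply: (@halts_cell _ (lb + sorted_pos sz base i) (base i)).
  + by rewrite /= /binop_eval lb2 lo2 vE /sorted_pos !wrapE; lia.
  + by rewrite /= z2 bb.
  split=> //; split=> [p|j jl] /=; last by rewrite a02 ltn_eqF ?hD //; lia.
  rewrite eqn_add2l ltnS leq_eqVlt => /orP[/eqP->|pi] pb; first by rewrite eqxx.
  rewrite (negbTE (sorted_pos_neq sz0 base_inj iltN pb _)); last by rewrite ltn_eqF.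
  by rewrite a02; apply: hs.
- by move=> s1 [[h1 h2] _] _.
Qed.

(** An incomplete last block may spill past the end of its level. It does so only into cells above
    that level, and the later levels are written afterwards, so it is enough that [write_level]
    preserves the cells below [lb]. *)
Lemma write_levels_spec s N (base : nat -> nat) :
  reg s r_n = n -> reg s r_N = N -> N <= n * n ->
  (forall p q, p < N -> q < N -> base p = base q -> p = q) -> arr s a_base = base ->
  halts w write_levels s (fun s' => exists j,
    [/\ reg s' 0 = 4 * n + 3 + j * N, j <= levels_nb n, N < 2 ^ j,
       forall j' p, j' < j -> p < N -> block_start (2 ^ j') p + 2 ^ j' <= N ->
         arr s' 0 (4 * n + 3 + j' * N + sorted_pos (2 ^ j') base p) = base p &
       forall i, i < 4 * n + 3 -> arr s' 0 i = arr s 0 i]).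
Proof.
move=> nE NE Nn base_inj baseE.
have NJ : N < 2 ^ levels_nb n := leq_ltn_trans Nn (expn_levels n).
have JN : levels_nb n * N <= levels_nb n * (n * n) by rewrite leq_mul2l Nn orbT.
hsreg 1; hsreg (4 * n + 3).
apply: halts_seq.
apply: (@halts_while _ (fun k s' => exists j,
    [/\ reg s' r_sz = 2 ^ j, reg s' r_lb = 4 * n + 3 + j * N, j <= levels_nb n, k = levels_nb n - j &
     (forall j' p, j' < j -> p < N -> block_start (2 ^ j') p + 2 ^ j' <= N ->
         arr s' 0 (4 * n + 3 + j' * N + sorted_pos (2 ^ j') base p) = base p) /\
     (forall i, i < 4 * n + 3 -> arr s' 0 i = arr s 0 i)]) (levels_nb n - 0)).
  by exists 0; split=> //=; rewrite addn0.
move=> k s1 [j [szE lbE jJ -> [hs hD]]] [fr fa].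
have N1 : reg s1 r_N = N by rewrite fr.
exists (2 ^ j <= N); split.
- rewrite /= szE N1 /binop_eval !wrapE; try lia.
- move=> szN.
  have jlt : j < levels_nb n by rewrite -(ltn_exp2l _ _ (isT : 1 < 2)); apply: leq_ltn_trans NJ.
  have jNJ : j * N + N <= levels_nb n * N by rewrite -mulSnr leq_mul2r jlt orbT.
  have b1 : arr s1 a_base = base by rewrite fa.
  have sz0 : 0 < 2 ^ j by rewrite expn_gt0.
  apply: halts_seq; apply: (halts_conseq (write_level_spec N1 szE lbE sz0 szN base_inj b1 _)).
    by move: (j * N) jNJ => jN; move: (_ * N) JN => JN'; move: (_ * (n * n)) w_big; lia.
  move=> s2 [h1 h2] [fr2 fa2].
  have [N2 sz2 lb2] : [/\ reg s2 r_N = N, reg s2 r_sz = 2 ^ j & reg s2 r_lb = 4 * n + 3 + j * N].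
    by rewrite !fr2.
  hsreg (2 ^ j.+1).
    by rewrite /= sz2 expnSr /binop_eval !wrapE; lia.
  hreg (4 * n + 3 + j.+1 * N).
  exists (levels_nb n - j.+1); first by lia.
  exists j.+1; split=> //=; split=> [j' p|i ii]; last by rewrite h2 ?hD //; lia.
  rewrite ltnS leq_eqVlt => /orP[/eqP->|j'j] pN pb; first exact: h1.
  rewrite h2 ?hs //.
  have h0 : 0 < 2 ^ j' by rewrite expn_gt0.
  have := block_rank_lt base h0 p; rewrite /sorted_pos.
  have : j' * N + N <= j * N by rewrite -mulSnr leq_mul2r j'j orbT.
  by move: (j' * N) (j * N) => x1 x2; lia.
- rewrite -ltnNge => szN.
  have jNJ : j * N <= levels_nb n * N by rewrite leq_mul2r jJ orbT.
  hreg (4 * n + 3 + j * N).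
  by exists j; split.
Qed.

(** The data is described as a query will find it: cut at the output length and zero beyond. *)
Lemma build_dense_spec s :
  reg s r_n = n -> arr s 0 0 = n -> n < size E -> reg s 1 = 2 * size E -> stores s 1 0 E ->
  (forall x, 3 <= x -> reg s x = 0) -> (forall a i, 2 <= a -> arr s a i = 0) ->
  halts w build_dense s (fun s' =>
    (exists N I P S A base,
      dense_layout n E (fun i => if i < reg s' 0 then arr s' 0 i else 0) N I P S A base) /\
    reg s' 0 <= 4 * n + 3 + levels_nb n * (2 * size E)).
Proof.
move=> nE D0 nltE lenE stE r0 a0.
have J0 : 2 <= levels_nb n by rewrite /levels_nb; lia.
have J2 : 2 * (n * n) <= levels_nb n * (n * n) by rewrite leq_mul2r J0 orbT.
have n_lt : n + 10 < 2 ^ w by lia.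
apply: halts_seq; apply: (halts_conseq (halts_runs (init_trivial_spec n_lt w_gt1 nE))).
move=> s1 triv [fr1 fa1].
have st1 : stores s1 1 0 E by move=> e he; rewrite fa1 //; apply: stE.
apply: halts_seq; apply: (halts_conseq (halts_runs (@search_all_spec w n n_lt w_gt1 s1 0 (levels_nb n)
  no_edge (fun=> n) succn (fun=> 0) (fun=> 0) id [::] E
  (forest_trivial n) (codes_trivial n _) (levels_trivial (J := levels_nb n) _ _)
  _ _ _ _ _ _ _ _ _ _ _ _ _ _ _ _ _ _ _ _ _ _))) => //.
- by rewrite expn_gt0.
- by rewrite fr1 // r0 //; lia.
- lia.
- by rewrite /=; lia.
- by move=> v vn; have [-> _ _] := triv v vn.
- by move=> v vn; have [_ -> _] := triv v vn.
- by move=> v vn; have [_ _ ->] := triv v vn.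
- by move=> v _; rewrite fa1 // a0.
- by rewrite fr1.
- by rewrite fr1 // r0.
- by rewrite fr1 // r0.
- by move=> v; rewrite fa1 // a0.
- by move=> v; rewrite fa1 // a0.
- by move=> v; rewrite fa1 // a0.
- by rewrite fr1 // r0.
- by rewrite fr1.
move=> s2 [dd _ _] [fr2 fa2].
have {}dd : dfs_done n (extra n E) (arr s2 a_V) (arr s2 a_F) (arr s2 a_fin).
  apply: eq_dfs_done dd => a b /=; congr (extra n _ a b).
  by rewrite /relabel -[RHS]map_id; apply: eq_map => -[].
pose I v := arr s2 a_V v - 2.
have [VE I_inj] : _ /\ {in gtn n &, injective I} := dfs_times dd (fun v _ => erefl).
have n2 : reg s2 r_n = n by rewrite fr2 // fr1.
have len2 : reg s2 1 = 2 * size E by rewrite fr2 // fr1.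
apply: halts_seq; apply: (halts_conseq (@write_forest_spec s2 I n2 VE I_inj _)).
  move=> v vn; have [p1 _ _ _] := dd_par dd vn; have [t1 t2 t3] := dd_time dd (ltnW vn).
  by split=> //; lia.
move=> s3 [D30 D31 V3 D3] [fr3 fa3].
apply: halts_seq; apply: (halts_conseq (@write_matrix_spec s3 I _ _ _ _ _)).
- by rewrite fr3.
- by rewrite fr3.
- by move=> e he; rewrite fa3 // fa2 //; apply: st1.
- by move=> v vn; rewrite V3 //; split=> //; have [] := VE v vn.
- by move=> c; rewrite fa3 // fa2 // fa1 // a0.
move=> s4 adj4 [fr4 fa4].
set G := adj (relabel I E).
have n4 : reg s4 r_n = n by rewrite fr4 // fr3.
apply: halts_seq; apply: (halts_conseq (write_codes_spec n4 adj4)).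
move=> s5 [N5 b5 A5 D5] [fr5 fa5].
have n5 : reg s5 r_n = n by rewrite fr5.
set N := edge_rank n G (n * n) in N5.
have inj5 p q := base_inj b5 (p := p) (q := q).
apply: (halts_conseq (write_levels_spec n5 N5 (edge_rank_sq G) inj5 erefl)).
move=> s6 [j [size6 jJ Nj lev D6]] _; split; last first.
  rewrite size6 leq_add2l; apply: leq_mul => //.
  rewrite -(size_map (fun p => (I p.1, I p.2)) E); apply: edge_rank_le.
  by apply: below_relabel bE => v vn; have [] := VE v vn.
pose S i := arr s3 0 (2 + 2 * n + i).
pose P i := arr s3 0 (2 + n + i).
have fo : forest n G P S.
  apply: (dfs_forest dd bE (I := I)) => // v vn.
  - by have [_ h _] := D3 v vn.
  - by have [_ _ h] := D3 v vn.
have low i : i < 2 + 3 * n -> (if i < reg s6 0 then arr s6 0 i else 0) = arr s3 0 i.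
  move=> h; rewrite size6 ifT; last by lia.
  by rewrite D6 ?D5 ?fa4 //; lia.
exists N, I, P, S, (fun a => edge_rank n G (a * n)), (arr s5 a_base).
split.
- by rewrite low // D30 fa2 // fa1.
- by rewrite low ?D31; lia.
- move=> v vn; rewrite low; last by lia.
  by have [-> _ _] := D3 v vn; have [] := VE v vn.
- exact: I_inj.
- by move=> v vn; rewrite low //; lia.
- by move=> v vn; rewrite low //; lia.
- move=> v vn; rewrite size6 ifT; last by lia.
  by rewrite D6 ?A5 //; lia.
- by split=> //; apply: edge_rank_sq.
- exact: fo.
- apply: (edge_codes b5 (forest_sub fo)) => // x y Gxy.
  by split; [|rewrite /G adj_sym in Gxy]; apply: (forest_dom fo) Gxy.
- move=> j' b j'J bN.
  have sz0 : 0 < 2 ^ j' by rewrite expn_gt0.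
  (* A complete block of length [2 ^ j'] fits into [N < 2 ^ j]; for the levels that were not written
     there is nothing to prove. *)
  have jj : j' < j.
    rewrite -(ltn_exp2l _ _ (isT : 1 < 2)); apply: leq_ltn_trans Nj.
    by apply: leq_trans bN; rewrite leq_pmull.
  apply: (sorted_block sz0 inj5 (t := fun i =>
    if 4 * n + 3 + (j' * N + i) < reg s6 0 then arr s6 0 (4 * n + 3 + (j' * N + i)) else 0)) => // p pN pb.
  have := block_rank_lt (arr s5 a_base) sz0 p => rk.
  have pos_lt : sorted_pos (2 ^ j') (arr s5 a_base) p < N.
    by rewrite /sorted_pos; apply: leq_trans pb; rewrite ltn_add2l.
  rewrite size6 ifT; first by rewrite addnA lev.
  have : j' * N + N <= j * N by rewrite -mulSnr leq_mul2r jj orbT.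
  by move: (j' * N) (j * N) => x1 x2; lia.
Qed.

Lemma build_sparse_spec s :
  arr s 0 0 = n -> reg s 1 = 2 * size E -> stores s 1 0 E -> size E <= n ->
  halts w build_sparse s (fun s' =>
    [/\ reg s' 0 = 2 * size E + 2, arr s' 0 0 = n, arr s' 0 1 = 2 * size E & stores s' 0 2 E]).
Proof.
move=> D0 lenE stE sE.
apply: halts_seq; apply: (halts_conseq (halts_for (I := fun i s' =>
   arr s' 0 0 = n /\ forall v, v < i -> arr s' 0 (v + 2) = arr s 1 v) (N := 2 * size E) w_gt1 _ _ _ _)).
- lia.
- by split.
- by move=> i s1 _ _ _ [fr _]; rewrite /= fr.
- move=> i s1 iltE [h0 hv] xi [fr fa].
  hcell (i + 2) (arr s 1 i); first by rewrite /= xi fa.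
  split=> //; split=> [|v] /=; first by rewrite addn2.
  rewrite ltnS leq_eqVlt eqn_add2r => /orP[/eqP->|vi]; first by rewrite eqxx.
  by rewrite ltn_eqF //; apply: hv.
move=> s1 [[h0 hv] _] [fr fa].
hscell 1 (2 * size E); first by rewrite /= fr.
hreg (2 * size E + 2); first by rewrite /= fr // lenE /binop_eval !wrapE; lia.
split=> // e he; have [e1 e2] := stE e he; rewrite addn0 in e1.
have -> : e * 2 + 3 = e * 2 + 1 + 2 by lia.
have ne k : (k + 2 == 1) = false by rewrite addn2.
by rewrite /= !ne !hv ?e1 ?e2 //; lia.
Qed.

End Build.

(** * The theorem *)

Lemma eq_dense_layout n E (D D' : nat -> nat) N I P S A base :
  (forall i, D i = D' i) -> dense_layout n E D N I P S A base ->
  dense_layout n E D' N I P S A base.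
Proof.
move=> e []; rewrite !e => h1 h2 h3 h4 h5 h6 h7 h8 h9 h10 h11.
split=> //; try by move=> v vn; rewrite -e; eauto.
move=> j b jJ bN; have [k1 k2 k3] := h11 j b jJ bN.
split=> [i i' hi hi' ii|i hi|p hp].
- by rewrite -2!e; apply: k1.
- by have [p pb pE] := k2 i hi; exists p; rewrite -?e.
- by have [i ib iE] := k3 p hp; exists i; rewrite -?e.
Qed.

(** * Word size and encoding of the inputs *)

Section Words.
Variable n : nat.
Let w := word_size 20 n.

Lemma word_size_gt1 : 1 < w.
Proof. by rewrite /w /word_size mulnS. Qed.

Lemma word_size_big : levels_nb n * (n * n) + 4 * (n * n) + 100 * n + 100 < 2 ^ w.
Proof.
have nX : n < 2 ^ (log2 n).+1 by apply: trunc_log_ltn.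
have lX : (log2 n).+1 < 2 ^ (log2 n).+1 by apply: ltn_expl.
have X2 : 2 <= 2 ^ (log2 n).+1 by rewrite -[X in X <= _]expn1 leq_exp2l.
rewrite /w /word_size /levels_nb [20 * _]mulnC expnM.
move: (2 ^ (log2 n).+1) nX lX X2 => X nX lX X2; move: ((log2 n).+1) lX => l lX.
have nn : n * n <= X * X by apply: leq_mul; apply: ltnW.
have h1 : 2 * l * (n * n) <= 2 * (X * (X * X)).
  by rewrite [2 * (X * _)]mulnA; apply: leq_mul => //; rewrite leq_mul2l ltnW.
have XX : X <= X * X by rewrite leq_pmulr //; lia.
have XXX : X * X <= X * (X * X) by rewrite leq_pmull //; lia.
(* Here [2 ^ w] is [X ^ 20], split as [X ^ 8 * X ^ 12]: the first factor is at least 256 as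
   [X >= 2], the second at least [X ^ 3]. *)
apply: (@leq_trans (256 * (X * (X * X)))).
  move: (2 * l * (n * n)) h1 => a.
  by move: (X * (X * X)) (X * X) (n * n) nn XX XXX => X3 Xs n2; lia.
have -> : 256 * (X * (X * X)) = 2 ^ 8 * X ^ 3 by rewrite -[256]/(2 ^ 8) !(expnS X) expn0 muln1.
rewrite -[20]/(8 + 12) expnD leq_mul ?leq_exp2r //.
by rewrite leq_exp2l.
Qed.

Lemma load_small ins a i : nth 0 (nth [::] ins a) i <= n * n + n -> arr (load w ins) a i = nth 0 (nth [::] ins a) i.
Proof. by move=> h; rewrite /= wrapE //; have := word_size_big; lia. Qed.

Lemma load_fresh l0 l1 : fresh (load w [:: l0; l1]).
Proof.
split=> [[|[|x]] //|[|[|a]] // i] _; by rewrite /= !nth_nil // /Defs.wrap mod0n.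
Qed.

Variables (L : seq ('I_n * 'I_n)) (E : {set {set 'I_n}}).
Hypothesis E2 : edge_set E.
Hypothesis LE : lists_edges L E.

Lemma size_lists_edges : size L = #|E|.
Proof. by have := perm_size LE; rewrite size_map -cardE. Qed.

Lemma card_edge_set : 2 * #|E| <= n * n.
Proof.
have h : #|E| <= 'C(n, 2).
  rewrite -[X in 'C(X, _)]card_ord -card_draws; apply: subset_leq_card.
  by apply/subsetP => e /E2 e2; rewrite inE e2.
apply: (@leq_trans (2 * 'C(n, 2))); first by rewrite leq_mul2l.
have h' : n * n.-1 <= n * n by rewrite leq_mul2l leq_pred orbT.
by rewrite bin2; have := odd_double_half (n * n.-1); lia.
Qed.

Lemma size_edge_words : size (edge_words L) = 2 * size L.
Proof. by rewrite /edge_words; elim: L => //= p l IH; rewrite IH mulnS. Qed.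

Lemma nth_edge_words e : e < size L ->
  nth 0 (edge_words L) (e * 2) = (nth (0, 0) (nat_pairs L) e).1 /\
  nth 0 (edge_words L) (e * 2 + 1) = (nth (0, 0) (nat_pairs L) e).2.
Proof.
rewrite /edge_words; elim: L e => //= p l IH [|e] //= el.
by have [h1 h2] := IH e el; split; rewrite -?h1 -?h2 ?addn1.
Qed.

Lemma load_edges l0 : stores (load w [:: l0; edge_words L]) 1 0 (nat_pairs L).
Proof.
move=> e; rewrite size_map => eL; have [h1 h2] := nth_edge_words eL.
have [|b1 b2] := @below_nat_pairs n L (nth (0, 0) (nat_pairs L) e).
  by apply: mem_nth; rewrite size_map.
by rewrite addn0 !load_small /= ?h1 ?h2 //; apply: leq_trans (leq_addl _ _); apply: ltnW.
Qed.

Lemma load_len l0 : reg (load w [:: l0; edge_words L]) 1 = 2 * size (nat_pairs L).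
Proof.
rewrite /= size_edge_words size_map wrapE // size_lists_edges.
by have := card_edge_set; have := word_size_big; lia.
Qed.

End Words.

Section Main.
Variables (n : nat) (E : {set {set 'I_n}}) (L : seq ('I_n * 'I_n)).
Hypothesis E2 : edge_set E.
Hypothesis LE : lists_edges L E.
Let w := word_size 20 n.

Lemma log2_gt0 k : 1 < k -> 0 < log2 k.
Proof. by move=> k1; rewrite /log2 trunc_log_gt0 /=; lia. Qed.

Lemma build_spec :
  halts w build (load w [:: [:: n]; edge_words L]) (fun s' =>
    (forall s, (forall i, arr s 0 i = if i < reg s' 0 then arr s' 0 i else 0) ->
       data_ok n (nat_pairs L) s) /\
    reg s' 0 <= 150 * 100 * (#|E| * log2 n + 1)).
Proof.
have wb := word_size_big n; have w1 := word_size_gt1 n; rewrite -/w in wb w1.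
have sL : size (nat_pairs L) = #|E| by rewrite size_map (size_lists_edges LE).
have Enn := card_edge_set E2.
have [r0 a0] := load_fresh n [:: n] (edge_words L).
have lenE := load_len E2 LE [:: n]; have stE := @load_edges n L [:: n].
rewrite -/w in r0 a0 lenE stE.
set s0 := load _ _ in r0 a0 lenE stE *.
have D0 : arr s0 0 0 = n by rewrite /s0 /= wrapE //; lia.
have bE := @below_nat_pairs n L.
have E2' : 2 * size (nat_pairs L) <= n * n by rewrite sL.
clearbody s0.
hsreg n.
apply: (@halts_if _ (n < size (nat_pairs L))).
- by rewrite /= lenE /binop_eval !wrapE; lia.
- move=> nltm.
  apply: (halts_conseq (@build_dense_spec w n (nat_pairs L) bE E2' w1 wb _ _ _ _ _ _ _ _)) => //.
  + by move=> x x3; rewrite /= gtn_eqF // r0 //; lia.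
  move=> s' [[N [I [P [S [A [base D]]]]]] sz] _; split.
    move=> s hs; right; exists N, I, P, S, A, base.
    by apply: eq_dense_layout D => i; rewrite hs.
  apply: leq_trans sz _; rewrite sL in nltm *.
  (* A graph with an edge has [n >= 2], so the logarithm is positive and [#|E| * log2 n] absorbs the
     terms linear in [#|E|]. *)
  have l0 : 0 < log2 n by apply: log2_gt0; rewrite ltnNge; apply/negP => h; have := leq_mul h h; lia.
  have ml : #|E| <= #|E| * log2 n by rewrite leq_pmulr.
  rewrite /levels_nb; have -> : 2 * (log2 n).+1 * (2 * #|E|) = 4 * (#|E| * log2 n) + 4 * #|E|.
    by rewrite mulnCA !mulnA mulnS; nia.
  by move: (#|E| * log2 n) ml => x; lia.
- rewrite -leqNgt => mn.
  apply: (halts_conseq (@build_sparse_spec w n (nat_pairs L) E2' w1 wb _ _ _ _ _)) => //.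
  move=> s' [sz h0 h1 st] _; split.
    move=> s hs; left; split=> //.
    + by rewrite hs sz h0 addn2.
    + by rewrite hs sz h1 addn2.
    + move=> e he; have [st1 st2] := st e he; rewrite !hs sz !ifT ?st1 ?st2 //; lia.
  rewrite sz sL; have [m0|m0] := posnP #|E|; first by rewrite m0; lia.
  have l0 : 0 < log2 n by apply: log2_gt0; rewrite ltnNge; apply/negP => h; have := leq_mul h h; lia.
  have ml : #|E| <= #|E| * log2 n by rewrite leq_pmulr.
  by move: (#|E| * log2 n) ml => x; lia.
Qed.

(** The factor [150 * 100] has to cover [2 * 7100] for [n >= 2], and the cost 11400 for [n = 1],
    where the logarithm is 0 and only the summand 1 remains. *)
Lemma query_cost_le : query_cost n <= 150 * 100 * (n * log2 n ^ 3 + 1).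
Proof.
rewrite /query_cost /search_cost /levels_nb.
case: n => [|[|k]]; [by [] | by [] | ].
have l1 : 0 < log2 k.+2 by apply: log2_gt0.
move: (log2 k.+2) l1 => l l1.
have ll : l <= l * l by rewrite leq_pmulr.
have h : 2 * l.+1 * (80 * (2 * l.+1) + 200) <= 2080 * (l * l).
  rewrite -[2080]/(4 * 520) mulnACA; apply: leq_mul; lia.
have {}h : 2 * l.+1 * (80 * (2 * l.+1) + 200) + 80 + 4900 <= 100 * 71 * (l * l).
  by move: (_ * (80 * _ + _)) (l * l) h ll => x y; lia.
apply: (@leq_trans (2 * k.+2 * (100 * 71 * (l * l)))); first by apply: leq_mul => //; lia.
(* The cost is already of order [n * l ^ 2]; it is weakened to the cube from here on. *)
have -> : l ^ 3 = l * (l * l) by rewrite !expnS expn0 muln1.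
have lll : l * l <= l * (l * l) by rewrite leq_pmull.
have : k.+2 * (l * l) <= k.+2 * (l * (l * l)) by rewrite leq_mul2l lll.
by rewrite mulnACA; move: (k.+2 * (l * l)) (k.+2 * _) => x y; lia.
Qed.

End Main.

Theorem theorem6 :
  exists (build query : cmd) (c C : nat),
  forall (n m : nat) (E : {set {set 'I_n}}) (L : seq ('I_n * 'I_n)),
    edge_set E -> #|E| = m -> lists_edges L E ->
    exists D : seq nat,
      [/\ exists t : nat,
            computes (word_size c n) build [:: [:: n]; edge_words L] D t,
          size D <= C * (m * log2 n + 1)
        & forall (k : nat) (U : {set {set 'I_n}}) (M : seq ('I_n * 'I_n)),
            edge_set U -> #|U| = k -> k <= n -> lists_edges M U ->
            exists (par : option 'I_n -> option 'I_n) (t : nat),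
              [/\ computes (word_size c n) query [:: D; edge_words M]
                    (parent_words par) t,
                  t <= C * (n * log2 n ^ 3 + 1)
                & dfs_tree (add_root (E :|: U)) None par]].
Proof.
exists build, query, 20, (150 * 100) => n m E L E2 <- LE.
have [t [s' [ex [data sz]]]] := build_spec E2 LE.
have [_ hb] := exec_bounded ex (load_bounded _ _).
exists (output s'); split; [by exists t, s' | by rewrite size_mkseq | ].
move=> k U M U2 <- kn MU.
have sM : size (nat_pairs M) <= n by rewrite size_map (size_lists_edges MU).
have [|t1 [s1 [ex1 t1_le [I [V [F [fin [I_lt I_inj D r1 out]]]]]]]] :=
  query_spec (@below_nat_pairs n L) (@below_nat_pairs n M) sM (word_size_gt1 n)
    (word_size_big n) _ (load_fresh n (output s') (edge_words M)) (load_len U2 MU _)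
    (@load_edges n M _).
  (* By [hb] all words of the output survive loading, and the cells beyond its length are loaded as
     zeros. *)
  apply: data => i; rewrite /= wrapE.
    by case: ifP => h; [rewrite nth_mkseq | rewrite nth_default // size_mkseq leqNgt h].
  by case: (ltnP i (reg s' 0)) => h; [rewrite nth_mkseq | rewrite nth_default ?size_mkseq ?expn_gt0].
exists (tree_parent I F), t1; split.
- exists s1; split=> //; rewrite /output r1.
  exact: (parent_words_tree I_lt I_inj D out).
- exact: leq_trans t1_le (query_cost_le n).
- exact: (dfs_tree_parent LE MU I_lt I_inj D).
Qed.
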